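(* Consider a sequence of weighted graphs $G_n=(V_n,E_n,(c_{xy})_{xy\in E_n})$ with $|V_n|=n$ and site-weights $\pi=\pi_n$ which is finite-dimensional (Assumption A below) and uniformly elliptic (Assumption B below). Let $k=k_n\in\mathbb N$ be such that $k\to\infty$ and, for some $c_{\rm vol}\in[0,\infty)$, $\limsup_{n\to\infty}k/n^2\le c_{\rm vol}$. Then for all $\delta\in(0,1)$ there exists $C=C(\delta)>0$ such that $$\limsup_{n\to\infty}\mathbf d_k(t^+(C))\le\delta,\qquad \liminf_{n\to\infty}\mathbf d_k(t^-(C))\ge1-\delta,$$ where $t^\pm(C)=\frac{t_{\rm rel}}{2}\log k\pm C\,t_{\rm rel}$ and $\mathbf d_k(t)$ is the worst-case total variation distance to equilibrium at time $t$ of the $k$-particle Binomial Splitting process.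
   Context: Graphs are finite, connected, undirected, with positive symmetric edge weights $c_{xy}>0$; $\pi=(\pi(x))_{x\in V}$ is a probability measure on $V$ with $\pi(x)>0$ for all $x$. Everything depends on $n$; the dependence is dropped from the notation. $\|\psi\|_p^p=\sum_{x}\pi(x)|\psi(x)|^p$. Binomial Splitting $\mathrm{Bin}(k)$: continuous-time Markov chain on $\Omega_k=\{\xi\in\mathbb N_0^V:\sum_{x}\xi(x)=k\}$ with generator $\mathcal L^{\mathrm{Bin}(k)}f(\xi)=\sum_{xy\in E}c_{xy}\big(\mathbb E[f(\Xi^{xy}_\xi)]-f(\xi)\big)$, where $\Xi_\xi^{xy}(x)=Y$, $\Xi_\xi^{xy}(y)=\xi(x)+\xi(y)-Y$, $\Xi_\xi^{xy}(z)=\xi(z)$ for $z\ne x,y$, with $Y\sim\mathrm{Binomial}\big(\xi(x)+\xi(y),\frac{\pi(x)}{\pi(x)+\pi(y)}\big)$. Its semigroup is $\mathcal S^{\mathrm{Bin}(k)}_t$; $\nu\mathcal S^{\mathrm{Bin}(k)}_t$ is the law at time $t$ from initial law $\nu$. Its reversible measure is $\mu_{k,\pi}=\mathrm{Multinomial}(k,\pi)$. The worst-case TV distance is $\mathbf d_k(t)=\sup_{\xi\in\Omega_k}\|\delta_\xi\mathcal S^{\mathrm{Bin}(k)}_t-\mu_{k,\pi}\|_{\rm TV}$, where $\|\mu-\nu\|_{\rm TV}=\sup_A|\mu(A)-\nu(A)|$. For $k=1$ the process is a Markov chain on $V$ with reversible measure $\pi$ and Dirichlet form $\mathcal E_{\mathrm{Bin}(1)}(\psi)=\sum_{xy\in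 E}c_{xy}\frac{\pi(x)\pi(y)}{\pi(x)+\pi(y)}(\psi(x)-\psi(y))^2$. Let $\mathrm{gap}$ be its spectral gap (smallest positive eigenvalue of minus its generator) and $t_{\rm rel}=\mathrm{gap}^{-1}$. Assumption A (finite-dimensional geometries): for every $n$ there are positive constants $d=d(n)$, $t_{\rm Nash}=t_{\rm Nash}(n)$, $T=T(n)$ such that the Nash inequality $$\|\psi\|_2^{2(1+2/d)}\le t_{\rm Nash}\big(\mathcal E_{\mathrm{Bin}(1)}(\psi)+T^{-1}\|\psi\|_2^2\big)\|\psi\|_1^{4/d},\qquad \psi:V\to\mathbb R,$$ holds, and $d=O(1)$, $t_{\rm Nash}=O(t_{\rm rel})$, $T=\Theta(t_{\rm Nash})$ as $n\to\infty$. Assumption B (uniform ellipticity): for some $c_{\rm ell}\in[1,\infty)$, $\sup_n\frac{\max_{x\in V}\pi(x)}{\min_{y\in V}\pi(y)}\le c_{\rm ell}$. *)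

(* Defs.v *)
From HB Require Import structures.
From mathcomp Require Import all_boot all_order all_algebra.
From mathcomp Require Import all_classical all_reals all_analysis.

Set Implicit Arguments.
Unset Strict Implicit.
Unset Printing Implicit Defensive.

Import Order.TTheory GRing.Theory Num.Theory.
Import numFieldNormedType.Exports.

Local Open Scope classical_set_scope.
Local Open Scope ring_scope.

(* The conductance of a pair that is not an edge is never used. *)
Record wgraph (R : realType) := WGraph {
  vertex : finType;
  edge : rel vertex;
  cond : vertex -> vertex -> R;
  weight : vertex -> R;
  edge_sym : symmetric edge;
  edge_irr : irreflexive edge;
  edge_connected : forall x y, connect edge x y;
  cond_sym : forall x y, cond x y = cond y x;
  cond_gt0 : forall x y, edge x y -> 0 < cond x y;
  weight_gt0 : forall x, 0 < weight x;
  weight_sum1 : \sum_x weight x = 1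
}.

(* Sum over undirected edges of an expression F x y symmetric in x and y: each
   edge xy occurs twice, as (x, y) and as (y, x), whence the factor 1/2. *)
Definition edge_sum (R : realType) (G : wgraph R)
    (F : vertex G -> vertex G -> R) : R :=
  2^-1 * \sum_x \sum_(y | edge x y) F x y.

Section Markov.
Variables (R : realType) (T : finType).
Implicit Types (L : (T -> R) -> T -> R) (mu nu : T -> R).

(* exp (t L) f = \sum_m t ^ m / m! * L ^ m f *)
Definition semigroup L (t : R) (f : T -> R) (x : T) : R :=
  limn (series (fun m => exp_coeff t m * iter m L f x)).

Definition dirac_law (x : T) : T -> R := fun y => (y == x)%:R.

Definition law_at L (nu : T -> R) (t : R) : T -> R :=
  fun y => \sum_x nu x * semigroup L t (fun z => (z == y)%:R) x.

Definition prob_of mu (A : {set T}) : R := \sum_(x in A) mu x.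

Definition tv_dist mu nu : R :=
  sup (range (fun A : {set T} => `|prob_of mu A - prob_of nu A|)).

Definition is_eigenvalue L (lambda : R) : Prop :=
  exists f : T -> R, (exists x, f x != 0) /\ forall x, L f x = lambda * f x.

Definition spectral_gap L : R :=
  inf [set lambda | 0 < lambda /\ is_eigenvalue (fun f x => - L f x) lambda].

End Markov.

Notation config V k := {xi : {ffun V -> 'I_k.+1} | (\sum_x xi x == k)%N}.

Definition occ (V : finType) (k : nat) (xi : config V k) (x : V) : nat :=
  val xi x.

(* The default values of insubd and inord are not used when x != y and
   j <= occ xi x + occ xi y, see redistributeE. *)
Definition redistribute (V : finType) (k : nat) (xi : config V k) (x y : V)
    (j : nat) : config V k :=
  insubd xi [ffun z => inord (if z == x then j
                              else if z == y then occ xi x + occ xi y - j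
                              else occ xi z)%N].

Lemma redistributeE (V : finType) (k : nat) (xi : config V k) (x y : V)
    (j : nat) (z : V) : x != y -> (j <= occ xi x + occ xi y)%N ->
  occ (redistribute xi x y j) z = (if z == x then j
                              else if z == y then occ xi x + occ xi y - j
                              else occ xi z)%N.
Proof.
move=> xy jle.
pose g z := (if z == x then j else if z == y then occ xi x + occ xi y - j
             else occ xi z)%N.
have yx : y != x by rewrite eq_sym.
have gsum : (\sum_z g z = k)%N.
  rewrite -[RHS](eqP (valP xi)) (bigD1 x)//= (bigD1 y)//=.
  rewrite [in RHS](bigD1 x)//= [in RHS](bigD1 y)//= !addnA.
  rewrite /g eqxx (negbTE yx) eqxx subnKC//; congr addn.
  by apply: eq_bigr => i /andP[/negbTE-> /negbTE->].
have gle u : (g u < k.+1)%N by rewrite ltnS -gsum (bigD1 u)//= leq_addr.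
have gval u : nat_of_ord (@inord k (g u)) = g u by rewrite inordK.
rewrite /redistribute /occ val_insubd ifT; first by rewrite ffunE gval.
by rewrite -[X in _ == X]gsum; apply/eqP/eq_bigr => u _; rewrite ffunE gval.
Qed.

Section BinomialSplitting.
Variables (R : realType) (G : wgraph R).
Local Notation V := (vertex G).

Definition bin_gen (k : nat) (f : config V k -> R) (xi : config V k) : R :=
  edge_sum (fun x y => cond x y *
    (\sum_(j < (occ xi x + occ xi y).+1)
        binomial_pmf (occ xi x + occ xi y) (weight x / (weight x + weight y)) j
        * f (redistribute xi x y j)
     - f xi)).

Definition multinomial_law (k : nat) (xi : config V k) : R :=
  k`!%:R / (\prod_x (occ xi x)`!%:R) * \prod_x weight x ^+ occ xi x.

Definition worst_tv (k : nat) (t : R) : R :=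
  sup (range (fun xi : config V k =>
    tv_dist (law_at (@bin_gen k) (dirac_law R xi) t) (@multinomial_law k))).

Definition gap : R := spectral_gap (@bin_gen 1).

Definition trel : R := gap^-1.

Definition dirichlet (psi : V -> R) : R :=
  edge_sum (fun x y => cond x y * (weight x * weight y / (weight x + weight y))
                       * (psi x - psi y) ^+ 2).

Definition pnorm (p : R) (psi : V -> R) : R :=
  (\sum_x weight x * `|psi x| `^ p) `^ p^-1.

Definition nash_inequality (d tNash T : R) : Prop := forall psi : V -> R,
  pnorm 2 psi `^ (2 * (1 + 2 / d)) <=
  tNash * (dirichlet psi + T^-1 * pnorm 2 psi ^+ 2) * pnorm 1 psi `^ (4 / d).

End BinomialSplitting.

(* The graph on n = 1 vertex has no positive eigenvalue, so that trel makes
   sense for 1 < n only; G 0 and G 1 are unconstrained. *)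

Definition finite_dimensional (R : realType) (G : nat -> wgraph R) : Prop :=
  exists d tNash T : nat -> R,
  [/\ forall n, (1 < n)%N ->
        [/\ 0 < d n, 0 < tNash n, 0 < T n
          & nash_inequality (G n) (d n) (tNash n) (T n)],
      d =O_\oo (fun=> 1 : R),
      tNash =O_\oo (fun n => trel (G n))
    & T =Theta_\oo tNash].

Definition uniformly_elliptic (R : realType) (G : nat -> wgraph R) : Prop :=
  exists2 cell : R, 1 <= cell & forall n, (1 < n)%N ->
    sup (range (@weight R (G n))) / inf (range (@weight R (G n))) <= cell.

Definition cutoff_time (R : realType) (G : wgraph R) (k : nat) (C : R) : R :=
  trel G / 2 * ln k%:R + C * trel G.

(* Main.v *)
Require Import Defs.
From mathcomp Require Import all_boot all_order all_algebra.
From mathcomp Require Import all_classical all_reals all_analysis.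
From mathcomp Require Import ring lra.
Set Implicit Arguments.
Unset Strict Implicit.
Unset Printing Implicit Defensive.
Import Order.TTheory GRing.Theory Num.Theory.
Import numFieldNormedType.Exports.
Local Open Scope classical_set_scope.
Local Open Scope ring_scope.

(* Given the sequence w of edges that ring, the particles move independently,
   and a particle of density h (with respect to the weights) ends up with the
   density run w h obtained by averaging h along the edges of w.  So the law of
   the process is a mixture of product laws, and its distance to equilibrium is
   controlled by k times the energy E |h_t|^2 - 1 of the averaging process h.

   The energy has to decay like expR (- 2 gap t), whereas the Poincare
   inequality only gives expR (- gap t).  Let P be the one-particle semigroup.
   Along s |-> E |P_{t-s} h_s|^2 - 1, which goes from |P_t h_0|^2 - 1 to the
   energy at t, a ring of the edge e at time s contributes at most q_e times
   |P_{t-s} (delta_x - delta_y)|^2 as much as it lowers the energy, and this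
   factor is O(expR (- 2 gap (t - s)) / n) by the Nash inequality and uniform
   ellipticity, provided t - s is at least a small multiple tau of the
   relaxation time.  The last stretch of length tau is absorbed by induction on
   t, with steps tau.  The error made by using the weak decay of the energy in
   this argument is of relative order expR (gap t) / n, that is sqrt k / n.

   The lower bound is Wilson's second moment method for the eigenfunction phi of
   the gap, with independent particles of initial density 1 + phi / |phi|_oo:
   the Nash inequality bounds |phi|_oo, and the fluctuations of the averaging
   process are again of relative order sqrt k / n. *)

(** * Exponential generating functions *)

(** The last stretch closes for a numerical reason. There a ring is only known to raise the smoothed
    energy by at most as much as it lowers the energy, so the sum of the two does not increase. As
    they coincide at time t, twice the energy at t is at most the energy at t - tau plus a term that
    decays at the right rate. The factor 1/2 so gained outweighs the loss expR (2 gap tau) <= 3/2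
    caused by one step back. The relative error sqrt k / n is harmless precisely because k is at
    most of order n^2. The Nash inequality concerns a fixed function, but it passes to the mean
    energy because a power above 1 is convex. It makes the energy bounded after a time of order
    trel, whatever the initial density, and every other constant is derived from that bound. Given w
    the particles are independent, so the comparisons with equilibrium are second moment estimates
    for product laws. Their bounds are kept polynomial in the environment, of degree at most two, so
    that they can be averaged over w by the computed means. *)

Lemma is_derive_eq_pt (R : realType) (f : R -> R) (x d d' : R) :
  is_derive x 1 f d -> d = d' -> is_derive x 1 f d'.
Proof. by move=> H <-. Qed.

Lemma is_derive_ext (R : realType) (f g : R -> R) (x d : R) :
  f =1 g -> is_derive x 1 f d -> is_derive x 1 g d.
Proof. by move=> /funext <-. Qed.

Lemma is_derive_nondecreasing (R : realType) (f df : R -> R) (a b : R) :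
  a <= b -> (forall x, a <= x <= b -> is_derive x 1 f (df x)) ->
  (forall x, a <= x <= b -> 0 <= df x) -> f a <= f b.
Proof.
move=> ab hd h0.
have [||c] := @MVT_segment R f df a b ab.
- move=> x; rewrite in_itv/= => /andP[/ltW ax /ltW xb].
  by apply: hd; rewrite ax xb.
- apply: derivable_within_continuous => x; rewrite in_itv/= => axb.
  by have [] := hd x axb.
rewrite in_itv/= => cab fE.
by rewrite -subr_ge0 fE mulr_ge0 ?h0 ?subr_ge0.
Qed.

Lemma is_derive_nonincreasing (R : realType) (f df : R -> R) (a b : R) :
  a <= b -> (forall x, a <= x <= b -> is_derive x 1 f (df x)) ->
  (forall x, a <= x <= b -> df x <= 0) -> f b <= f a.
Proof.
move=> ab hd h0; rewrite -lerN2.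
apply: (@is_derive_nondecreasing R (fun x => - f x) (fun x => - df x)) => //.
  by move=> x /hd dfx; apply: is_deriveN.
by move=> x /h0; rewrite oppr_ge0.
Qed.

Section RealDerive.
Variable R : realType.
Implicit Types (f g : R -> R) (x c df dg : R).

Lemma is_derive_fcst c x : is_derive x 1 (fun=> c) 0.
Proof. exact: is_derive_cst. Qed.

Lemma is_derive_fadd f g x df dg : is_derive x 1 f df -> is_derive x 1 g dg ->
  is_derive x 1 (fun s => f s + g s) (df + dg).
Proof. by move=> hf hg; apply: is_deriveD. Qed.

Lemma is_derive_fsub f g x df dg : is_derive x 1 f df -> is_derive x 1 g dg ->
  is_derive x 1 (fun s => f s - g s) (df - dg).
Proof. by move=> hf hg; apply: is_deriveB. Qed.

Lemma is_derive_fmul f g x df dg : is_derive x 1 f df -> is_derive x 1 g dg ->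
  is_derive x 1 (fun s => f s * g s) (df * g x + f x * dg).
Proof.
move=> hf hg; apply: is_derive_eq_pt (is_deriveM hf hg) _.
by rewrite /GRing.scale/= addrC mulrC.
Qed.

Lemma is_derive_fscale c f x df : is_derive x 1 f df ->
  is_derive x 1 (fun s => c * f s) (c * df).
Proof.
move=> hf; apply: is_derive_eq_pt (is_derive_fmul (is_derive_fcst c x) hf) _.
by rewrite mul0r add0r.
Qed.

Lemma is_derive_fsum (I : finType) (F : I -> R -> R) (dF : I -> R) x :
  (forall i, is_derive x 1 (F i) (dF i)) ->
  is_derive x 1 (fun s => \sum_i F i s) (\sum_i dF i).
Proof.
move=> hF.
have -> : (fun s => \sum_i F i s) = \sum_i F i.
  by apply/funext => s; rewrite fct_sumE.
by elim/big_ind2 : _ => // [|] *; [exact: is_derive_cst|exact: is_deriveD].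
Qed.

Lemma is_derive_frefl c f x df : is_derive (c - x) 1 f df ->
  is_derive x 1 (fun s => f (c - s)) (- df).
Proof.
move=> hf.
have h : is_derive x 1 (fun s : R => c - s) (0 - 1).
  exact: is_derive_fsub (is_derive_fcst _ _) (is_derive_id _ _).
have hc := @is_derive1_comp R f (fun s => c - s) x _ _ hf h.
by apply: (is_derive_eq_pt hc); ring.
Qed.

Lemma is_derive_expRM (a x : R) :
  is_derive x 1 (fun s => expR (a * s)) (a * expR (a * x)).
Proof.
have h1 : is_derive x 1 (fun s : R => a * s) (a * 1).
  exact: is_derive_fscale (is_derive_id _ _).
have hc := @is_derive1_comp R expR (fun s => a * s) x _ _ (is_derive_expR _) h1.
by apply: (is_derive_eq_pt hc); ring.
Qed.

End RealDerive.

Section Egf.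
Variable R : realType.
Implicit Types (a b : R^nat) (t k : R).

Definition egf a (t : R) : R := limn (series (fun m => exp_coeff t m * a m)).

(** Such growth makes the series [egf a] converge for every [t], and it survives the shift by which
    [egf] is differentiated. *)
Definition geometric_bound a := exists B C : R, forall m, `|a m| <= C * B ^+ m.

Lemma geometric_boundP a : geometric_bound a ->
  exists B C : R, [/\ 0 <= B, 0 <= C & forall m, `|a m| <= C * B ^+ m].
Proof.
move=> [B [C aBC]]; exists `|B|, `|C|; split => // m.
by rewrite (le_trans (aBC m))// -normrX -normrM ler_norm.
Qed.

Lemma egf_cvg a t : geometric_bound a ->
  cvgn (series (fun m => exp_coeff t m * a m)).
Proof.
move=> /geometric_boundP[B [C [B0 C0 aBC]]]; apply: normed_cvg.
apply: (@series_le_cvg _ _ (fun m => C *: exp_coeff (`|t| * B) m)) => [m|m|m|].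
- exact: normr_ge0.
- by rewrite mulr_ge0// exp_coeff_ge0// mulr_ge0.
- rewrite /exp_coeff/= normrM normrM normfV normr_nat normrX.
  rewrite [leRHS]/GRing.scale/= exprMn.
  rewrite (_ : C * _ = `|t| ^+ m / m`!%:R * (C * B ^+ m)); last by ring.
  by rewrite ler_wpM2l// divr_ge0// exprn_ge0.
- apply: (@is_cvg_seriesZ _ _ C); exact: is_cvg_series_exp_coeff.
Qed.

Lemma egf0 a : egf a 0 = a 0%N.
Proof.
apply: lim_near_cst => //; near=> m.
rewrite -[m]prednK; last by near: m; exact: nbhs_infty_gt.
rewrite /series/= big_nat_recl//= big1_seq ?addr0.
  by rewrite /exp_coeff/= expr0 fact0 divr1 mul1r.
by move=> i _; rewrite /exp_coeff/= expr0n/= !mul0r.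
Unshelve. all: by end_near. Qed.

Lemma geometric_bound_shift a :
  geometric_bound a -> geometric_bound (fun m => a m.+1).
Proof.
move=> [B [C aBC]]; exists B, (C * B) => m.
by rewrite (le_trans (aBC _))// exprS mulrA.
Qed.

Lemma is_derive_egf a t : geometric_bound a ->
  is_derive t 1 (egf a) (egf (fun m => a m.+1) t).
Proof.
move=> ha.
pose c m := a m / m`!%:R.
have cE b s : (fun m => exp_coeff s m * b m) = (fun m => b m / m`!%:R * s ^+ m).
  by apply/funext => m; rewrite /exp_coeff/=; ring.
have dE (b : R^nat) : pseries_diffs (fun m => b m / m`!%:R) =
    (fun m => b m.+1 / m`!%:R).
  apply/funext => m; rewrite /pseries_diffs factS natrM invfM.
  by rewrite mulrCA mulVKf// pnatr_eq0.
have egfE b : egf b = (fun s => limn (pseries (fun m => b m / m`!%:R) s)).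
  by apply/funext => s; rewrite /egf/pseries cE.
have cv b s : geometric_bound b -> cvgn (pseries (fun m => b m / m`!%:R) s).
  by move=> hb; have := @egf_cvg b s hb; rewrite cE.
rewrite !egfE -dE.
have ha1 := geometric_bound_shift ha; have ha2 := geometric_bound_shift ha1.
(* The series converge everywhere, so any radius beyond the absolute value of [t] would do. *)
apply: (@pseries_snd_diffs _ _ (`|t| + 1)); rewrite ?dE; do ?exact: cv.
by rewrite [ltRHS]ger0_norm ?addr_ge0// ltrDl.
Qed.

Lemma egfD a b t : geometric_bound a -> geometric_bound b ->
  egf (fun m => a m + b m) t = egf a t + egf b t.
Proof.
move=> ha hb; rewrite /egf -lim_seriesD; do ?exact: egf_cvg.
by congr (limn (series _)); apply/funext => m; rewrite mulrDr.
Qed.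

Lemma egfZ a k t : geometric_bound a ->
  egf (fun m => k * a m) t = k * egf a t.
Proof.
move=> ha; rewrite /egf -[RHS]lim_seriesZ; last exact: egf_cvg.
by congr (limn (series _)); apply/funext => m; rewrite mulrCA.
Qed.

Lemma egf_ge0 a t : geometric_bound a -> 0 <= t -> (forall m, 0 <= a m) ->
  0 <= egf a t.
Proof.
move=> ha t0 a0; apply: limr_ge; first exact: egf_cvg.
apply: nearW => m; apply: sumr_ge0 => i _.
by rewrite mulr_ge0// exp_coeff_ge0.
Qed.

Lemma egf_exp k t : egf (fun m => k ^+ m) t = expR (k * t).
Proof.
rewrite /expR /egf; congr (limn (series _)); apply/funext => m.
by rewrite /exp_coeff/= exprMn; ring.
Qed.

End Egf.

(** * Semigroups of finite generators and of Poisson words *)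

Section FiniteSemigroup.
Variables (R : realType) (T : finType).
Implicit Types (L : (T -> R) -> T -> R) (f g : T -> R).

Definition lin_op L :=
  forall (a : R) f g x, L (fun z => a * f z + g z) x = a * L f x + L g x.

Lemma lin_op0 L x : lin_op L -> L (fun=> 0) x = 0.
Proof.
move=> hL; have := hL 1 (fun=> 0) (fun=> 0) x.
rewrite (_ : (fun z : T => 1 * 0 + 0) = (fun=> 0 : R)); last first.
  by apply/funext => z; rewrite mulr0 addr0.
by move=> h; lra.
Qed.

Lemma lin_op_sum L (I : Type) (r : seq I) (a : I -> R) (F : I -> T -> R) x :
  lin_op L -> L (fun z => \sum_(i <- r) a i * F i z) x =
              \sum_(i <- r) a i * L (F i) x.
Proof.
move=> hL; elim: r => [|i r IH].
  rewrite big_nil -[RHS](lin_op0 x hL); congr (L _ x).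
  by apply/funext => z; rewrite big_nil.
rewrite big_cons -IH -hL; congr (L _ x).
by apply/funext => z; rewrite big_cons.
Qed.

Lemma sum_dirac f x : \sum_y f y * dirac_law R y x = f x.
Proof.
rewrite (bigD1 x)//= /dirac_law eqxx mulr1 big1 ?addr0// => y yx.
by rewrite eq_sym (negbTE yx) mulr0.
Qed.

Lemma lin_opE L f x : lin_op L -> L f x = \sum_y f y * L (dirac_law R y) x.
Proof.
move=> hL; rewrite -lin_op_sum//; congr (L _ x).
by apply/funext => z; rewrite sum_dirac.
Qed.

Lemma lin_op_iter L m : lin_op L -> lin_op (iter m L).
Proof.
move=> hL; elim: m => [//|m IH] a f g x /=.
rewrite -hL; congr (L _ x); apply/funext => z; exact: IH.
Qed.

(** [B] sums the absolute values of all matrix entries of [L], so one application of [L] multiplies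
    a uniform bound by at most [B]. *)
Lemma geometric_bound_iter L f x : lin_op L ->
  geometric_bound (fun m => iter m L f x).
Proof.
move=> hL; pose B := \sum_x \sum_y `|L (dirac_law R y) x|.
exists B, (\sum_x `|f x|) => m.
elim: m x => [|m IH] x /=.
  by rewrite expr0 mulr1 (bigD1 x)//= lerDl sumr_ge0.
rewrite lin_opE// (le_trans (ler_norm_sum _ _ _))// exprSr mulrA.
apply: (@le_trans _ _
  (\sum_y (\sum_x `|f x|) * B ^+ m * `|L (dirac_law R y) x|)).
  by apply: ler_sum => y _; rewrite normrM ler_wpM2r.
rewrite -mulr_sumr ler_wpM2l//.
  by rewrite mulr_ge0 ?exprn_ge0 ?sumr_ge0// => i _; rewrite sumr_ge0.
by rewrite /B [leRHS](bigD1 x)//= lerDl sumr_ge0// => i _; rewrite sumr_ge0.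
Qed.

Lemma semigroupE L t f x : semigroup L t f x = egf (fun m => iter m L f x) t.
Proof. by []. Qed.

Lemma semigroup0 L f x : semigroup L 0 f x = f x.
Proof. exact: egf0. Qed.

Lemma geometric_bound_sum (I : Type) (r : seq I) (k : I -> R)
    (a : I -> R^nat) : (forall i, geometric_bound (a i)) ->
  geometric_bound (fun m => \sum_(i <- r) k i * a i m).
Proof.
move=> ha; elim: r => [|i r [B [C hBC]]].
  by exists 0, 0 => m; rewrite big_nil normr0 mul0r.
have /geometric_boundP[B' [C' [B'0 C'0 hBC']]] := ha i.
exists (`|B| + B'), (`|C| + `|k i| * C') => m; rewrite big_cons.
rewrite (le_trans (ler_normD _ _))// addrC mulrDl lerD//.
  rewrite (le_trans (hBC m))// (le_trans (ler_norm _))// normrM normrX.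
  by rewrite ler_wpM2l// lerXn2r ?nnegrE ?addr_ge0// lerDl.
rewrite normrM -mulrA ler_wpM2l// (le_trans (hBC' m))// ler_wpM2l//.
by rewrite lerXn2r ?nnegrE ?addr_ge0// lerDr.
Qed.

Lemma egf_sum (I : Type) (r : seq I) (k : I -> R) (a : I -> R^nat) t :
  (forall i, geometric_bound (a i)) ->
  egf (fun m => \sum_(i <- r) k i * a i m) t = \sum_(i <- r) k i * egf (a i) t.
Proof.
move=> ha; elim: r => [|i r IH].
  rewrite big_nil -[RHS](mul0r (egf (fun=> 0) t)).
  rewrite -egfZ; last by exists 0, 0 => m; rewrite normr0 mul0r.
  by congr (egf _ t); apply/funext => m; rewrite big_nil mul0r.
rewrite big_cons -IH -egfZ// -egfD.
- by congr (egf _ t); apply/funext => m; rewrite big_cons.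
- have := @geometric_bound_sum _ [:: i] k a ha.
  by under eq_fun do rewrite big_seq1.
- exact: geometric_bound_sum.
Qed.

Lemma semigroup_sum L t (I : Type) (r : seq I) (a : I -> R) (F : I -> T -> R)
    x : lin_op L ->
  semigroup L t (fun z => \sum_(i <- r) a i * F i z) x =
  \sum_(i <- r) a i * semigroup L t (F i) x.
Proof.
move=> hL; rewrite !semigroupE -egf_sum; last first.
  by move=> i; exact: geometric_bound_iter.
congr (egf _ t); apply/funext => m; apply: lin_op_sum; exact: lin_op_iter.
Qed.

Lemma semigroup_comm L t f x : lin_op L ->
  L (semigroup L t f) x = semigroup L t (L f) x.
Proof.
move=> hL; rewrite lin_opE//.
under eq_bigr do rewrite mulrC semigroupE.
rewrite -egf_sum; last by move=> i; exact: geometric_bound_iter.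
rewrite semigroupE; congr (egf _ t); apply/funext => m.
rewrite -iterSr iterS [RHS]lin_opE//.
by apply: eq_bigr => y _; rewrite mulrC.
Qed.

Lemma is_derive_semigroup L (t : R) f x : lin_op L ->
  is_derive t 1 (fun s => semigroup L s f x) (semigroup L t (L f) x).
Proof.
move=> hL; apply: is_derive_eq_pt.
  exact/is_derive_egf/geometric_bound_iter.
by rewrite semigroupE; congr (egf _ t); apply/funext => m; rewrite iterSr.
Qed.

(* Kolmogorov's forward equation has only one solution, since
   s |-> \sum_y v s y * semigroup L (t - s) f y is then constant. *)
Lemma forward_equation L (v : R -> T -> R) (t : R) f : lin_op L -> 0 <= t ->
  (forall (s : R) g, 0 <= s -> is_derive s 1 (fun s => \sum_y v s y * g y)
                                   (\sum_y v s y * L g y)) ->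
  \sum_y v t y * f y = \sum_y v 0 y * semigroup L t f y.
Proof.
move=> hL t0 hv.
have hvy (s : R) y : 0 <= s ->
    is_derive s 1 (v ^~ y) (\sum_z v s z * L (dirac_law R y) z).
  move=> s0; apply: is_derive_ext (hv s (dirac_law R y) s0) => r.
  under eq_bigr => z _ do rewrite /dirac_law eq_sym -/(dirac_law R z y).
  exact: sum_dirac.
pose F s := \sum_y v s y * semigroup L (t - s) f y.
have hF (s : R) : 0 <= s <= t -> is_derive s 1 F 0.
  move=> /andP[s0 _].
  have hd y := is_derive_fmul (hvy s y s0)
    (is_derive_frefl (is_derive_semigroup (t - s) f y hL)).
  apply: is_derive_eq_pt (is_derive_fsum hd) _.
  under eq_bigr do rewrite mulrN mulr_suml.
  rewrite big_split/= sumrN exchange_big/=; apply/eqP; rewrite subr_eq0.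
  apply/eqP/eq_bigr => z _; rewrite -semigroup_comm// [in RHS]lin_opE//.
  by rewrite mulr_sumr; apply: eq_bigr => y _; rewrite -mulrA; congr *%R;
    exact: mulrC.
have -> : \sum_y v t y * f y = F t.
  by apply: eq_bigr => y _; rewrite subrr semigroup0.
have -> : \sum_y v 0 y * semigroup L t f y = F 0.
  by apply: eq_bigr => y _; rewrite subr0.
apply/eqP; rewrite eq_le; apply/andP; split.
  by apply: (is_derive_nonincreasing (df := fun=> 0)).
by apply: (is_derive_nondecreasing (df := fun=> 0)).
Qed.

End FiniteSemigroup.

Section Words.
Variables (R : realType) (E : finType) (c : E -> R).
Hypothesis c_ge0 : forall e, 0 <= c e.
Implicit Types (Psi : seq E -> R).

(** Iterated [m] times and evaluated at the empty word, it sums [Psi] over the words of length [m],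
    each weighted by the product of the rates of its letters. *)
Definition word_op Psi (w : seq E) : R := \sum_e c e * Psi (e :: w).

Lemma word_opE Psi w : word_op Psi w = \sum_e c e * Psi (e :: w).
Proof. by []. Qed.

Definition word_gen Psi (w : seq E) : R := \sum_e c e * (Psi (e :: w) - Psi w).

Definition bounded_word Psi := exists C : R, forall w, `|Psi w| <= C.

(* The expectation of Psi at the word of the marks of a marked Poisson process
   of intensity c on [0, t], latest mark first. *)
Definition word_mean (t : R) Psi : R :=
  expR (- (\sum_e c e) * t) * egf (fun m => iter m word_op Psi [::]) t.

Lemma bounded_word_sum (I : finType) (a : I -> R) (F : I -> seq E -> R) :
  (forall i, bounded_word (F i)) ->
  bounded_word (fun w => \sum_i a i * F i w).
Proof.
move=> hF; have /choice[C hC] := hF.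
exists (\sum_i `|a i| * C i) => w.
rewrite (le_trans (ler_norm_sum _ _ _))//; apply: ler_sum => i _.
by rewrite normrM ler_wpM2l.
Qed.

Lemma bounded_wordD Psi1 Psi2 : bounded_word Psi1 -> bounded_word Psi2 ->
  bounded_word (fun w => Psi1 w + Psi2 w).
Proof.
move=> [C1 h1] [C2 h2]; exists (C1 + C2) => w.
by rewrite (le_trans (ler_normD _ _))// lerD.
Qed.

Lemma bounded_wordM Psi1 Psi2 : bounded_word Psi1 -> bounded_word Psi2 ->
  bounded_word (fun w => Psi1 w * Psi2 w).
Proof.
move=> [C1 h1] [C2 h2]; exists (C1 * C2) => w.
by rewrite normrM ler_pM.
Qed.

Lemma bounded_word_cst (k : R) : bounded_word (fun=> k).
Proof. by exists `|k|. Qed.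

Lemma bounded_wordZ (k : R) Psi : bounded_word Psi ->
  bounded_word (fun w => k * Psi w).
Proof. exact: bounded_wordM (bounded_word_cst k). Qed.

Lemma bounded_wordB Psi1 Psi2 : bounded_word Psi1 -> bounded_word Psi2 ->
  bounded_word (fun w => Psi1 w - Psi2 w).
Proof.
move=> h1 h2; have := bounded_wordD h1 (bounded_wordZ (-1) h2).
by under eq_fun do rewrite mulN1r.
Qed.

Lemma bounded_word_cons Psi e : bounded_word Psi ->
  bounded_word (fun w => Psi (e :: w)).
Proof. by move=> [C hC]; exists C. Qed.

Lemma bounded_word_gen Psi : bounded_word Psi -> bounded_word (word_gen Psi).
Proof.
move=> h; apply: bounded_word_sum => e.
by apply: bounded_wordB => //; exact: bounded_word_cons.
Qed.

Lemma word_op_sum m (I : Type) (r : seq I) (a : I -> R) (F : I -> seq E -> R)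
    w : iter m word_op (fun w => \sum_(i <- r) a i * F i w) w =
  \sum_(i <- r) a i * iter m word_op (F i) w.
Proof.
elim: m w => [//|m IH] w; rewrite iterS word_opE.
under eq_bigr do rewrite IH mulr_sumr.
rewrite exchange_big/=; apply: eq_bigr => i _; rewrite word_opE mulr_sumr.
by apply: eq_bigr => e _; rewrite mulrCA.
Qed.

Lemma geometric_bound_word Psi w : bounded_word Psi ->
  geometric_bound (fun m => iter m word_op Psi w).
Proof.
move=> [C hC]; exists (\sum_e c e), C => m.
elim: m w => [|m IH] w /=; first by rewrite expr0 mulr1.
rewrite (le_trans (ler_norm_sum _ _ _))// exprSr mulrA mulr_sumr.
by apply: ler_sum => e _; rewrite normrM (ger0_norm (c_ge0 e)) mulrC ler_wpM2r.
Qed.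

Lemma word_mean_sum t (I : Type) (r : seq I) (a : I -> R)
    (F : I -> seq E -> R) : (forall i, bounded_word (F i)) ->
  word_mean t (fun w => \sum_(i <- r) a i * F i w) =
  \sum_(i <- r) a i * word_mean t (F i).
Proof.
move=> hF; rewrite /word_mean.
under [fun m => iter m _ _ _]eq_fun do rewrite word_op_sum.
rewrite egf_sum => [|i]; last exact: geometric_bound_word.
by rewrite mulr_sumr; apply: eq_bigr => i _; rewrite mulrCA.
Qed.

Lemma word_meanZ t (k : R) Psi : bounded_word Psi ->
  word_mean t (fun w => k * Psi w) = k * word_mean t Psi.
Proof.
move=> h; have := @word_mean_sum t unit [:: tt] (fun=> k) (fun=> Psi) (fun=> h).
rewrite big_seq1 => <-; congr (word_mean t _).
by apply/funext => w; rewrite big_seq1.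
Qed.

Lemma word_meanD t Psi1 Psi2 : bounded_word Psi1 -> bounded_word Psi2 ->
  word_mean t (fun w => Psi1 w + Psi2 w) = word_mean t Psi1 + word_mean t Psi2.
Proof.
move=> h1 h2.
have := @word_mean_sum t bool [:: true; false] (fun=> 1)
  (fun b => if b then Psi1 else Psi2).
rewrite 2!big_cons big_nil addr0 !mul1r => <-; last by case.
by congr (word_mean t _); apply/funext => w;
  rewrite 2!big_cons big_nil addr0 !mul1r.
Qed.

Lemma word_meanB t Psi1 Psi2 : bounded_word Psi1 -> bounded_word Psi2 ->
  word_mean t (fun w => Psi1 w - Psi2 w) = word_mean t Psi1 - word_mean t Psi2.
Proof.
move=> h1 h2; have := word_meanD t h1 (bounded_wordZ (-1) h2).
by rewrite word_meanZ// mulN1r; under eq_fun do rewrite mulN1r.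
Qed.

Lemma word_mean_cst t (k : R) : word_mean t (fun=> k) = k.
Proof.
have it m w : iter m word_op (fun=> k) w = k * (\sum_e c e) ^+ m.
  elim: m w => [|m IH] w; first by rewrite mulr1.
  rewrite iterS word_opE; under eq_bigr do rewrite IH.
  by rewrite -mulr_suml exprS; ring.
rewrite /word_mean; under [fun m => iter m _ _ _]eq_fun do rewrite it.
rewrite egfZ; last by exists (\sum_e c e), 1 => m;
  rewrite normrX mul1r ger0_norm// sumr_ge0.
by rewrite egf_exp mulrCA mulNr -expRD addNr expR0 mulr1.
Qed.

Lemma word_mean_ge0 t Psi : 0 <= t -> bounded_word Psi ->
  (forall w, 0 <= Psi w) -> 0 <= word_mean t Psi.
Proof.
move=> t0 hb h0; rewrite mulr_ge0 ?expR_ge0//.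
apply: egf_ge0 => //; first exact: geometric_bound_word.
move=> m; elim: m [::] => [//|m IH] w /=.
by apply: sumr_ge0 => e _; rewrite mulr_ge0.
Qed.

Lemma word_mean_le t Psi1 Psi2 : 0 <= t -> bounded_word Psi1 ->
  bounded_word Psi2 -> (forall w, Psi1 w <= Psi2 w) ->
  word_mean t Psi1 <= word_mean t Psi2.
Proof.
move=> t0 h1 h2 h12; rewrite -subr_ge0 -word_meanB//.
apply: word_mean_ge0 => //; first exact: bounded_wordB.
by move=> w; rewrite subr_ge0.
Qed.

Lemma word_mean0 Psi : word_mean 0 Psi = Psi [::].
Proof. by rewrite /word_mean mulr0 expR0 mul1r egf0. Qed.

Lemma is_derive_word_mean (t : R) Psi : bounded_word Psi ->
  is_derive t 1 (word_mean ^~ Psi) (word_mean t (word_gen Psi)).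
Proof.
move=> hb.
have hd := is_derive_fmul (is_derive_expRM (- \sum_e c e) t)
  (is_derive_egf t (geometric_bound_word [::] hb)).
apply: is_derive_eq_pt hd _.
have -> : word_gen Psi = fun w => word_op Psi w - (\sum_e c e) * Psi w.
  apply/funext => w; rewrite /word_op mulr_suml -sumrB.
  by apply: eq_bigr => e _; rewrite mulrBr.
have hop : bounded_word (word_op Psi).
  by apply: bounded_word_sum => e; exact: bounded_word_cons.
rewrite word_meanB//; last exact: bounded_wordZ.
rewrite word_meanZ// /word_mean.
under [fun m => iter m _ (word_op _) _]eq_fun do rewrite -iterSr.
ring.
Qed.

(** The functional itself may depend on time, but only through the coefficients of a finite sum of
    fixed functionals, where the product rule suffices. Needed for [smoothed]. *)
Lemma is_derive_word_mean_sum (I : finType) (a : I -> R -> R) (da : I -> R)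
    (F : I -> seq E -> R) (t : R) :
  (forall i, bounded_word (F i)) -> (forall i, is_derive t 1 (a i) (da i)) ->
  is_derive t 1 (fun s => word_mean s (fun w => \sum_i a i s * F i w))
    (word_mean t (fun w => \sum_i da i * F i w +
                           word_gen (fun w => \sum_i a i t * F i w) w)).
Proof.
move=> hF ha.
have hd i := is_derive_fmul (ha i) (is_derive_word_mean t (hF i)).
apply: (is_derive_ext (f := fun s => \sum_i a i s * word_mean s (F i))).
  by move=> s; rewrite word_mean_sum.
apply: is_derive_eq_pt (is_derive_fsum hd) _.
rewrite big_split/= -!word_mean_sum//; last first.
  by move=> i; exact: bounded_word_gen.
rewrite -word_meanD; last 2 first.
- exact: bounded_word_sum.
- by apply: bounded_word_sum => i; exact: bounded_word_gen.
congr (word_mean t _); apply/funext => w; congr (_ + _).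
rewrite /word_gen; under [LHS]eq_bigr do rewrite mulr_sumr.
rewrite exchange_big/=; apply: eq_bigr => e _.
rewrite -sumrB mulr_sumr; apply: eq_bigr => i _; ring.
Qed.

End Words.

(** * Resampling operators *)

Section Resampling.
Variables (R : realType) (G : wgraph R).
Local Notation V := (vertex G).
Local Notation p := (@weight R G).
Implicit Types (f g h : V -> R) (e : V * V) (x y z : V) (w : seq (V * V)).

(* Every undirected edge is indexed by its two orientations, each of them
   carrying half of its conductance. *)
Definition rate e : R := if edge e.1 e.2 then cond e.1 e.2 / 2 else 0.

Lemma rate_ge0 e : 0 <= rate e.
Proof. by rewrite /rate; case: ifP => // /cond_gt0 /ltW c0; rewrite divr_ge0. Qed.

Lemma rate_diag x : rate (x, x) = 0.
Proof. by rewrite /rate/= edge_irr. Qed.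

Lemma edge_sumE (F : V -> V -> R) :
  edge_sum (fun x y => cond x y * F x y) = \sum_e rate e * F e.1 e.2.
Proof.
rewrite /edge_sum mulr_sumr.
rewrite -(pair_big xpredT xpredT (fun x y => rate (x, y) * F x y))/=.
apply: eq_bigr => x _; rewrite mulr_sumr big_mkcond/=.
by apply: eq_bigr => y _; rewrite /rate/=; case: ifP => _; rewrite ?mul0r//; ring.
Qed.

Definition dot f g : R := \sum_x p x * f x * g x.

Definition delta x : V -> R := fun z => (z == x)%:R / p x.

Definition qe e : R := p e.1 * p e.2 / (p e.1 + p e.2).

Definition resample e f : V -> R := fun z =>
  if (z == e.1) || (z == e.2)
  then (p e.1 * f e.1 + p e.2 * f e.2) / (p e.1 + p e.2) else f z.

Definition grad e f : R := f e.1 - f e.2.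

Lemma weight_neq0 x : p x != 0.
Proof. by rewrite gt_eqF// weight_gt0. Qed.

Lemma weightD_neq0 x y : p x + p y != 0.
Proof. by rewrite gt_eqF// addr_gt0// weight_gt0. Qed.

Lemma qe_ge0 e : 0 <= qe e.
Proof.
by rewrite /qe divr_ge0 ?mulr_ge0 ?addr_ge0//; apply/ltW/weight_gt0.
Qed.

Lemma qe_le e : qe e <= p e.1.
Proof.
rewrite /qe ler_pdivrMr ?addr_gt0 ?weight_gt0// ler_pM2l ?weight_gt0//.
by rewrite lerDr ltW// weight_gt0.
Qed.

(** Averaging along an edge is a rank-one perturbation of the identity in the direction of the
    dipole [delta e.1 - delta e.2]. The formulas for inner products and for the walk of a resampled
    function come from this form. *)
Lemma resampleE e f z :
  resample e f z = f z - qe e * grad e f * (delta e.1 z - delta e.2 z).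
Proof.
case: e => x y; rewrite /resample /qe /grad /delta/=.
have px := weight_neq0 x; have py := weight_neq0 y.
have pxy := weightD_neq0 x y.
have [->|zx] := eqVneq z x.
  have [->|xy] := eqVneq x y => /=; first by field; rewrite py weightD_neq0.
  by field; rewrite px py pxy.
have [->|zy] := eqVneq z y => /=; last by rewrite !mul0r subrr mulr0 subr0.
by field; rewrite px py pxy.
Qed.

Lemma dotC f g : dot f g = dot g f.
Proof. by apply: eq_bigr => x _; rewrite mulrAC. Qed.

Lemma dot_delta f x : dot f (delta x) = f x.
Proof.
rewrite /dot (bigD1 x)//= big1 ?addr0 => [|y /negbTE yx].
  by rewrite /delta eqxx mul1r; field; exact: weight_neq0.
by rewrite /delta yx mul0r mulr0.
Qed.

Lemma dotDl f g h (a : R) :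
  dot (fun z => a * f z + g z) h = a * dot f h + dot g h.
Proof.
rewrite /dot mulr_sumr -big_split/=; apply: eq_bigr => x _; ring.
Qed.

Lemma dotBl f g h : dot (fun z => f z - g z) h = dot f h - dot g h.
Proof. rewrite /dot -sumrB; apply: eq_bigr => x _; ring. Qed.

Lemma dotBr f g h : dot h (fun z => f z - g z) = dot h f - dot h g.
Proof. by rewrite dotC dotBl !(dotC h). Qed.

Lemma dotZl f g (a : R) : dot (fun z => a * f z) g = a * dot f g.
Proof. rewrite /dot mulr_sumr; apply: eq_bigr => x _; ring. Qed.

Lemma dotZr f g (a : R) : dot f (fun z => a * g z) = a * dot f g.
Proof. by rewrite dotC dotZl dotC. Qed.

Lemma dot_ge0 f : 0 <= dot f f.
Proof.
apply: sumr_ge0 => x _; rewrite -mulrA -expr2 mulr_ge0 ?sqr_ge0//.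
exact/ltW/weight_gt0.
Qed.

Lemma dot11 : dot (fun=> 1) (fun=> 1) = 1.
Proof. by rewrite /dot; under eq_bigr do rewrite !mulr1; exact: weight_sum1. Qed.

Lemma dot_center f : dot (fun=> 1) f = 1 ->
  dot (fun z => f z - 1) (fun z => f z - 1) = dot f f - 1.
Proof.
by move=> f1; rewrite dotBl !dotBr dot11 f1 dotC f1; ring.
Qed.

Lemma dotB_le f g : dot (fun z => f z - g z) (fun z => f z - g z) <=
  2 * dot f f + 2 * dot g g.
Proof.
rewrite /dot !mulr_sumr -big_split/=; apply: ler_sum => x _.
rewrite -subr_ge0; have := weight_gt0 x; set a := f x; set b := g x => hp.
have -> : 2 * (p x * a * a) + 2 * (p x * b * b) - p x * (a - b) * (a - b) =
  p x * (a + b) ^+ 2 by ring.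

by rewrite mulr_ge0 ?sqr_ge0// ltW.
Qed.

Lemma dot_resample e f g :
  dot (resample e f) g = dot f g - qe e * grad e f * grad e g.
Proof.
have -> : resample e f =
    fun z => f z - (qe e * grad e f) * (delta e.1 z - delta e.2 z).
  by apply/funext => z; rewrite resampleE.
by rewrite dotBl dotZl dotBl !(dotC _ g) !dot_delta.
Qed.

Lemma dot_resampleC e f g : dot (resample e f) g = dot f (resample e g).
Proof. by rewrite dot_resample [RHS]dotC dot_resample dotC; ring. Qed.

Lemma grad_resample e f : grad e (resample e f) = 0.
Proof.
by rewrite /grad /resample !eqxx/= orbT subrr.
Qed.

(** [resample e] is an orthogonal projection: it is self-adjoint and leaves no gradient along
    [e]. *)
Lemma norm_resample e f :
  dot (resample e f) (resample e f) = dot f f - qe e * grad e f ^+ 2.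
Proof.
rewrite dot_resample grad_resample mulr0 subr0 dotC dot_resample; ring.
Qed.

Lemma resample_cst e (a : R) z : resample e (fun=> a) z = a.
Proof.
rewrite /resample; case: ifP => // _; rewrite -mulrDl mulrC mulrA mulVf ?mul1r//.
exact: weightD_neq0.
Qed.

Lemma lin_op_resample e : lin_op (resample e).
Proof.
move=> a f g x; rewrite !resampleE /grad; ring.
Qed.

Definition gen1 f z : R := \sum_e rate e * (resample e f z - f z).

Lemma lin_op_gen1 : lin_op gen1.
Proof.
move=> a f g x; rewrite /gen1 mulr_sumr -big_split/=.
by apply: eq_bigr => e _; rewrite lin_op_resample; ring.
Qed.

Lemma dot_gen1 f g : dot (gen1 f) g = - \sum_e rate e * (qe e * grad e f * grad
  e g).
Proof.
rewrite /dot /gen1.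
under eq_bigr do rewrite mulr_sumr mulr_suml.
rewrite exchange_big/= -sumrN; apply: eq_bigr => e _.
have := dot_resample e f g => /eqP; rewrite -subr_eq0 opprB => /eqP h.
transitivity (rate e * (dot (resample e f) g - dot f g)).
  by rewrite /dot -sumrB mulr_sumr; apply: eq_bigr => x _; ring.
by rewrite dot_resample; ring.
Qed.

Lemma dirichletE f : dirichlet f = \sum_e rate e * (qe e * grad e f ^+ 2).
Proof.
rewrite /dirichlet.
have := edge_sumE (fun x y => p x * p y / (p x + p y) * (f x - f y) ^+ 2).
rewrite /grad /qe => <-; rewrite /edge_sum; congr (_ * _).
by apply: eq_bigr => x _; apply: eq_bigr => y _; rewrite -!mulrA.
Qed.

Lemma dirichlet_ge0 f : 0 <= dirichlet f.
Proof.
rewrite dirichletE; apply: sumr_ge0 => e _.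
by rewrite mulr_ge0 ?rate_ge0// mulr_ge0 ?qe_ge0 ?sqr_ge0.
Qed.

Lemma dot_gen1_dirichlet f : dot (gen1 f) f = - dirichlet f.
Proof.
rewrite dot_gen1 dirichletE; congr (- _); apply: eq_bigr => e _.
by rewrite -mulrA -expr2.
Qed.

Lemma dot_gen1C f g : dot (gen1 f) g = dot f (gen1 g).
Proof.
rewrite dot_gen1 [RHS]dotC dot_gen1; congr (- _).
by apply: eq_bigr => e _; rewrite mulrAC.
Qed.

Definition density h := (forall x, 0 <= h x) /\ dot (fun=> 1) h = 1.

Lemma density_delta x : density (delta x).
Proof.
split => [z|]; last exact: dot_delta.
by rewrite /delta divr_ge0// ltW// weight_gt0.
Qed.

Lemma density_resample e h : density h -> density (resample e h).
Proof.
move=> [h0 h1]; split => [z|].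
  rewrite /resample; case: ifP => // _.
  by rewrite divr_ge0 ?addr_ge0 ?mulr_ge0//; apply/ltW/weight_gt0.
rewrite -dot_resampleC -h1; congr (dot _ _).
by apply/funext => z; rewrite resample_cst.
Qed.

(** [foldr] applies the head of the word last, in agreement with the convention that the head is the
    latest ring. *)
Definition run w h := foldr resample h w.

Lemma density_run w h : density h -> density (run w h).
Proof. by move=> hh; elim: w => //= e w; exact: density_resample. Qed.

Lemma density_norm_ge1 h : density h -> 1 <= dot h h.
Proof.
by move=> [_ h1]; rewrite -subr_ge0 -dot_center// dot_ge0.
Qed.

Lemma norm_run_le w h : dot (run w h) (run w h) <= dot h h.
Proof.
elim: w => //= e w IH; rewrite norm_resample (le_trans _ IH)// gerBl.
by rewrite mulr_ge0 ?qe_ge0 ?sqr_ge0.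
Qed.

Lemma bounded_word_run f x : bounded_word (fun w => run w f x).
Proof.
pose C := \sum_x `|f x|.
have fC z : `|f z| <= C by rewrite /C (bigD1 z)//= lerDl sumr_ge0.
exists C => w; elim: w x => [//|e w IH] x /=.
rewrite /resample; case: ifP => // _.
have p1 := weight_gt0 e.1; have p2 := weight_gt0 e.2.
rewrite normrM normfV (gtr0_norm (addr_gt0 p1 p2)) ler_pdivrMr ?addr_gt0//.
rewrite (le_trans (ler_normD _ _))// !normrM (gtr0_norm p1) (gtr0_norm p2).
by rewrite [leRHS]mulrC mulrDl lerD// ler_pM2l.
Qed.

Lemma bounded_word_dot_run f g : bounded_word (fun w => dot (run w f) g).
Proof.
have -> : (fun w => dot (run w f) g) =
    (fun w => \sum_x (p x * g x) * run w f x).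
  by apply/funext => w; apply: eq_bigr => x _; rewrite mulrAC.
by apply: bounded_word_sum; exact: bounded_word_run.
Qed.

Lemma bounded_word_norm_run f : bounded_word (fun w => dot (run w f) (run w f)).
Proof.
exists (dot f f) => w; rewrite ger0_norm ?dot_ge0//; exact: norm_run_le.
Qed.

Lemma bounded_word_grad_run f e : bounded_word (fun w => grad e (run w f)).
Proof. by apply: bounded_wordB; exact: bounded_word_run. Qed.

Lemma bounded_word_dirichlet_run f : bounded_word (fun w => dirichlet (run w f)).
Proof.
under eq_fun do rewrite dirichletE.
apply: bounded_word_sum => e; apply: bounded_wordZ.
under eq_fun do rewrite expr2.
by apply: bounded_wordM; exact: bounded_word_grad_run.
Qed.

End Resampling.

(** * Labelled particles *)

Section Configurations.
Local Open Scope set_scope.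
Variables (V : finType) (k : nat).
Implicit Types (u y : {ffun 'I_k -> V}) (xi : config V k).

Definition load k (u : {ffun 'I_k -> V}) (x : V) : nat := #|[set i | u i == x]|.

Lemma sum_load u : (\sum_x load u x = k)%N.
Proof.
rewrite /load -[RHS](card_ord k) -sum1_card.
rewrite (partition_big u xpredT)//=; apply: eq_bigr => x _.
by rewrite -sum1_card; apply: eq_bigl => i; rewrite finset.inE.
Qed.

Lemma load_le u x : (load u x < k.+1)%N.
Proof. by rewrite ltnS -[leqRHS](sum_load u) (bigD1 x)//= leq_addr. Qed.

Lemma cfg_subproof u :
  (\sum_x [ffun x => Ordinal (load_le u x)] x == k)%N.
Proof.
by rewrite -[X in _ == X](sum_load u); apply/eqP/eq_bigr => x _; rewrite ffunE.
Qed.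

Definition cfg u : config V k :=
  exist (fun xi : {ffun V -> 'I_k.+1} => (\sum_x xi x == k)%N) _ (cfg_subproof u).

Lemma occ_cfg u x : occ (cfg u) x = load u x.
Proof. by rewrite /occ/= ffunE. Qed.

Lemma occ_inj xi1 xi2 : occ xi1 =1 occ xi2 -> xi1 = xi2.
Proof.
move=> h; apply: val_inj; apply/ffunP => x; apply: val_inj; exact: h.
Qed.

Lemma sum_occ xi : (\sum_x occ xi x = k)%N.
Proof. exact/eqP/(valP xi). Qed.

Lemma cfg_eq u xi : (cfg u == xi) = [forall x, load u x == occ xi x].
Proof.
apply/eqP/forallP => [<- x|h]; first by rewrite occ_cfg.
by apply: occ_inj => x; rewrite occ_cfg (eqP (h x)).
Qed.

End Configurations.

Section ConsParticle.
Local Open Scope set_scope.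
Variables (V : finType) (k : nat).

Definition ffcons (ay : V * {ffun 'I_k -> V}) : {ffun 'I_k.+1 -> V} :=
  [ffun i => oapp ay.2 ay.1 (unlift ord0 i)].

Definition ffuncons (u : {ffun 'I_k.+1 -> V}) : V * {ffun 'I_k -> V} :=
  (u ord0, [ffun i => u (lift ord0 i)]).

Lemma ffconsK : cancel ffcons ffuncons.
Proof.
case=> a y; rewrite /ffuncons /ffcons; congr pair.
  by rewrite ffunE unlift_none.
by apply/ffunP => i; rewrite !ffunE liftK.
Qed.

Lemma ffunconsK : cancel ffuncons ffcons.
Proof.
move=> u; apply/ffunP => i; rewrite /ffcons /ffuncons ffunE.
by case: unliftP => [j ->|->] /=; rewrite ?ffunE.
Qed.

Lemma load_cons a (y : {ffun 'I_k -> V}) x :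
  load (ffcons (a, y)) x = ((a == x) + load y x)%N.
Proof.
rewrite /load -!sum1_card big_mkcond [X in (_ + X)%N]big_mkcond big_ord_recl.
congr addn; first by rewrite finset.inE ffunE unlift_none/=; case: (a == x).
by apply: eq_bigr => i _; rewrite !finset.inE ffunE liftK.
Qed.

End ConsParticle.

Section CardLoad.
Local Open Scope set_scope.

(** The multinomial coefficient, by induction on the number of particles: the first one sits at some
    [a] with [0 < g a], the others realise [g] lowered by one at [a], and the factors [g a] split
    off from the factorials sum to [k.+1]. *)
Lemma card_load (V : finType) (k : nat) (g : V -> nat) : (\sum_x g x = k)%N ->
  (#|[set u : {ffun 'I_k -> V} | [forall x, load u x == g x]]|
     * \prod_x (g x)`! = k`!)%N.
Proof.
elim: k g => [|k IH] g gk.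
  have g0 x : g x = 0%N by apply/eqP; move: gk => /eqP;
    rewrite sum_nat_eq0 => /forallP/(_ x).
  rewrite big1 ?muln1 => [|x _]; last by rewrite g0.
  rewrite (_ : [set _ | _] = finset.setT) ?cardsT ?card_ffun ?card_ord//.
  apply/setP => u; rewrite !finset.inE; apply/forallP => x; rewrite g0.
  rewrite -leqn0 -ltnS. exact: (load_le u x).
pose g' a x := (g x - (a == x))%N.
have hcard : #|[set u : {ffun 'I_k.+1 -> V} | [forall x, load u x == g x]]| =
    (\sum_(a | (0 < g a)%N)
      #|[set y : {ffun 'I_k -> V} | [forall x, load y x == g' a x]]|)%N.
  rewrite -sum1_card big_mkcond/=.
  rewrite (reindex (@ffcons V k)); last first.
    by exists (@ffuncons V k) => ? _; [exact: ffconsK | exact: ffunconsK].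
  rewrite -(pair_big xpredT xpredT (fun a y =>
    if ffcons (a, y) \in [set u : {ffun 'I_k.+1 -> V} | [forall x,
      load u x == g x]] then 1%N else 0%N))/=.
  rewrite [RHS]big_mkcond/=; apply: eq_bigr => a _.
  case: ifPn => ga; last first.
    apply: big1 => y _; rewrite ifF// finset.inE; apply/negbTE/forallPn; exists a.
    by rewrite load_cons eqxx/= add1n; apply: contra ga => /eqP <-.
  rewrite -sum1_card [RHS]big_mkcond/=; apply: eq_bigr => y _; rewrite !finset.inE.
  congr (if _ then _ else _); apply: eq_forallb => x; rewrite load_cons /g'.
  have [<-|ax] := eqVneq a x; last by rewrite subn0.
  by rewrite -{1}(subnKC ga) eqn_add2l.
rewrite hcard big_distrl/=.
transitivity (\sum_(a | (0 < g a)%N) g a * k`!)%N; last first.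
  rewrite -big_distrl/= factS -gk; congr muln.
  by rewrite big_mkcond/=; apply: eq_bigr => a _; case: posnP.
apply: eq_bigr => a ga; rewrite -(IH (g' a)); last first.
  apply/eqP; rewrite -(eqn_add2l 1) [eqbRHS]add1n -gk (bigD1 a)//=
    [eqbRHS](bigD1 a)//=.
  rewrite /g' eqxx addnA subnKC//; apply/eqP; congr addn; apply: eq_bigr => x xa.
  by rewrite eq_sym (negbTE xa) subn0.
rewrite mulnCA; congr muln; rewrite (bigD1 a)//= [in RHS](bigD1 a)//= mulnA.
congr muln; first by rewrite /g' eqxx subn1 -{1}(prednK ga) factS prednK.
by apply: eq_bigr => x xa; rewrite /g' eq_sym (negbTE xa) subn0.
Qed.

End CardLoad.

Section Labelled.
Local Open Scope set_scope.
Variables (R : realType) (G : wgraph R) (k : nat).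
Local Notation V := (vertex G).
Local Notation p := (@weight R G).
Local Notation lab := {ffun 'I_k -> V}.
Implicit Types (u y z : lab) (F : lab -> R) (h : 'I_k -> V -> R).
Implicit Types (e : V * V) (f : config V k -> R).

Definition prod_mean h F : R :=
  \sum_(u : lab) (\prod_i (p (u i) * h i (u i))) * F u.

Definition res_ker e (a b : V) : R := resample e (dirac_law R b) a.

(** When [e] rings, every particle at an endpoint of [e] chooses its endpoint afresh and
    independently. The number of those choosing [e.1] is binomial, so forgetting the labels gives
    Binomial Splitting. *)
Definition lab_op e F u : R :=
  \sum_(z : lab) (\prod_i res_ker e (u i) (z i)) * F z.

Lemma res_ker_dot e (g : V -> R) b :
  \sum_a p a * g a * res_ker e a b = p b * resample e g b.
Proof.
transitivity (dot g (resample e (dirac_law R b))) => //.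
rewrite -dot_resampleC /dot (bigD1 b)//= /dirac_law eqxx mulr1 big1 ?addr0//.
by move=> a /negbTE; rewrite eq_sym => ->; rewrite mulr0.
Qed.

(** A ring maps product laws to product laws because the particles choose independently. The kernel
    acts on densities by the same averaging, [resample e] being self-adjoint. *)
Lemma prod_mean_lab_op e h F :
  prod_mean h (lab_op e F) = prod_mean (fun i => resample e (h i)) F.
Proof.
rewrite /prod_mean /lab_op.
under eq_bigr do rewrite mulr_sumr.
rewrite exchange_big/=; apply: eq_bigr => z _.
under eq_bigr do rewrite mulrA -big_split/=.
rewrite -mulr_suml; congr (_ * _).
rewrite -(bigA_distr_bigA (fun i a => p a * h i a * res_ker e a (z i))).
by apply: eq_bigr => i _; rewrite res_ker_dot.
Qed.

Lemma prod_mean_sum (I : finType) h (a : I -> R) (F : I -> lab -> R) :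
  prod_mean h (fun u => \sum_i a i * F i u) = \sum_i a i * prod_mean h (F i).
Proof.
rewrite /prod_mean; under eq_bigr do rewrite mulr_sumr.
rewrite exchange_big/=; apply: eq_bigr => i _; rewrite mulr_sumr.
by apply: eq_bigr => u _; rewrite mulrCA.
Qed.

Lemma prod_mean_delta u F : prod_mean (fun i => delta (u i)) F = F u.
Proof.
rewrite /prod_mean (bigD1 u)//= [X in _ + X]big1 => [|z zu].
  rewrite addr0 big1 ?mul1r// => i _; rewrite /delta eqxx.
  by rewrite mul1r mulfV// weight_neq0.
have /existsP[i hi] : [exists i, z i != u i].
  rewrite -negb_forall; apply: contra zu => /forallP h.
  by apply/eqP/ffunP => i; exact/eqP.
by rewrite (bigD1 i)//= /delta (negbTE hi) mul0r mulr0 !mul0r.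
Qed.

Lemma prod_mean_law f :
  \sum_xi @multinomial_law R G k xi * f xi =
  prod_mean (fun=> fun=> 1) (fun u => f (cfg u)).
Proof.
rewrite /prod_mean (partition_big (@cfg V k) xpredT)//=; apply: eq_bigr => xi _.
transitivity (\sum_(u | cfg u == xi)
    (\prod_i (p (u i) * 1)) * f xi); last first.
  by apply: eq_bigr => u /eqP ->.
rewrite -mulr_suml; congr (_ * _).
rewrite /multinomial_law.
transitivity (\sum_(u in [set u : lab | [forall x, load u x == occ xi x]])
   \prod_x p x ^+ occ xi x).
  rewrite sumr_const -[RHS]mulr_natl; congr (_ * _).
  have := card_load (sum_occ xi) => /(congr1 (fun n => n%:R : R)).
  rewrite natrM natr_prod => <-; rewrite mulfK//.
  by apply/prodf_neq0 => x _; rewrite pnatr_eq0 -lt0n fact_gt0.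
apply: eq_big => u; first by rewrite finset.inE cfg_eq.
rewrite finset.inE => /forallP hu.
under [RHS]eq_bigr do rewrite mulr1.
rewrite (partition_big u xpredT)//=; apply: eq_bigr => x _.
rewrite -(eqP (hu x)) /load -prodr_const.
apply: eq_big => i; first by rewrite finset.inE.
by rewrite finset.inE => /eqP ->.
Qed.

Section Lumping.
Variables (e : V * V) (u : lab).
Hypothesis e_neq : e.1 != e.2.
Let q := p e.1 / (p e.1 + p e.2).
Let S0 : {set 'I_k} := [set i | (u i == e.1) || (u i == e.2)].
(** A labelled state that one ring can reach from [u] is coded by the set of the particles sent to
    [e.1]: [place] and [chosen] are inverse to each other between subsets of [S0] and reachable
    states. *)
Let place (A : {set 'I_k}) : lab :=
  [ffun i => if i \in A then e.1 else if i \in S0 then e.2 else u i].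
Let chosen (z : lab) : {set 'I_k} := [set i in S0 | z i == e.1].

Implicit Types A : {set 'I_k}.

Lemma card_S0 : #|S0| = (occ (cfg u) e.1 + occ (cfg u) e.2)%N.
Proof.
rewrite !occ_cfg /load -cardsUI.
rewrite (_ : [set i | u i == e.1] :&: _ = finset.set0) ?cards0 ?addn0.
  by congr #|pred_of_set _|; apply/setP => i; rewrite !finset.inE.
apply/setP => i; rewrite !finset.inE; have [->|//] := eqVneq (u i) e.1.
by rewrite (negbTE e_neq).
Qed.

Lemma placeK A : A \subset S0 -> chosen (place A) = A.
Proof.
move=> AS; apply/setP => i; rewrite !finset.inE /place ffunE.
have [iA|iA] := boolP (i \in A).
  by rewrite eqxx andbT; have := fintype.subsetP AS i iA; rewrite finset.inE.
rewrite finset.inE; case: ifPn; rewrite ?andFb// => _.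
by rewrite eq_sym (negbTE e_neq).
Qed.

Lemma chosen_sub z : chosen z \subset S0.
Proof. by apply/fintype.subsetP => i; rewrite finset.inE => /andP[]. Qed.

Lemma res_kerE (a b : V) : res_ker e a b =
  if (a == e.1) || (a == e.2) then
    (if b == e.1 then q else if b == e.2 then (1 - q) else 0) else (b == a)%:R.
Proof.
rewrite /res_ker /resample /dirac_law; case: ifP => _; last by rewrite eq_sym.
rewrite /q !(eq_sym b); have pxy := weightD_neq0 e.1 e.2.
have [<-|_] := eqVneq e.1 b.
  by rewrite eq_sym (negbTE e_neq) mulr1 mulr0 addr0.
have [_|_] := eqVneq e.2 b; rewrite !(mulr0, mulr1) add0r ?mul0r//.
by field.
Qed.

Lemma cfg_place A : A \subset S0 ->
  cfg (place A) = redistribute (cfg u) e.1 e.2 #|A|.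
Proof.
move=> AS; apply: occ_inj => x; rewrite redistributeE//; last first.
  by rewrite -card_S0 subset_leq_card.
rewrite occ_cfg /load; have [->|x1] := eqVneq x e.1.
  congr #|pred_of_set _|; rewrite -[RHS](placeK AS); apply/setP => i.
  rewrite !finset.inE; case: (boolP (_ || _)) => //= hi.
  rewrite /place ffunE finset.inE (negbTE hi).
  have -> : i \in A = false.
    by apply: contraNF hi => /(fintype.subsetP AS); rewrite finset.inE.
  by apply: contraNF hi => ->.
have [->|x2] := eqVneq x e.2.
  rewrite -card_S0 -(cardsID A S0) (finset.setIidPr AS) addKn.
  congr #|pred_of_set _|; apply/setP => i; rewrite !finset.inE /place ffunE.
  have [iA|iA] /= := boolP (i \in A); first by rewrite (negbTE e_neq).
  rewrite finset.inE; case: (boolP (_ || _)) => //= hi; rewrite ?eqxx//.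
  by apply: contraNF hi => ->; rewrite orbT.
rewrite occ_cfg /load; congr #|pred_of_set _|; apply/setP => i.
rewrite !finset.inE /place ffunE.
have [iA|iA] := boolP (i \in A).
  rewrite eq_sym (negbTE x1); have := fintype.subsetP AS i iA; rewrite finset.inE.
  by case/orP => /eqP ->; rewrite eq_sym ?(negbTE x1) ?(negbTE x2).
rewrite finset.inE; case: ifP => // /orP[] /eqP ->; rewrite !(eq_sym _ x).
  by rewrite (negbTE x1) (negbTE x2).
by [].
Qed.

Lemma prod_place A : A \subset S0 ->
  \prod_i res_ker e (u i) (place A i) = q ^+ #|A| * (1 - q) ^+ (#|S0| - #|A|).
Proof.
move=> AS.
rewrite (bigID (mem S0))/= [X in _ * X]big1 ?mulr1; last first.
  move=> i iS; rewrite res_kerE; move: (iS); rewrite finset.inE => /negbTE ->.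
  rewrite /place ffunE (negbTE iS) ifF ?eqxx//.
  by apply: contraNF iS => /(fintype.subsetP AS).
rewrite (bigID (mem A))/=; congr (_ * _).
  rewrite -prodr_const; apply: eq_big => [i|i /andP[iS iA]].
    by case: (boolP (i \in A)) => [/(fintype.subsetP AS) ->|]; rewrite ?andbF.
  move: iS; rewrite res_kerE finset.inE => ->.
  by rewrite /place ffunE iA eqxx.
have -> : (#|S0| - #|A| = #|S0 :\: A|)%N by rewrite cardsD (finset.setIidPr AS).
rewrite -prodr_const.
apply: eq_big => [i|i /andP[iS iA]]; first by rewrite !finset.inE andbC.
move: (iS); rewrite res_kerE finset.inE => ->.
by rewrite /place ffunE (negbTE iA) iS eq_sym (negbTE e_neq) eqxx.
Qed.

(** The kernel vanishes outside the image of [place]. What remains is a sum over the subsets of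
    [S0], and grouping them by cardinality [j] produces the binomial weights. *)
Lemma lab_op_cfg f : lab_op e (fun z => f (cfg z)) u =
  \sum_(j < (occ (cfg u) e.1 + occ (cfg u) e.2).+1)
    binomial_pmf (occ (cfg u) e.1 + occ (cfg u) e.2) q j *
    f (redistribute (cfg u) e.1 e.2 j).
Proof.
rewrite -card_S0 /lab_op (bigID (fun z => place (chosen z) == z))/=.
rewrite [X in _ + X]big1 ?addr0; last first.
  move=> z zz; rewrite (_ : \prod_i _ = 0) ?mul0r//.
  have /existsP[i hi] : [exists i, place (chosen z) i != z i].
    rewrite -negb_forall; apply: contra zz => /forallP h.
    by apply/eqP/ffunP => i; exact/eqP.
  apply/eqP; rewrite prodf_seq_eq0; apply/hasP; exists i.
    by rewrite mem_index_enum.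
  rewrite /= res_kerE; move: hi; rewrite /place ffunE !finset.inE.
  case: (boolP (_ || _)) => //= _.
    have [->|z1] /= := eqVneq (z i) e.1; first by rewrite eqxx.
    by rewrite eq_sym => /negbTE ->.
  by rewrite eq_sym => /negbTE ->.
rewrite (reindex_onto place chosen); last by move=> z /eqP.
rewrite (eq_bigl (fun A : {set 'I_k} => A \subset S0)); last first.
  move=> A; apply/andP/idP => [[_ /eqP <-]|AS]; first exact: chosen_sub.
  by rewrite placeK.
transitivity (\sum_(A : {set 'I_k} | A \subset S0)
    q ^+ #|A| * (1 - q) ^+ (#|S0| - #|A|) * f (redistribute (cfg u) e.1 e.2 #|A|)).
  by apply: eq_bigr => A AS; rewrite prod_place// cfg_place.
rewrite (partition_big (fun A : {set 'I_k} => inord #|A| : 'I_#|S0|.+1) xpredT)//=.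
apply: eq_bigr => j _.
rewrite (eq_bigl (fun A => A \in [set A : {set 'I_k} | A \subset S0 & #|A| == j])).
  rewrite (eq_bigr (fun=> q ^+ j * (1 - q) ^+ (#|S0| - j) *
    f (redistribute (cfg u) e.1 e.2 j))); last first.
    by move=> A; rewrite finset.inE => /andP[_ /eqP ->].
  by rewrite sumr_const cards_draws /binomial_pmf; exact/esym/mulrnAl.
move=> A; rewrite finset.inE; case: (boolP (A \subset S0)) => //= AS.
by rewrite -val_eqE/= inordK// ltnS subset_leq_card.
Qed.

End Lumping.

Lemma bin_gen_cfg f u : bin_gen f (cfg u) =
  \sum_e rate e * (lab_op e (fun z => f (cfg z)) u - f (cfg u)).
Proof.
rewrite /bin_gen.
pose H (x y : V) : R := \sum_(j < (occ (cfg u) x + occ (cfg u) y).+1)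
  binomial_pmf (occ (cfg u) x + occ (cfg u) y) (p x / (p x + p y)) j *
    f (redistribute (cfg u) x y j) - f (cfg u).
rewrite (edge_sumE H); apply: eq_bigr => -[x y] _.
have [<-|xy] := eqVneq x y; first by rewrite rate_diag !mul0r.
by rewrite lab_op_cfg.
Qed.

End Labelled.

(** * Particles in a common environment *)

Section Particles.
Variables (R : realType) (G : wgraph R) (k : nat).
Local Notation V := (vertex G).
Local Notation p := (@weight R G).
Local Notation lab := {ffun 'I_k -> V}.
Local Open Scope set_scope.
Implicit Types (f : config V k -> R) (h : 'I_k -> V -> R).

Lemma lin_op_bin_gen : lin_op (@bin_gen R G k).
Proof.
move=> a f g xi; rewrite /bin_gen /edge_sum mulrCA -mulrDr; congr (_ * _).
rewrite mulr_sumr -big_split/=; apply: eq_bigr => x _.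
rewrite mulr_sumr -big_split/=; apply: eq_bigr => y _.
rewrite mulrCA -mulrDr; congr (_ * _).
rewrite mulrBr addrACA -opprD; congr (_ - _).
rewrite mulr_sumr -big_split/=; apply: eq_bigr => j _; ring.
Qed.

(** The fibre over [xi] cannot be empty, since by [card_load] its cardinality divides a
    factorial. *)
Lemma cfg_surj (xi : config V k) : exists u, cfg u = xi.
Proof.
have := card_load (sum_occ xi).
have [->|[u]] := finset.set_0Vmem [set u : lab | [forall x, load u x == occ xi x]].
  by rewrite cards0 mul0n => /esym/eqP; rewrite -[_ == _]negbK -lt0n fact_gt0.
by rewrite finset.inE -cfg_eq => /eqP; exists u.
Qed.

Lemma bounded_word_prod_mean h (F : lab -> R) :
  bounded_word (fun w => prod_mean (fun i => run w (h i)) F).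
Proof.
rewrite /prod_mean.
under eq_fun => w do under eq_bigr do rewrite mulrC.
apply: bounded_word_sum => u.
elim: (index_enum _) => [|i r IH].
  by under eq_fun do rewrite big_nil; exact: bounded_word_cst.
under eq_fun do rewrite big_cons.
apply: bounded_wordM => //; apply: bounded_wordZ; exact: bounded_word_run.
Qed.

Definition initial_law h (xi : config V k) : R :=
  prod_mean h (fun u => (cfg u == xi)%:R).

Lemma initial_lawE h f :
  \sum_xi initial_law h xi * f xi = prod_mean h (fun u => f (cfg u)).
Proof.
under eq_bigr do rewrite mulrC.
rewrite -prod_mean_sum; apply: eq_bigr => u _; congr (_ * _).
rewrite (bigD1 (cfg u))//= eqxx mulr1 big1 ?addr0// => xi.
by rewrite eq_sym => /negbTE ->; rewrite mulr0.
Qed.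

(** The right-hand side solves the forward equation of [bin_gen]: at rate [rate e] the product law
    with densities [run w (h i)] becomes the one with densities [run (e :: w) (h i)]. Uniqueness is
    [forward_equation]. *)
Lemma particle_representation h f (t : R) : 0 <= t ->
  \sum_xi initial_law h xi * semigroup (@bin_gen R G k) t f xi =
  word_mean (@rate R G) t
    (fun w => prod_mean (fun i => run w (h i)) (fun u => f (cfg u))).
Proof.
move=> t0.
pose v s xi := word_mean (@rate R G) s
  (fun w => initial_law (fun i => run w (h i)) xi).
have vE s g : \sum_xi v s xi * g xi = word_mean (@rate R G) s
    (fun w => prod_mean (fun i => run w (h i)) (fun u => g (cfg u))).
  under eq_bigr do rewrite mulrC.
  rewrite -word_mean_sum; last 2 first.
  - exact: rate_ge0.
  - by move=> xi; exact: bounded_word_prod_mean.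
  congr (word_mean _ s _); apply/funext => w; rewrite -initial_lawE.
  by apply: eq_bigr => xi _; rewrite mulrC.
have hder (s : R) g : 0 <= s -> is_derive s 1 (fun s => \sum_xi v s xi * g xi)
    (\sum_xi v s xi * bin_gen g xi).
  move=> s0.
  have hd := is_derive_word_mean (@rate_ge0 R G) s
    (bounded_word_prod_mean h (fun u => g (cfg u))).
  apply: (is_derive_ext (fun r => esym (vE r g))).
  apply: is_derive_eq_pt hd _.
  rewrite vE; congr (word_mean _ s _); apply/funext => w; rewrite /word_gen.
  under [fun u => bin_gen _ _]eq_fun do rewrite bin_gen_cfg.
  rewrite prod_mean_sum; apply: eq_bigr => e _; congr (_ * _).
  rewrite [X in X - _ = _](_ : _ = prod_mean (fun i => run w (h i))
    (lab_op e (fun z => g (cfg z)))); last by rewrite prod_mean_lab_op.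
  by rewrite /prod_mean -sumrB; apply: eq_bigr => u _; rewrite mulrBr.
rewrite -vE; have := forward_equation f (@lin_op_bin_gen) t0 hder => ->.
by apply: eq_bigr => xi _; rewrite /v word_mean0.
Qed.

End Particles.

(** * One particle: configurations as vertices *)

Section OneParticle.
Variables (R : realType) (G : wgraph R).
Local Notation V := (vertex G).
Local Notation p := (@weight R G).
Implicit Types (psi phi f g : V -> R).

Let unit_cfg (x : V) : config V 1 := cfg [ffun=> x].

Lemma unit_cfg_surj xi : exists x, unit_cfg x = xi.
Proof.
have [u <-] := cfg_surj xi; exists (u ord0); congr cfg.
by apply/ffunP => i; rewrite ffunE (ord1 i).
Qed.

Lemma occ_unit_cfg x y : occ (unit_cfg x) y = (x == y).
Proof.
rewrite occ_cfg /load -sum1_card big_mkcond/= big_ord1 finset.inE ffunE.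
by case: (x == y).
Qed.

Lemma prod_mean1 (h : 'I_1 -> V -> R) F :
  prod_mean h F = dot (h ord0) (fun x => F [ffun=> x]).
Proof.
rewrite /prod_mean (reindex (fun x : V => [ffun=> x] : {ffun 'I_1 -> V})).
  by apply: eq_bigr => x _; rewrite big_ord1 ffunE.
exists (fun u : {ffun 'I_1 -> V} => u ord0) => u _; first by rewrite ffunE.
by apply/ffunP => i; rewrite ffunE (ord1 i).
Qed.

Lemma bin_gen1E (f : config V 1 -> R) x :
  bin_gen f (unit_cfg x) = gen1 (fun y => f (unit_cfg y)) x.
Proof.
rewrite /unit_cfg bin_gen_cfg; apply: eq_bigr => e _; congr (_ * (_ - _)).
rewrite -(prod_mean_delta [ffun=> x]) prod_mean_lab_op prod_mean1.
by rewrite dot_resampleC ffunE dotC dot_delta.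
Qed.

(** [gap] is defined through configurations of one particle; this transports its eigenvalue problem
    to functions on the vertices. *)
Lemma eigenvalue_gen1P (lambda : R) :
  is_eigenvalue (fun F xi => - @bin_gen R G 1 F xi) lambda <->
  exists psi, (exists x, psi x != 0) /\ forall x, gen1 psi x = - lambda * psi x.
Proof.
split => [[F [[xi fxi] hf]]|[psi [[x psix] hpsi]]].
  exists (fun x => F (unit_cfg x)); split.
    by have [x xE] := unit_cfg_surj xi; exists x; rewrite xE.
  by move=> x; rewrite -bin_gen1E mulNr -hf opprK.
(* The linear statistic whose value is [psi y] when the particle sits at [y]. *)
pose F (xi : config V 1) := \sum_y psi y * (occ xi y)%:R.
have FE y : F (unit_cfg y) = psi y.
  rewrite -[RHS]sum_dirac; apply: eq_bigr => z _.
  by rewrite occ_unit_cfg.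
exists F; split; first by exists (unit_cfg x); rewrite FE.
move=> xi; have [y <-] := unit_cfg_surj xi; rewrite bin_gen1E FE.
by under [fun y => F _]eq_fun do rewrite FE; rewrite hpsi mulNr opprK.
Qed.

End OneParticle.

(** * Spectral gap *)

Section SpectralGap.
Variables (R : realType) (G : wgraph R).
Local Notation V := (vertex G).
Local Notation p := (@weight R G).
Implicit Types (psi phi f g : V -> R).

(** Each edge has a positive coefficient [rate e * qe e], so no gradient is left along it, and
    connectedness propagates the equality. *)
Lemma dirichlet0_const f : dirichlet f = 0 -> forall x y, f x = f y.
Proof.
move=> f0 x y.
have hedge a b : edge a b -> f a = f b.
  move=> ab; have := f0; rewrite dirichletE => /eqP.
  rewrite psumr_eq0 => [/allP/(_ (a, b))|e _]; last first.
    by rewrite mulr_ge0 ?rate_ge0// mulr_ge0 ?qe_ge0 ?sqr_ge0.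
  rewrite mem_index_enum => /(_ isT)/=.
  rewrite mulf_eq0 mulf_eq0 sqrf_eq0 /rate/= ab /grad/= subr_eq0 =>
    /orP[|/orP[|/eqP//]].
    by rewrite gt_eqF// divr_gt0// cond_gt0.
  by rewrite gt_eqF// /qe divr_gt0 ?mulr_gt0 ?addr_gt0 ?weight_gt0.
have /connectP[s] := edge_connected x y.
elim: s x => [x _ -> //|z s IH x /= /andP[xz zs] ys].
by rewrite (hedge _ _ xz); exact: IH.
Qed.

Lemma continuous_fsum (T : topologicalType) (I : Type) (r : seq I)
    (F : I -> T -> R) : (forall i, continuous (F i)) ->
  continuous (fun v => \sum_(i <- r) F i v).
Proof.
move=> hF; elim: r => [|i r IH].
  by under eq_fun do rewrite big_nil; exact: cst_continuous.
under eq_fun do rewrite big_cons.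
by move=> v; apply: continuousD; [exact: hF | exact: IH].
Qed.

Lemma continuous_fmul (T : topologicalType) (F1 F2 : T -> R) :
  continuous F1 -> continuous F2 -> continuous (fun v => F1 v * F2 v).
Proof. by move=> h1 h2 v; exact: (continuousM (h1 v) (h2 v)). Qed.

Lemma dirichletZ f (a : R) : dirichlet (fun z => a * f z) = a ^+ 2 * dirichlet f.
Proof.
rewrite !dirichletE mulr_sumr; apply: eq_bigr => e _; rewrite /grad; ring.
Qed.

Lemma dirichlet_add f g (a : R) : dirichlet (fun z => a * g z + f z) =
  a ^+ 2 * dirichlet g - 2 * a * dot (gen1 f) g + dirichlet f.
Proof.
rewrite !dirichletE dot_gen1 mulrN opprK !mulr_sumr -!big_split/=.
by apply: eq_bigr => e _; rewrite /grad; ring.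
Qed.

(** Compactness of the unit sphere of the mean-zero functions, which are encoded as row vectors to
    have a topology at hand. *)
Lemma dirichlet_min : (1 < #|V|)%N -> exists phi,
  [/\ dot (fun=> 1) phi = 0, dot phi phi = 1
    & forall f, dot (fun=> 1) f = 0 -> dirichlet phi * dot f f <= dirichlet f].
Proof.
move=> V1; pose n := #|V|.
pose fn (v : 'rV[R]_n) : V -> R := fun x => v ord0 (enum_rank x).
have fn_cont x : continuous (fun v => fn v x) by exact: coord_continuous.
have fn_surj f : fn (\row_i f (enum_val i)) = f.
  by apply/funext => x; rewrite /fn mxE enum_rankK.
pose A := [set v | dot (fun=> 1) (fn v) = 0 /\ dot (fn v) (fn v) = 1].
have cst_cont (a : R) : continuous (fun _ : 'rV[R]_n => a) by exact: cst_continuous.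
have c1 : continuous (fun v => dot (fun=> 1) (fn v)).
  by apply: continuous_fsum => x; apply: continuous_fmul.
have c2 : continuous (fun v => dot (fn v) (fn v)).
  by apply: continuous_fsum => x; do 2 apply: continuous_fmul => //.
have c3 : continuous (fun v => dirichlet (fn v)).
  under eq_fun do rewrite dirichletE.
  apply: continuous_fsum => e; do 2 apply: continuous_fmul => //.
  have cg : continuous (fun v => grad e (fn v)).
    by move=> v; exact: (continuousB (fn_cont e.1 v) (fn_cont e.2 v)).
  by under eq_fun do rewrite expr2; apply: continuous_fmul.
have closedA : closed A.
  apply: (@closedI _ [set v | dot (fun=> 1) (fn v) = 0]
                     [set v | dot (fn v) (fn v) = 1]).
    by apply: (proj1 (continuous_closedP _) c1 [set x | x = 0]); exact: closed_eq.
  by apply: (proj1 (continuous_closedP _) c2 [set x | x = 1]); exact: closed_eq.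
(* [M] bounds all coordinates on the sphere through [b ^+ 2 <= (p x)^-1 <= M <= M ^+ 2]; the summand
   1 serves the last inequality. *)
pose M := 1 + \sum_x (p x)^-1.
have pinv0 x : 0 <= (p x)^-1 by rewrite invr_ge0 ltW// weight_gt0.
have M1 : 1 <= M by rewrite lerDl sumr_ge0.
have compactA : compact A.
  apply: subclosed_compact closedA (@rV_compact _ n (fun=> `[- M, M]%classic) _) _.
    by move=> _; exact: segment_compact.
  move=> v [_ v1] i /=; rewrite in_itv/= -ler_norml.
  have -> : v ord0 i = fn v (enum_val i) by rewrite /fn enum_valK.
  set x := enum_val i; set b := fn v x.
  have hb : p x * b ^+ 2 <= 1.
    rewrite -v1 /dot (bigD1 x)//= -mulrA -expr2 lerDl sumr_ge0// => y _.
    by rewrite -mulrA -expr2 mulr_ge0 ?sqr_ge0// ltW// weight_gt0.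
  have hb2 : b ^+ 2 <= M ^+ 2.
    apply: (@le_trans _ _ (p x)^-1).
      by rewrite -[leRHS]mul1r ler_pdivlMr ?weight_gt0// mulrC.
    rewrite (@le_trans _ _ M)//.
      by rewrite /M (bigD1 x)//= addrCA lerDl addr_ge0 ?sumr_ge0.
    by rewrite expr2 ler_peMl// (le_trans ler01).
  have hb3 : (`|b : R| <= M)%R.
    rewrite -ler_sqr ?nnegrE ?normr_ge0 ?(le_trans ler01)//.
    by rewrite real_normK ?num_real.
  exact: hb3.
have A0 : A !=set0.
  have [x [y [_ _ xy]]] := card_gt1P V1.
  pose f := fun z => delta x z - delta y z.
  have f1 : dot (fun=> 1) f = 0 by rewrite dotBr !dot_delta subrr.
  have fpos : 0 < dot f f.
    rewrite lt_neqAle dot_ge0 andbT eq_sym; apply/negP => /eqP f0.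
    have : f x = 0.
      have := f0; rewrite /dot => /eqP; rewrite psumr_eq0 => [/allP/(_ x)|z _].
        rewrite mem_index_enum => /(_ isT); rewrite !mulf_eq0.
        by rewrite (negbTE (weight_neq0 x)) orbb/= => /eqP.
      by rewrite -mulrA -expr2 mulr_ge0 ?sqr_ge0// ltW// weight_gt0.
    rewrite /f /delta eqxx (negbTE xy) mul0r subr0 mul1r => /eqP.
    by rewrite invr_eq0 (negbTE (weight_neq0 x)).
  exists (\row_i ((Num.sqrt (dot f f))^-1 * f (enum_val i))).
  rewrite /A/= (fn_surj (fun z => (Num.sqrt (dot f f))^-1 * f z)); split.
    by rewrite dotZr f1 mulr0.
  by rewrite dotZr dotZl mulrA -invfM -expr2 sqr_sqrtr ?dot_ge0// mulVf// gt_eqF.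
have [v vA vmin] := compact_EVT_min A0 compactA (continuous_subspaceT c3).
have [v1 v2] : A v by exact: set_mem.
exists (fn v); split => // f f1.
have := dot_ge0 f; rewrite le_eqVlt => /orP[/eqP <-|fpos].
  by rewrite mulr0 dirichlet_ge0.
pose s := (Num.sqrt (dot f f))^-1.
have s2 : s ^+ 2 = (dot f f)^-1 by rewrite exprVn sqr_sqrtr// ltW.
have := vmin (\row_i (s * f (enum_val i))).
rewrite (fn_surj (fun z => s * f z)) dirichletZ s2 => h.
rewrite -ler_pdivlMr// mulrC; apply: h.
apply: mem_set; rewrite /A/= (fn_surj (fun z => s * f z)) dotZr f1 mulr0;
  split=> //.
by rewrite dotZr dotZl mulrA -expr2 s2 mulVf// gt_eqF.
Qed.

(** The minimiser of the Dirichlet form is a critical point, hence an eigenfunction. Its eigenvalue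
    is positive by connectedness and bounds every other positive eigenvalue from below, so it is the
    infimum that defines [gap]. *)
Lemma gap_eigenfunction : (1 < #|V|)%N -> exists phi,
  [/\ dot (fun=> 1) phi = 0, dot phi phi = 1, 0 < gap G,
      forall x, gen1 phi x = - gap G * phi x
    & forall f, dot (fun=> 1) f = 0 -> gap G * dot f f <= dirichlet f].
Proof.
move=> V1; have [phi [phi1 phi2 phimin]] := dirichlet_min V1.
set lambda := dirichlet phi in phimin.
have gphi1 : dot (fun=> 1) (gen1 phi) = 0.
  rewrite dotC dot_gen1 big1 ?oppr0// => e _.
  by rewrite /grad subrr !mulr0.
have lambda0 : 0 < lambda.
  rewrite lt_neqAle dirichlet_ge0 andbT eq_sym; apply/negP => /eqP l0.
  have cphi := dirichlet0_const l0.
  have [x [_ [_ _ _]]] := card_gt1P V1.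
  have phix : phi = fun=> phi x * 1 by apply/funext => z; rewrite mulr1;
    exact: cphi.
  have := phi1; rewrite phix dotZr dot11 mulr1 => p0.
  by move: phi2; rewrite phix p0 dotZr mul0r => /eqP; rewrite eq_sym oner_eq0.
have crit g : dot (fun=> 1) g = 0 -> - dot (gen1 phi) g = lambda * dot phi g.
  move=> g1; pose b := - dot (gen1 phi) g - lambda * dot phi g.
  pose B := dirichlet g - lambda * dot g g.
  have B0 : 0 <= B by rewrite subr_ge0 phimin.
  have hq t : 0 <= 2 * t * b + t ^+ 2 * B.
    have := phimin (fun z => t * g z + phi z).
    rewrite dirichlet_add dotC dotDl [dot g _]dotC [dot phi _]dotC g1 phi1.
    rewrite mulr0 add0r => /(_ erefl).
    rewrite dotDl ![dot _ (fun z => t * g z + phi z)]dotC !dotDl phi2.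
    rewrite [dot g phi]dotC -subr_ge0 -/lambda => h; apply: (le_trans h).
    by rewrite le_eqVlt /b /B; apply/orP; left; apply/eqP; ring.
  (* A polynomial [2 * t * b + t ^+ 2 * B] that is nonnegative for all [t] must have [b = 0]. The
     denominator [B + 1] also covers [B = 0]. *)
  have := hq (- b / (B + 1)).
  have B1 : 0 < B + 1 by rewrite ltr_wpDl.
  have -> : 2 * (- b / (B + 1)) * b + (- b / (B + 1)) ^+ 2 * B =
      - (b ^+ 2 * ((B + 2) / (B + 1) ^+ 2)) by field; rewrite gt_eqF.
  rewrite oppr_ge0 pmulr_lle0 ?divr_gt0 ?exprn_gt0// ?ltr_wpDl//.
  move=> hb; have /eqP : b ^+ 2 = 0 by apply/eqP; rewrite eq_le hb sqr_ge0.
  by rewrite sqrf_eq0 subr_eq0 => /eqP.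
(* Testing against [delta x - 1], the mean-zero part of the Dirac density, reads off the value at
   [x]. *)
have ephi x : gen1 phi x = - lambda * phi x.
  have := crit (fun z => delta x z - 1).
  rewrite !dotBr !dot_delta dot11 subrr => /(_ erefl).
  by rewrite [dot (gen1 _) _]dotC gphi1 [dot phi _]dotC phi1 !subr0 => /eqP;
    rewrite eqr_oppLR mulNr => /eqP.
have phi_neq0 : exists x, phi x != 0.
  apply: contrapT => h; have p0 : phi = fun z => 0 * phi z.
    apply/funext => z; rewrite mul0r; apply/eqP/negPn/negP => hz.
    by apply: h; exists z.
  by move: phi2; rewrite p0 dotZl mul0r => /eqP; rewrite eq_sym oner_eq0.
have gapE : gap G = lambda.
  apply/eqP; rewrite eq_le; apply/andP; split.
    apply: ge_inf; first by exists 0 => z [/ltW].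
    by split=> //; apply/eigenvalue_gen1P; exists phi; split.
  apply: lb_le_inf.
    by exists lambda; split => //; apply/eigenvalue_gen1P; exists phi; split.
  move=> mu [mu0 /eigenvalue_gen1P[psi [[x psix] hpsi]]].
  have gpsi : gen1 psi = fun z => - mu * psi z by apply/funext.
  (* An eigenfunction of a nonzero eigenvalue is orthogonal to the constants, on which the
     self-adjoint [gen1] vanishes. *)
  have psi1 : dot (fun=> 1) psi = 0.
    have : dot (gen1 psi) (fun=> 1) = 0.
      by rewrite dot_gen1 big1 ?oppr0// => e _; rewrite /grad subrr !mulr0.
    rewrite gpsi dotZl dotC => /eqP; rewrite mulf_eq0 oppr_eq0 gt_eqF//=.
    by move/eqP.
  have := phimin psi psi1.
  have -> : dirichlet psi = mu * dot psi psi.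
    by rewrite -[LHS]opprK -dot_gen1_dirichlet gpsi dotZl mulNr opprK.
  rewrite ler_pM2r// lt_neqAle dot_ge0 andbT eq_sym; apply/negP.
  rewrite /dot => /eqP/eqP; rewrite psumr_eq0 => [/allP/(_ x)|z _].
    rewrite mem_index_enum => /(_ isT); rewrite !mulf_eq0.
    by rewrite (negbTE (weight_neq0 x)) (negbTE psix).
  by rewrite -mulrA -expr2 mulr_ge0 ?sqr_ge0// ltW// weight_gt0.
by exists phi; rewrite gapE; split.
Qed.

End SpectralGap.

(** * Decay of the energy *)

Section Energy.
Variables (R : realType) (G : wgraph R).
Local Notation V := (vertex G).
Local Notation p := (@weight R G).
Local Notation g := (gap G).
Local Notation mean := (word_mean (@rate R G)).
Local Notation P r f := (semigroup (@gen1 R G) r f).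
Implicit Types (f h : V -> R) (e : V * V).

Hypothesis V1 : (1 < #|V|)%N.

Let g_gt0 : 0 < g.
Proof. by have [phi []] := gap_eigenfunction V1. Qed.

Let poincare f : dot (fun=> 1) f = 0 -> g * dot f f <= dirichlet f.
Proof. by move=> f0; have [phi [_ _ _ _]] := gap_eigenfunction V1; apply. Qed.

Definition energy h (s : R) : R := mean s (fun w => dot (run w h) (run w h)) - 1.

Definition dissipation h (s : R) : R := mean s (fun w => dirichlet (run w h)).

Lemma mean1_run w h : dot (fun=> 1) (run w h) = dot (fun=> 1) h.
Proof.
elim: w => //= e w <-; rewrite -dot_resampleC; congr (dot _ _).
by apply/funext => z; rewrite resample_cst.
Qed.

Lemma dirichlet_center f : dirichlet (fun z => f z - 1) = dirichlet f.
Proof. by rewrite !dirichletE; apply: eq_bigr => e _; rewrite /grad;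
  congr (_ * (_ * _ ^+ 2)); ring. Qed.

Lemma is_derive_energy h (s : R) :
  is_derive s 1 (energy h) (- dissipation h s).
Proof.
have hd := is_derive_word_mean (@rate_ge0 R G) s (bounded_word_norm_run h).
have hd2 := is_derive_fsub hd (is_derive_fcst 1 s).
apply: is_derive_eq_pt hd2 _; rewrite subr0 /dissipation -mulN1r.
rewrite -word_meanZ; last 2 first.
- exact: rate_ge0.
- exact: bounded_word_dirichlet_run.
congr (word_mean _ s _); apply/funext => w.
rewrite dirichletE mulN1r -sumrN; apply: eq_bigr => e _ /=.
by rewrite norm_resample; ring.
Qed.

Lemma dissipation_ge h (s : R) : 0 <= s -> dot (fun=> 1) h = 1 ->
  g * energy h s <= dissipation h s.
Proof.
move=> s0 h1; rewrite /energy mulrBr mulr1 lerBlDr.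
rewrite -(word_mean_cst (@rate_ge0 R G) s g) /dissipation.
rewrite -word_meanD; last 3 first.
- exact: rate_ge0.
- exact: bounded_word_dirichlet_run.
- exact: bounded_word_cst.
rewrite {1}word_mean_cst; last exact: rate_ge0.
rewrite -word_meanZ; last 2 first.
- exact: rate_ge0.
- exact: bounded_word_norm_run.
apply: word_mean_le => //.
- exact: rate_ge0.
- by apply: bounded_wordZ; exact: bounded_word_norm_run.
- by apply: bounded_wordD;
  [exact: bounded_word_dirichlet_run|exact: bounded_word_cst].
move=> w; rewrite -lerBlDr -{2}(mulr1 g) -mulrBr -dot_center;
  last by rewrite mean1_run.
rewrite -[leRHS]dirichlet_center; apply: poincare.
by rewrite dotBr mean1_run h1 dot11 subrr.
Qed.

Lemma dissipation_ge0 h (s : R) : 0 <= s -> 0 <= dissipation h s.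
Proof.
move=> s0; apply: word_mean_ge0 => //.
- exact: rate_ge0.
- exact: bounded_word_dirichlet_run.
- by move=> w; exact: dirichlet_ge0.
Qed.

Lemma energy_ge0 h (s : R) : 0 <= s -> dot (fun=> 1) h = 1 -> 0 <= energy h s.
Proof.
move=> s0 h1; rewrite subr_ge0 -(word_mean_cst (@rate_ge0 R G) s 1).
apply: word_mean_le => //.
- exact: rate_ge0.
- exact: bounded_word_cst.
- exact: bounded_word_norm_run.
by move=> w; rewrite -subr_ge0 -dot_center ?mean1_run// dot_ge0.
Qed.

Lemma energy_nonincreasing h (s t : R) : 0 <= s -> s <= t ->
  energy h t <= energy h s.
Proof.
move=> s0 st; apply: (is_derive_nonincreasing (df := fun r => - dissipation h
  r)) => //.
  by move=> r _; exact: is_derive_energy.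
by move=> r /andP[sr _]; rewrite oppr_le0 dissipation_ge0// (le_trans s0).
Qed.

(** The rate is [g] and not [2 * g]: a ring changes the squared norm by a linear term
    [- 2 * qe e * grad e f ^+ 2] and by a quadratic term that gives half of it back. The walk in
    [norm_walk_decay] has the linear term only. *)
Lemma energy_decay h (s t : R) : 0 <= s -> s <= t -> dot (fun=> 1) h = 1 ->
  energy h t <= energy h s * expR (- g * (t - s)).
Proof.
move=> s0 st h1.
have : expR (g * t) * energy h t <= expR (g * s) * energy h s.
  apply: (is_derive_nonincreasing (f := fun r => expR (g * r) * energy h r)
    (df := fun r => g * expR (g * r) * energy h r + expR (g * r) * -
      dissipation h r)) => //.
    by move=> r _; exact: (is_derive_fmul (is_derive_expRM g r)
      (is_derive_energy h r)).
  move=> r /andP[sr _]; have := @dissipation_ge h r (le_trans s0 sr) h1.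
  rewrite -subr_ge0 => hd; rewrite -oppr_ge0.
  have -> : - (g * expR (g * r) * energy h r + expR (g * r) * - dissipation h r) =
    expR (g * r) * (dissipation h r - g * energy h r) by ring.
  by rewrite mulr_ge0 ?expR_ge0.
rewrite mulrC -ler_pdivlMr ?expR_gt0// => /le_trans; apply.
rewrite -expRN mulrC mulrA [X in X <= _](_ : _ = energy h s * (expR (- (g * t))
  * expR (g * s))); last by ring.
by rewrite -expRD; rewrite (_ : - (g * t) + g * s = - g * (t - s))//; ring.
Qed.

Lemma is_derive_walk f z (r : R) : is_derive r 1 (fun r => P r f z) (P r (gen1
  f) z).
Proof. exact: is_derive_semigroup (@lin_op_gen1 R G). Qed.

Lemma walk_linear (a : R) f h r z :
  P r (fun x => a * f x + h x) z = a * P r f z + P r h z.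
Proof.
have := @semigroup_sum _ _ (@gen1 R G) r bool [:: true; false]
  (fun b => if b then a else 1) (fun b => if b then f else h) z (@lin_op_gen1 R G).
rewrite !big_cons !big_nil !addr0 !mul1r => <-; congr (semigroup _ _ _ _).
by apply/funext => x; rewrite !big_cons !big_nil !addr0 !mul1r.
Qed.

Lemma walk_dirac f r z : P r f z = \sum_x f x * P r (dirac_law R x) z.
Proof.
rewrite -semigroup_sum; last exact: lin_op_gen1.
by congr (semigroup _ _ _ _); apply/funext => x; rewrite sum_dirac.
Qed.

Lemma is_derive_dot_walk f h (r : R) : is_derive r 1 (fun r => dot (P r f) (P r h))
  (dot (P r (gen1 f)) (P r h) + dot (P r f) (P r (gen1 h))).
Proof.
have hd x := is_derive_fmul (is_derive_fscale (p x) (is_derive_walk f x r))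
  (is_derive_walk h x r).
apply: is_derive_eq_pt (is_derive_fsum hd) _.
by rewrite big_split.
Qed.

Lemma is_derive_norm_walk f (r : R) : is_derive r 1 (fun r => dot (P r f) (P r f))
  (- 2 * dirichlet (P r f)).
Proof.
apply: is_derive_eq_pt (is_derive_dot_walk f f r) _.
have -> : P r (gen1 f) = gen1 (P r f).
  by apply/funext => z; rewrite semigroup_comm//; exact: lin_op_gen1.
by rewrite [X in _ + X]dotC dot_gen1_dirichlet; ring.
Qed.

Lemma mean1_walk f (r : R) : 0 <= r -> dot (fun=> 1) (P r f) = dot (fun=> 1) f.
Proof.
move=> r0.
have -> : dot (fun=> 1) f = dot (fun=> 1) (P 0 f).
  by congr (dot _ _); apply/funext => z; rewrite semigroup0.
have hd (s : R) : is_derive s 1 (fun s => dot (fun=> 1) (P s f)) 0.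
  have hx x := is_derive_fscale (p x * 1) (is_derive_walk f x s).
  apply: is_derive_eq_pt (is_derive_fsum hx) _.
  have -> : P s (gen1 f) = gen1 (P s f).
    by apply/funext => z; rewrite semigroup_comm//; exact: lin_op_gen1.
  transitivity (dot (fun=> 1) (gen1 (P s f))) => //.
  by rewrite dotC dot_gen1 big1 ?oppr0// => e _; rewrite /grad subrr !mulr0.
exact: is_derive_0_is_cst.
Qed.

Lemma norm_walk_decay f (r s : R) : 0 <= r -> r <= s -> dot (fun=> 1) f = 0 ->
  dot (P s f) (P s f) <= dot (P r f) (P r f) * expR (- (2 * g) * (s - r)).
Proof.
move=> r0 rs f0.
pose N r := dot (P r f) (P r f).
have : expR (2 * g * s) * N s <= expR (2 * g * r) * N r.
  apply: (is_derive_nonincreasing (f := fun r => expR (2 * g * r) * N r)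
    (df := fun r => 2 * g * expR (2 * g * r) * N r + expR (2 * g * r) * (- 2 *
      dirichlet (P r f)))) => //.
    by move=> q _; exact: (is_derive_fmul (is_derive_expRM (2 * g) q)
      (is_derive_norm_walk f q)).
  move=> q /andP[rq _].
  have := @poincare (P q f); rewrite mean1_walk ?(le_trans r0)// => /(_ f0).
  rewrite -subr_ge0 => hd; rewrite -oppr_ge0.
  have -> : - (2 * g * expR (2 * g * q) * N q + expR (2 * g * q) * (- 2 *
    dirichlet (P q f))) =
    2 * expR (2 * g * q) * (dirichlet (P q f) - g * N q) by ring.
  by rewrite mulr_ge0// mulr_ge0// expR_ge0.
rewrite mulrC -ler_pdivlMr ?expR_gt0// => /le_trans; apply.
rewrite -expRN [X in X <= _](_ : _ = N r * (expR (- (2 * g * s)) * expR (2 * g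
  * r))); last by ring.
by rewrite -expRD; rewrite (_ : - (2 * g * s) + 2 * g * r = - (2 * g) * (s -
  r))//; ring.
Qed.

Definition dipole e : V -> R := fun z => delta e.1 z - delta e.2 z.

Definition dipole_norm e (r : R) : R := qe e * dot (P r (dipole e)) (P r
  (dipole e)).

Lemma dipole_mean e : dot (fun=> 1) (dipole e) = 0.
Proof. by rewrite dotBr !dot_delta subrr. Qed.

Lemma dipole_norm_ge0 e r : 0 <= dipole_norm e r.
Proof. by rewrite mulr_ge0 ?qe_ge0// dot_ge0. Qed.

(** The walk is a contraction, and at time 0 the bound holds because [qe e] is the inverse of
    [(p e.1)^-1 + (p e.2)^-1]. No waiting time is required, which makes this the bound for the last
    stretch. *)
Lemma dipole_norm_le1 e (r : R) : 0 <= r -> dipole_norm e r <= 1.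
Proof.
move=> r0; apply: (@le_trans _ _ (dipole_norm e 0)).
  rewrite /dipole_norm ler_wpM2l ?qe_ge0//.
  rewrite (le_trans (norm_walk_decay (lexx 0) r0 (dipole_mean e)))//.
  rewrite ler_piMr ?dot_ge0// subr0 -[leRHS]expR0 ler_expR mulNr oppr_le0.
  by rewrite !mulr_ge0// ltW.
rewrite /dipole_norm.
have -> : P 0 (dipole e) = dipole e by apply/funext => z; rewrite semigroup0.
have p1 := weight_gt0 e.1; have p2 := weight_gt0 e.2.
rewrite {2}/dipole dotBr !dot_delta /dipole.
apply: (@le_trans _ _ (qe e * ((p e.1)^-1 + (p e.2)^-1))).
  rewrite ler_wpM2l ?qe_ge0// /delta !eqxx !mul1r.
  have h1 : 0 <= (e.1 == e.2)%:R / p e.2 by rewrite divr_ge0// ltW.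
  have h2 : 0 <= (e.2 == e.1)%:R / p e.1 by rewrite divr_ge0// ltW.
  lra.
rewrite /qe le_eqVlt; apply/orP; left; apply/eqP; field.
by rewrite !gt_eqF// addr_gt0.
Qed.

Definition smoothed h (t s : R) : R :=
  mean s (fun w => dot (P (t - s) (run w h)) (P (t - s) (run w h))) - 1.

Definition smoothed_rate h (t s : R) : R := mean s (fun w =>
  \sum_e rate e * dipole_norm e (t - s) * (qe e * grad e (run w h) ^+ 2)).

Lemma bounded_word_grad2 h e : bounded_word (fun w => qe e * grad e (run w h) ^+ 2).
Proof.
apply: bounded_wordZ; under eq_fun do rewrite expr2.
by apply: bounded_wordM; exact: bounded_word_grad_run.
Qed.

(** Summed over the rings, the first-order term cancels the derivative of [P (t - s)] in [s]; the
    second-order one survives as [smoothed_rate]. *)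
Lemma norm_walk_resample e f r :
  dot (P r (resample e f)) (P r (resample e f)) - dot (P r f) (P r f) =
  2 * dot (fun z => P r (resample e f) z - P r f z) (P r f) +
  dipole_norm e r * (qe e * grad e f ^+ 2).
Proof.
have E : P r (resample e f) =
    fun z => - (qe e * grad e f) * P r (dipole e) z + P r f z.
  apply/funext => z; rewrite -walk_linear; congr (semigroup _ _ _ _).
  by apply/funext => y; rewrite resampleE /dipole; ring.
rewrite dotBl E !dotDl ![dot _ (fun z => _ * _ + _)]dotC !dotDl /dipole_norm.
rewrite [dot (P r f) (P r (dipole e))]dotC; ring.
Qed.

Lemma is_derive_smoothed h (t s : R) :
  is_derive s 1 (smoothed h t) (smoothed_rate h t s).
Proof.
pose D x : V -> R := dirac_law R x.
(* The squared norm is expanded over pairs of vertices, into coefficients [a i] that depend on time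
   and monomials [F i] that depend on the word. This is the shape differentiated by
   [is_derive_word_mean_sum]. *)
pose a (i : V * V) r := dot (P r (D i.1)) (P r (D i.2)).
pose da (i : V * V) r := dot (P r (gen1 (D i.1))) (P r (D i.2)) +
  dot (P r (D i.1)) (P r (gen1 (D i.2))).
pose F (i : V * V) w := run w h i.1 * run w h i.2.
have bilinE (A B : V -> V -> R) f : dot (fun z => \sum_x f x * A x z)
    (fun z => \sum_x f x * B x z) =
    \sum_i dot (A i.1) (B i.2) * (f i.1 * f i.2).
  rewrite -(pair_big xpredT xpredT (fun x y => dot (A x) (B y) * (f x * f y)))/=.
  rewrite {1}/dot; under [LHS]eq_bigr do rewrite -mulrA mulr_suml mulr_sumr.
  rewrite exchange_big/=; apply: eq_bigr => x _.
  under [LHS]eq_bigr do rewrite !mulr_sumr.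
  rewrite exchange_big/=; apply: eq_bigr => y _.
  by rewrite /dot mulr_suml; apply: eq_bigr => z _; ring.
have PE r f : P r f = fun z => \sum_x f x * P r (D x) z.
  by apply/funext => z; exact: walk_dirac.
have PgenE r f : P r (gen1 f) = fun z => \sum_x f x * P r (gen1 (D x)) z.
  apply/funext => z; rewrite -semigroup_sum; last exact: lin_op_gen1.
  congr (semigroup _ _ _ _); apply/funext => x.
  by rewrite {1}(lin_opE f x (@lin_op_gen1 R G)).
have normE r f : dot (P r f) (P r f) = \sum_i a i r * (f i.1 * f i.2).
  by rewrite (PE r f) bilinE.
have bF i : bounded_word (F i) by apply: bounded_wordM; exact: bounded_word_run.
have had i : is_derive s 1 (fun s => a i (t - s)) (- da i (t - s)).
  by apply: is_derive_frefl; exact: is_derive_dot_walk.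
have hd := is_derive_fsub
  (is_derive_word_mean_sum (@rate_ge0 R G) bF had) (is_derive_fcst 1 s).
apply: is_derive_ext.
  2: { apply: is_derive_eq_pt hd _; rewrite subr0 /smoothed_rate.
  congr (word_mean _ s _); apply/funext => w; set f := run w h; set r := t - s.
  have -> : \sum_i - da i r * F i w = - 2 * dot (P r (gen1 f)) (P r f).
    transitivity (- (dot (P r (gen1 f)) (P r f) + dot (P r f) (P r (gen1 f)))).
      rewrite (PgenE r f) (PE r f) !bilinE -big_split/= -sumrN.
      by apply: eq_bigr => i _; rewrite /da /F -/f; ring.
    by rewrite [X in - (_ + X)]dotC; ring.
  rewrite /word_gen.
  have -> : P r (gen1 f) = fun z => \sum_e rate e * (P r (resample e f) z - P r
    f z).
    apply/funext => z.
    have -> : gen1 f = fun z => \sum_e rate e * (resample e f z - f z) by [].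
    rewrite semigroup_sum; last exact: lin_op_gen1.
    apply: eq_bigr => e _; congr (_ * _).
    have := walk_linear (-1) f (resample e f) r z.
    rewrite mulN1r addrC => <-; congr (semigroup _ _ _ _).
    by apply/funext => y; rewrite mulN1r addrC.
  have -> : dot (fun z => \sum_e rate e * (P r (resample e f) z - P r f z)) (P
    r f) =
      \sum_e rate e * dot (fun z => P r (resample e f) z - P r f z) (P r f).
    rewrite {1}/dot; under [LHS]eq_bigr do rewrite mulr_sumr mulr_suml.
    rewrite exchange_big/=; apply: eq_bigr => e _; rewrite /dot mulr_sumr.
    by apply: eq_bigr => z _; ring.
  rewrite mulr_sumr -big_split/=; apply: eq_bigr => e _.
  rewrite /F/= -!normE -/f norm_walk_resample; ring. }
by move=> q; rewrite /smoothed; congr (_ - _); congr (word_mean _ q _);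
  apply/funext => w; rewrite normE.
Qed.

End Energy.

(** * From decay at the rate of the gap to twice the gap *)

Section EnergyIteration.
Variables (R : realType) (G : wgraph R).
Local Notation V := (vertex G).
Local Notation p := (@weight R G).
Local Notation g := (gap G).
Local Notation mean := (word_mean (@rate R G)).
Local Notation P r f := (semigroup (@gen1 R G) r f).
Implicit Types (f h : V -> R) (e : V * V).

Hypothesis V1 : (1 < #|V|)%N.

Let g_gt0 : 0 < g.
Proof. by have [phi []] := gap_eigenfunction V1. Qed.

Lemma walk_cst (r : R) z : P r (fun=> 1) z = 1.
Proof.
transitivity (P 0 (fun=> 1 : R) z); last by rewrite semigroup0.
apply: (@is_derive_0_is_cst R (fun s => P s (fun=> 1) z)) => s.
apply: is_derive_eq_pt (is_derive_walk (fun=> 1) z s) _.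
have -> : gen1 (fun=> 1) = (fun=> 0 : R) :> (V -> R).
  apply/funext => x; rewrite /gen1 big1// => e _.
  by rewrite resample_cst subrr mulr0.
have h : P s (fun _ : V => \sum_(i <- [::] : seq unit) 1 * (0 : R)) z = 0.
  rewrite (@semigroup_sum _ _ _ _ _ [::] (fun=> 1) (fun=> fun=> 0)) ?big_nil//.
  exact: lin_op_gen1.
rewrite -[RHS]h; congr (semigroup _ _ _ _).
by apply/funext => x; rewrite big_nil.
Qed.

Lemma smoothed_end h t : smoothed h t t = energy h t.
Proof.
rewrite /smoothed /energy subrr; congr (word_mean _ t _ - 1); apply/funext => w.
by congr (dot _ _); apply/funext => z; rewrite semigroup0.
Qed.

Lemma bounded_word_norm_walk h r : bounded_word (fun w => dot (P r (run w h))
  (P r (run w h))).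
Proof.
have b z : bounded_word (fun w => P r (run w h) z).
  rewrite [X in bounded_word X](_ : _ = (fun w => \sum_x P r (dirac_law R x) z
    * run w h x)).
    by apply: bounded_word_sum => x; exact: bounded_word_run.
  by apply/funext => w; rewrite walk_dirac; apply: eq_bigr => x _; exact: mulrC.
rewrite [X in bounded_word X](_ : _ =
  (fun w => \sum_x p x * (P r (run w h) x * P r (run w h) x))).
  by apply: bounded_word_sum => x; exact: bounded_wordM.
by apply/funext => w; apply: eq_bigr => x _; rewrite mulrA.
Qed.

Lemma smoothed_rate_le h (t s c : R) : 0 <= s ->
  (forall e, dipole_norm e (t - s) <= c) ->
  smoothed_rate h t s <= c * dissipation h s.
Proof.
move=> s0 hc; rewrite /dissipation -word_meanZ; last 2 first.
- exact: rate_ge0.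
- exact: bounded_word_dirichlet_run.
apply: word_mean_le => //.
- exact: rate_ge0.
- by apply: bounded_word_sum => e; exact: bounded_word_grad2.
- by apply: bounded_wordZ; exact: bounded_word_dirichlet_run.
move=> w; rewrite dirichletE mulr_sumr; apply: ler_sum => e _.
rewrite -mulrA mulrCA ler_wpM2r//.
by rewrite mulr_ge0 ?rate_ge0// mulr_ge0 ?qe_ge0 ?sqr_ge0.
Qed.

Lemma smoothed_rate_ge0 h (t s : R) : 0 <= s -> 0 <= smoothed_rate h t s.
Proof.
move=> s0; apply: word_mean_ge0 => //.
- exact: rate_ge0.
- by apply: bounded_word_sum => e; exact: bounded_word_grad2.
move=> w; apply: sumr_ge0 => e _.
rewrite mulr_ge0 ?[0 <= _ * dipole_norm _ _]mulr_ge0 ?rate_ge0 ?dipole_norm_ge0//.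
by rewrite mulr_ge0 ?qe_ge0 ?sqr_ge0.
Qed.

(** [P t h] is the mean of [run w h], so the difference is a variance; here it is the growth of
    [smoothed] over [[0, t]]. Bounds on the energy thereby reach the walk, and through it the
    dipoles and the eigenfunction. *)
Lemma norm_walk_le_energy h (t : R) : 0 <= t ->
  dot (P t h) (P t h) <= 1 + energy h t.
Proof.
move=> t0; rewrite -smoothed_end addrC -lerBlDr.
have -> : dot (P t h) (P t h) - 1 = smoothed h t 0.
  by rewrite /smoothed word_mean0 subr0.
apply: (is_derive_nondecreasing (df := smoothed_rate h t)) => //.
  by move=> r _; exact: is_derive_smoothed.
by move=> r /andP[r0 _]; exact: smoothed_rate_ge0.
Qed.

(** For each word separately, the walk contracts the squared norm of the mean-zero function
    [run w h - 1] at rate [2 * g]. *)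
Lemma smoothed_init h (s t : R) : 0 <= s -> s <= t -> dot (fun=> 1) h = 1 ->
  smoothed h t s <= energy h s * expR (- (2 * g) * (t - s)).
Proof.
move=> s0 st h1; set c := expR _; have c0 : 0 <= c := expR_ge0 _.
rewrite /smoothed /energy mulrBl mul1r mulrC.
rewrite -word_meanZ; last 2 first.
- exact: rate_ge0.
- exact: bounded_word_norm_run.
suff : mean s (fun w => dot (P (t - s) (run w h)) (P (t - s) (run w h))) <=
    mean s (fun w => c * dot (run w h) (run w h) + (1 - c)).
  rewrite word_meanD ?word_mean_cst; do ?exact: rate_ge0; first lra.
    by apply: bounded_wordZ; exact: bounded_word_norm_run.
  exact: bounded_word_cst.
apply: word_mean_le => //.
- exact: rate_ge0.
- exact: bounded_word_norm_walk.
- apply: bounded_wordD; last exact: bounded_word_cst.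
  by apply: bounded_wordZ; exact: bounded_word_norm_run.
move=> w; set f := run w h.
have ts : 0 <= t - s by rewrite subr_ge0.
have f1 : dot (fun=> 1) f = 1 by rewrite mean1_run.
have := norm_walk_decay V1 (lexx 0) ts (f := fun z => f z - 1).
rewrite dotBr f1 dot11 subrr subr0 -/c => /(_ erefl).
have -> : P 0 (fun z => f z - 1) = fun z => f z - 1.
  by apply/funext => z; rewrite semigroup0.
have -> : P (t - s) (fun z => f z - 1) = fun z => P (t - s) f z - 1.
  apply/funext => z; transitivity (-1 * P (t - s) (fun=> 1) z + P (t - s) f z).
    by rewrite -walk_linear; congr (semigroup _ _ _ _); apply/funext => y; ring.
  by rewrite walk_cst; ring.
rewrite !dot_center//; first by move=> hh; lra.
by rewrite mean1_walk.
Qed.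

(* The smoothed energy G s = E |P_{t-s} h_s|^2 - 1 increases at most as fast as
   the energy decreases, and, at distance at least tau from t, slower than that
   by the factor K * expR (- 2 g (t - s)). *)
Lemma energy_two_step h (K tau s t : R) : 0 <= s -> 0 <= tau -> s + tau <= t ->
  0 <= K -> dot (fun=> 1) h = 1 ->
  (forall e r, tau <= r -> dipole_norm e r <= K * expR (- (2 * g) * r)) ->
  2 * energy h t <= energy h (t - tau) +
    energy h s * expR (- (2 * g) * (t - s)) * (1 + K + 2 * K * expR (g * (t - s))).
Proof.
move=> s0 tau0 stt K0 h1 hK.
have ttau : s <= t - tau by rewrite lerBrDr.
have ttau0 : 0 <= t - tau by rewrite (le_trans s0).
have st : s <= t by rewrite (le_trans ttau)// gerBl.
have e0 := energy_ge0 s0 h1.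
(* On the last stretch only [dipole_norm_le1] is available. Since [smoothed h t t] is [energy h t],
   this is the origin of the factor 2 in the conclusion. *)
have step1 : smoothed h t t + energy h t <= smoothed h t (t - tau) + energy h
  (t - tau).
  apply: (is_derive_nonincreasing
    (f := fun r => smoothed h t r + energy h r)
    (df := fun r => smoothed_rate h t r + - dissipation h r)).
  - by rewrite gerBl.
  - move=> r _; exact: (is_derive_fadd (is_derive_smoothed _ _ _)
    (is_derive_energy _ _)).
  move=> r /andP[tr rt]; rewrite subr_le0 -[leRHS]mul1r.
  have r0 : 0 <= r by rewrite (le_trans _ tr).
  by apply: smoothed_rate_le => // e; apply: dipole_norm_le1 => //;
    rewrite subr_ge0.
(* An integration by parts. The derivative of [c r * energy h r] contains [- c r * dissipation h r],
   which absorbs the growth of [smoothed]; the term left by the derivative of [c] is bounded by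
   [energy_decay] and compensated by [b * expR (g * r)]. *)
pose c r := K * expR (- (2 * g) * t) * expR (2 * g * r).
pose b := 2 * K * expR (- (2 * g) * t) * expR (g * s) * energy h s.
have step2 : smoothed h t (t - tau) + c (t - tau) * energy h (t - tau)
      - b * expR (g * (t - tau)) <=
    smoothed h t s + c s * energy h s - b * expR (g * s).
  apply: (is_derive_nonincreasing
    (f := fun r => smoothed h t r + c r * energy h r - b * expR (g * r))
    (df := fun r => smoothed_rate h t r +
      (K * expR (- (2 * g) * t) * (2 * g * expR (2 * g * r)) * energy h r +
       c r * - dissipation h r) - b * (g * expR (g * r)))) => //.
    move=> r _.
    have hc := is_derive_fscale (K * expR (- (2 * g) * t)) (is_derive_expRM (2
      * g) r).
    exact: (is_derive_fsub (is_derive_fadd (is_derive_smoothed h t r)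
      (is_derive_fmul hc (is_derive_energy h r)))
      (is_derive_fscale b (is_derive_expRM g r))).
  move=> r /andP[sr rt].
  have r0 : 0 <= r by rewrite (le_trans _ sr).
  have hrate : smoothed_rate h t r <= c r * dissipation h r.
    apply: smoothed_rate_le => // e; apply: le_trans (hK e (t - r) _) _.
      by rewrite lerBrDr addrC -lerBrDr.
    rewrite /c -mulrA -expRD ler_wpM2l// ler_expR le_eqVlt.
    by apply/orP; left; apply/eqP; ring.
  have hdec := energy_decay V1 s0 sr h1.
  have hE : K * expR (- (2 * g) * t) * (2 * g * expR (2 * g * r)) * energy h r <=
      b * (g * expR (g * r)).
    rewrite [leRHS](_ : _ = (K * expR (- (2 * g) * t) * (2 * g)) *
      ((expR (g * s) * expR (g * r)) * energy h s)); last by rewrite /b; ring.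
    rewrite [leLHS](_ : _ = (K * expR (- (2 * g) * t) * (2 * g)) *
      (expR (2 * g * r) * energy h r)); last by ring.
    rewrite ler_wpM2l ?mulr_ge0 ?expR_ge0// ?(ltW g_gt0)//.
    rewrite (le_trans (ler_wpM2l (expR_ge0 _) hdec))// mulrCA -expRD mulrC -expRD.
    rewrite le_eqVlt; apply/orP; left; apply/eqP; congr (expR _ * _); ring.
  lra.
have step3 := smoothed_init s0 st h1.
rewrite smoothed_end in step1.
have e1 : 0 <= c (t - tau) * energy h (t - tau).
  by rewrite mulr_ge0 ?energy_ge0// /c mulr_ge0 ?mulr_ge0 ?expR_ge0.
have e2 : 0 <= b * expR (g * s).
  by rewrite /b !mulr_ge0 ?expR_ge0.
have e3 : c s * energy h s = K * (energy h s * expR (- (2 * g) * (t - s))).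
  rewrite /c (_ : - (2 * g) * (t - s) = - (2 * g) * t + 2 * g * s); last by ring.
  by rewrite expRD; ring.
have e4 : b * expR (g * (t - tau)) <=
    2 * K * (energy h s * expR (- (2 * g) * (t - s))) * expR (g * (t - s)).
  rewrite [leLHS](_ : _ = (2 * K * energy h s) *
    (expR (- (2 * g) * t) * expR (g * s) * expR (g * (t - tau))));
      last by rewrite /b; ring.
  rewrite [leRHS](_ : _ = (2 * K * energy h s) *
    (expR (- (2 * g) * (t - s)) * expR (g * (t - s)))); last by ring.
  rewrite ler_wpM2l ?mulr_ge0// -!expRD ler_expR -subr_ge0.
  rewrite (_ : _ - _ = g * tau); last by ring.
  by rewrite mulr_ge0// ltW.
have -> : energy h s * expR (- (2 * g) * (t - s)) * (1 + K + 2 * K * expR (g *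
  (t - s))) =
  energy h s * expR (- (2 * g) * (t - s)) +
  K * (energy h s * expR (- (2 * g) * (t - s))) +
  2 * K * (energy h s * expR (- (2 * g) * (t - s))) * expR (g * (t - s)) by ring.
rewrite -e3; lra.
Qed.

(** Induction on the number of steps of length [tau]. With [X := energy h s * expR (- (2 * g) * (r -
    s))], the claim at [r - tau] gives at most [2 * B * X * (3 / 2)], and [energy_two_step] adds at
    most [B * X]. So [2 * energy h r <= 4 * B * X], which is the claim at [r]. *)
Lemma energy_double_decay h (K tau s t B : R) : 0 <= s -> 0 < tau -> s <= t ->
  0 <= K -> dot (fun=> 1) h = 1 -> expR (2 * g * tau) <= 3 / 2 ->
  (forall e r, tau <= r -> dipole_norm e r <= K * expR (- (2 * g) * r)) ->
  1 + K + 2 * K * expR (g * (t - s)) <= B ->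
  energy h t <= 2 * B * energy h s * expR (- (2 * g) * (t - s)).
Proof.
move=> s0 tau0 st K0 h1 htau hK hB.
have e0 := energy_ge0 s0 h1.
have B1 : 1 <= B.
  apply: le_trans hB; rewrite -addrA lerDl addr_ge0// !mulr_ge0// expR_ge0//.
pose n := Num.bound ((t - s) / tau).
have tn : t <= s + n%:R * tau.
  rewrite -lerBlDl -ler_pdivrMr//; apply/ltW/archi_boundP.
  by rewrite divr_ge0 ?subr_ge0// ltW.
suff H : forall n r, s <= r -> r <= t -> r <= s + n%:R * tau ->
    energy h r <= 2 * B * energy h s * expR (- (2 * g) * (r - s)) by exact: H tn.
clear tn n; elim=> [|n IH] r sr rt rn.
  have -> : r = s by apply/eqP; rewrite eq_le sr andbT; rewrite mul0r addr0 in rn.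
  rewrite subrr mulr0 expR0 mulr1 ler_peMl//; lra.
(* Within one step of [s] monotonicity is enough, at the price of a factor [3 / 2 <= 2 * B]. *)
have [rs|rs] := lerP r (s + tau).
  apply: le_trans (energy_nonincreasing h s0 sr) _.
  rewrite mulrAC -[leLHS]mul1r ler_wpM2r//.
  have h2 : expR (2 * g * (r - s)) <= 3 / 2.
    apply: le_trans htau; rewrite ler_expR ler_pM2l ?mulr_gt0//; lra.
  rewrite mulNr expRN -ler_pdivrMr ?invr_gt0 ?expR_gt0// invrK mul1r.
  by apply: (le_trans h2); lra.
have hstep := energy_two_step s0 (ltW tau0) (ltW rs) K0 h1 hK.
have srt : s <= r - tau by rewrite lerBrDr ltW.
have := IH (r - tau) srt.
have -> : r - tau <= t by rewrite (le_trans _ rt)// gerBl ltW.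
have -> : r - tau <= s + n%:R * tau by rewrite lerBlDr -addrA -[X in _ + (_ +
  X)]mul1r -mulrDl natr1.
move=> /(_ isT isT) hIH.
set X := energy h s * expR (- (2 * g) * (r - s)).
have X0 : 0 <= X by rewrite mulr_ge0// expR_ge0.
have hIH' : energy h (r - tau) <= 2 * B * X * (3 / 2).
  apply: (le_trans hIH); rewrite (_ : - (2 * g) * (r - tau - s) =
    - (2 * g) * (r - s) + 2 * g * tau); last by ring.
  rewrite expRD [leLHS](_ : _ = 2 * B * X * expR (2 * g * tau)); last first.
    by rewrite /X; ring.
  by rewrite ler_wpM2l// mulr_ge0//; lra.
have hX : X * (1 + K + 2 * K * expR (g * (r - s))) <= X * B.
  rewrite ler_wpM2l// (le_trans _ hB)// lerD2l ler_wpM2l ?mulr_ge0//.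
  by rewrite ler_expR ler_pM2l// lerD2r.
rewrite -mulrA -/X; rewrite -/X in hstep.
have XB : X <= X * B by rewrite ler_peMr.
nra.
Qed.

End EnergyIteration.

(** * Nash inequality *)

Section NashBound.
Variables (R : realType) (G : wgraph R).
Local Notation V := (vertex G).
Local Notation p := (@weight R G).
Local Notation mean := (word_mean (@rate R G)).
Implicit Types (f h : V -> R).

(** Young's inequality for [y] and the power [q - 1] of [a]: the convex power function lies above
    its tangent at [a]. Averaged, this is Jensen's inequality. *)
Lemma powR_tangent (q y a : R) : 1 < q -> 0 <= y -> 0 < a ->
  q * a `^ (q - 1) * y - (q - 1) * a `^ q <= y `^ q.
Proof.
move=> q1 y0 a0; have q0 : 0 < q by rewrite (lt_trans ltr01).
have q10 : 0 < q - 1 by rewrite subr_gt0.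
have := @conjugate_powR R y (a `^ (q - 1)) q (q / (q - 1)) y0 (powR_ge0 _ _) q0
  (divr_gt0 q0 q10).
have -> : q^-1 + (q / (q - 1))^-1 = 1 by field; rewrite !gt_eqF.
move=> /(_ erefl); rewrite -powRrM.
have -> : (q - 1) * (q / (q - 1)) = q by field; rewrite gt_eqF.
move=> h; have : q * (y * a `^ (q - 1)) <=
    q * (y `^ q / q + a `^ q / (q / (q - 1))) by rewrite ler_pM2l.
have -> : q * (y `^ q / q + a `^ q / (q / (q - 1))) = y `^ q + (q - 1) * a `^ q.
  by field; rewrite !gt_eqF.
by move=> h2; rewrite lerBlDr; apply: le_trans h2; rewrite le_eqVlt; apply/orP;
  left; apply/eqP; ring.
Qed.

Lemma pnorm2_sqr h : pnorm 2 h ^+ 2 = dot h h.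
Proof.
have -> : dot h h = \sum_x p x * `|h x| `^ 2.
  apply: eq_bigr => x _; rewrite powR_mulrn// real_normK ?num_real// expr2; ring.
rewrite /pnorm powR12_sqrt ?sqr_sqrtr//; apply: sumr_ge0 => x _;
  by rewrite mulr_ge0 ?powR_ge0// ltW// weight_gt0.
Qed.

Lemma pnorm2_powR h (q : R) : pnorm 2 h `^ (2 * q) = dot h h `^ q.
Proof.
rewrite powRrM powR_mulrn ?pnorm2_sqr// /pnorm; exact: powR_ge0.
Qed.

Lemma pnorm1_density h : density h -> pnorm 1 h = 1.
Proof.
move=> [h0 h1]; rewrite /pnorm invr1.
have -> : \sum_x p x * `|h x| `^ 1 = 1.
  rewrite -[RHS]h1; apply: eq_bigr => x _; rewrite powRr1// ger0_norm//.
  by rewrite mulr1.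
by rewrite powR1.
Qed.

Lemma nash_density (d tNash T : R) h : nash_inequality G d tNash T ->
  density h ->
  dot h h `^ (1 + 2 / d) <= tNash * (dirichlet h + T^-1 * dot h h).
Proof.
move=> nash hh; have := nash h.
by rewrite pnorm2_powR pnorm2_sqr pnorm1_density// powR1 mulr1.
Qed.

(** Every [run w h] is a density, so its L1 norm in the Nash inequality is 1. The tangent is taken
    at the mean [u] of the squared norm, which turns the power of the norm into an affine function
    of it. *)
Lemma nash_dissipation (d tNash T : R) h (s : R) : 0 < d ->
  nash_inequality G d tNash T -> density h -> 0 <= s ->
  (1 + energy h s) `^ (1 + 2 / d) <=
    tNash * (dissipation h s + T^-1 * (1 + energy h s)).
Proof.
move=> d0 nash hh s0; set u := 1 + energy h s.
have uE : u = mean s (fun w => dot (run w h) (run w h)) by rewrite /u /energy; ring.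
have u0 : 0 < u by rewrite ltr_wpDr// energy_ge0//; case: hh.
set q := 1 + 2 / d.
have q1 : 1 < q by rewrite ltrDl divr_gt0.
have c0 := @rate_ge0 R G.
have b1 := bounded_word_norm_run h.
have b2 := bounded_word_dirichlet_run h.
have -> : u `^ q = mean s (fun w => q * u `^ (q - 1) * dot (run w h) (run w h)
                                    - (q - 1) * u `^ q).
  rewrite word_meanB//; last 2 first.
  - exact: bounded_wordZ.
  - exact: bounded_word_cst.
  rewrite word_mean_cst// word_meanZ// -uE.
  have hq : u `^ q = u `^ (q - 1) * u.
    rewrite -{1}(subrK 1 q) powRD ?(gt_eqF u0) ?implybT//.
    by rewrite powRr1// ltW.
  by rewrite hq; ring.
rewrite /dissipation uE -word_meanZ// -word_meanD//; last exact: bounded_wordZ.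
rewrite -word_meanZ//; last by apply: bounded_wordD => //; exact: bounded_wordZ.
apply: word_mean_le => //.
- by apply: bounded_wordB; [exact: bounded_wordZ | exact: bounded_word_cst].
- by apply: bounded_wordZ; apply: bounded_wordD => //; exact: bounded_wordZ.
move=> w; apply: le_trans (nash_density nash (density_run w hh)).
by rewrite -uE; apply: powR_tangent => //; exact: dot_ge0.
Qed.

(* The function expR (2 / d * (s / T - ln (1 + energy h s))) - 2 / d * s / tNash
   is nondecreasing by the Nash inequality. *)
Lemma nash_energy (d tNash T : R) h (s : R) : 0 < d -> 0 < tNash -> 0 < T ->
  nash_inequality G d tNash T -> density h -> 0 < s ->
  ln (1 + energy h s) <= s / T + d / 2 * ln (d * tNash / (2 * s)).
Proof.
move=> d0 tN0 T0 nash hh s0.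
pose b := 2 / d; have b0 : 0 < b by rewrite divr_gt0.
pose u r := 1 + energy h r.
have u1 r : 0 <= r -> 0 < u r.
  by move=> r0; rewrite ltr_wpDr// energy_ge0//; case: hh.
have hu (r : R) : is_derive r 1 u (0 + - dissipation h r).
  exact: is_derive_fadd (is_derive_fcst 1 r) (is_derive_energy h r).
pose z r := expR (b * (T^-1 * r - ln (u r))) - b / tNash * r.
pose dz r := expR (b * (T^-1 * r - ln (u r))) *
  (b * (T^-1 * 1 - (u r)^-1 * (0 + - dissipation h r))) - b / tNash * 1.
have hz (r : R) : 0 <= r -> is_derive r 1 z (dz r).
  move=> r0.
  have h1 := @is_derive1_comp R (@ln R) u r _ _ (is_derive1_ln (u1 r r0)) (hu r).
  have h2 := is_derive_fscale b (is_derive_fsub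
    (is_derive_fscale T^-1 (is_derive_id r 1)) h1).
  have h3 := @is_derive1_comp R (@expR R) (fun s => b * (T^-1 * s - ln (u s))) r _ _
    (is_derive_expR _) h2.
  exact: is_derive_fsub h3 (is_derive_fscale (b / tNash) (is_derive_id r 1)).
have : z 0 <= z s.
  apply: (is_derive_nondecreasing (df := dz)); first exact: ltW.
    by move=> r /andP[r0 _]; exact: hz.
  move=> r /andP[r0 _]; have ur := u1 r r0.
  have hn := nash_dissipation d0 nash hh r0; rewrite -/(u r) -/b in hn.
  have hpow : u r `^ (1 + b) = u r * expR (b * ln (u r)).
    have -> : u r `^ (1 + b) = u r `^ 1 * u r `^ b.
      by apply: powRD; rewrite (gt_eqF ur) implybT.
    by rewrite powRr1 ?(ltW ur)// /powR (gt_eqF ur).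
  rewrite hpow in hn.
  have hD : expR (b * ln (u r)) / tNash <= T^-1 + (u r)^-1 * dissipation h r.
    rewrite ler_pdivrMr// -(ler_pM2l ur) (le_trans hn)// le_eqVlt.
    apply/orP; left; apply/eqP; field; rewrite !gt_eqF//.
  rewrite /dz subr_ge0.
  apply: (@le_trans _ _ (expR (b * (T^-1 * r - ln (u r))) * (b * (expR (b * ln
    (u r)) / tNash)))).
    rewrite [leRHS](_ : _ = b / tNash * (expR (b * (T^-1 * r - ln (u r))) *
      expR (b * ln (u r)))); last by ring.
    have hE : 1 <= expR (b * (T^-1 * r - ln (u r))) * expR (b * ln (u r)).
      rewrite -expRD -[leLHS]expR0 ler_expR.
      have -> : b * (T^-1 * r - ln (u r)) + b * ln (u r) = b * (T^-1 * r) by ring.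
      by rewrite mulr_ge0 ?(ltW b0)// mulr_ge0// invr_ge0 ltW.
    by rewrite ler_wpM2l// divr_ge0// ltW.
  rewrite ler_wpM2l ?expR_ge0// ler_wpM2l ?(ltW b0)//.
  by apply: (le_trans hD); rewrite le_eqVlt; apply/orP; left; apply/eqP; ring.
(* At time 0 only the exponential remains, and it is positive whatever [energy h 0]: the initial
   density drops out of the bound. *)
move=> z0s; have : 0 <= z s.
  by apply: le_trans z0s; rewrite /z !mulr0 subr0 expR_ge0.
rewrite /z subr_ge0 => hs.
have bs : 0 < b / tNash * s by rewrite mulr_gt0// divr_gt0.
have : ln (b / tNash * s) <= b * (T^-1 * s - ln (u s)).
  by rewrite -[leRHS]expRK ler_ln ?posrE ?expR_gt0.
have -> : d * tNash / (2 * s) = (b / tNash * s)^-1.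
  by rewrite /b; field; rewrite (gt_eqF d0) (gt_eqF tN0) (gt_eqF s0).
rewrite lnV ?posrE// -/(u s) => hs2.
have : d / 2 * ln (b / tNash * s) <= d / 2 * (b * (T^-1 * s - ln (u s))).
  by rewrite ler_wpM2l// divr_ge0 ?(ltW d0).
have -> : d / 2 * (b * (T^-1 * s - ln (u s))) = T^-1 * s - ln (u s).
  by rewrite /b; field; rewrite (gt_eqF T0) (gt_eqF d0).
lra.
Qed.

End NashBound.

(** * Total variation bounds *)

Lemma le_sup_range (R : realType) (I : finType) (F : I -> R) i :
  F i <= sup (range F).
Proof.
apply: ub_le_sup; last by exists i.
exists (\sum_j `|F j|) => _ [j _ <-].
by rewrite (le_trans (ler_norm _))// (bigD1 j)//= lerDl sumr_ge0.
Qed.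

Lemma sup_range_le (R : realType) (I : finType) (F : I -> R) (i0 : I) (c : R) :
  (forall i, F i <= c) -> sup (range F) <= c.
Proof.
move=> hF; apply: ge_sup; first by exists (F i0), i0.
by move=> _ [i _ <-].
Qed.

(** * Product laws and their chi-square distance to equilibrium *)

Section ProductMeasures.
Variables (R : realType) (G : wgraph R) (k : nat).
Local Notation V := (vertex G).
Local Notation p := (@weight R G).
Local Notation lab := {ffun 'I_k -> V}.
Local Notation one := (fun=> fun=> 1 : R).
Implicit Types (h : 'I_k -> V -> R) (F : lab -> R) (u : lab).

Lemma prod_mean_prod h (psi : 'I_k -> V -> R) :
  prod_mean h (fun u => \prod_i psi i (u i)) = \prod_i dot (h i) (psi i).
Proof.
rewrite /prod_mean.
under [LHS]eq_bigr do rewrite -big_split/=.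
rewrite -(bigA_distr_bigA (fun i a => p a * h i a * psi i a)).
by apply: eq_bigr => i _.
Qed.

Lemma prod_mean1_density h : (forall i, density (h i)) ->
  prod_mean h (fun=> 1) = 1.
Proof.
move=> hh; transitivity (prod_mean h (fun u => \prod_i (fun=> 1 : R) (u i))).
  by congr prod_mean; apply/funext => u; rewrite big1.
rewrite (prod_mean_prod h (fun=> fun=> 1)) big1// => i _.
by rewrite dotC; case: (hh i).
Qed.

Lemma prod_weight_ge0 h u : (forall i, density (h i)) ->
  0 <= \prod_i (p (u i) * h i (u i)).
Proof.
move=> hh; apply: prodr_ge0 => i _; rewrite mulr_ge0 ?(ltW (weight_gt0 _))//.
by case: (hh i).
Qed.

Lemma prod_mean_le h F1 F2 : (forall i, density (h i)) ->
  (forall u, F1 u <= F2 u) -> prod_mean h F1 <= prod_mean h F2.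
Proof.
move=> hh hF; apply: ler_sum => u _; rewrite ler_wpM2l//.
exact: prod_weight_ge0.
Qed.

Lemma density1 : density (fun _ : V => 1).
Proof. by split=> //; rewrite dot11. Qed.

Lemma prod_meanD h F1 F2 (a b : R) :
  prod_mean h (fun u => a * F1 u + b * F2 u) =
  a * prod_mean h F1 + b * prod_mean h F2.
Proof.
rewrite /prod_mean !mulr_sumr -big_split/=; apply: eq_bigr => u _; ring.
Qed.

Lemma prod_meanZ h F (a : R) :
  prod_mean h (fun u => a * F u) = a * prod_mean h F.
Proof.
rewrite /prod_mean !mulr_sumr; apply: eq_bigr => u _; ring.
Qed.

Lemma prod_mean_relative h F :
  prod_mean h F - prod_mean one F =
  prod_mean one (fun u => (\prod_i h i (u i) - 1) * F u).
Proof.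
rewrite /prod_mean -sumrB; apply: eq_bigr => u _.
have -> : \prod_i (p (u i) * h i (u i)) = \prod_i (p (u i) * 1) * \prod_i h i (u i).
  by rewrite -big_split; apply: eq_bigr => i _; rewrite mulr1.
ring.
Qed.

Lemma chi_square h : (forall i, density (h i)) ->
  prod_mean one (fun u => (\prod_i h i (u i) - 1) ^+ 2) =
  \prod_i dot (h i) (h i) - 1.
Proof.
move=> hh.
have -> : (fun u => (\prod_i h i (u i) - 1) ^+ 2) = (fun u =>
    1 * \prod_i (h i (u i) * h i (u i)) + -1 * (2 * \prod_i h i (u i) + -1 * 1)).
  by apply/funext => u; rewrite big_split/=; ring.
have h2 : prod_mean one (fun u => \prod_i (h i (u i) * h i (u i))) =
    \prod_i dot (h i) (h i).
  rewrite (prod_mean_prod one (fun i x => h i x * h i x)).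
  by apply: eq_bigr => i _; apply: eq_bigr => x _; ring.
have h1 : prod_mean one (fun u => \prod_i h i (u i)) = 1.
  by rewrite prod_mean_prod big1// => i _; case: (hh i).
rewrite !prod_meanD h1 h2 prod_mean1_density; last by move=> i; exact: density1.
ring.
Qed.

Lemma expR_le_1D2x (s : R) : 0 <= s -> s <= 2^-1 -> expR s <= 1 + 2 * s.
Proof.
move=> s0 s2; rewrite -[s]opprK expRN.
have h1 := expR_ge1Dx (- s).
have h2 : 0 < 1 - s by lra.
apply: (@le_trans _ _ (1 - s)^-1); first by rewrite lef_pV2 ?posrE ?expR_gt0.
by rewrite -[leLHS]mul1r ler_pdivrMr// opprK; nra.
Qed.

(* AM-GM, once pointwise to pass from L1 to L2 and once to discard the
   case where the chi-square distance is not small. *)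
Lemma prod_mean_close h F (theta : R) : 0 < theta ->
  (forall i, density (h i)) -> (forall u, 0 <= F u <= 1) ->
  `|prod_mean h F - prod_mean one F| <=
  theta / 2 + theta^-1 * \sum_i (dot (h i) (h i) - 1).
Proof.
move=> th0 hh F01.
set s := \sum_i _.
have a0 i : 0 <= dot (h i) (h i) - 1 by rewrite subr_ge0; exact: density_norm_ge1.
have s0 : 0 <= s by exact: sumr_ge0.
have d1 (i : 'I_k) := density1.
have F0 u : 0 <= F u by case/andP: (F01 u).
have F1 u : F u <= 1 by case/andP: (F01 u).
have [s2|s2] := lerP s 2^-1.
  have hp : prod_mean one (fun u => (\prod_i h i (u i) - 1) ^+ 2) <= 2 * s.
    rewrite chi_square// lerBlDl (le_trans _ (expR_le_1D2x s0 s2))//.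
    rewrite expR_sum; apply: ler_prod => i _.
    by rewrite dot_ge0/=; have := expR_ge1Dx (dot (h i) (h i) - 1);
      rewrite addrC subrK.
  rewrite prod_mean_relative.
  apply: (@le_trans _ _ (prod_mean one (fun u => theta / 2 * 1 +
      (2 * theta)^-1 * (\prod_i h i (u i) - 1) ^+ 2))).
    rewrite (le_trans (ler_norm_sum _ _ _))//; apply: ler_sum => u _.
    have w0 := prod_weight_ge0 u d1.
    rewrite normrM (ger0_norm w0); apply: ler_wpM2l => //=.
    set a := \prod_i _ - 1; rewrite normrM (ger0_norm (F0 u)).
    apply: (@le_trans _ _ `|a|); first by rewrite ler_piMr.
    rewrite -subr_ge0 -(real_normK (num_real a)).
    rewrite (_ : _ - _ = (2 * theta)^-1 * (`|a| - theta) ^+ 2).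
      by rewrite mulr_ge0 ?sqr_ge0// invr_ge0 mulr_ge0// ltW.
    by field; rewrite gt_eqF.
  rewrite prod_meanD prod_mean1_density// mulr1 lerD2l.
  have -> : theta^-1 * s = (2 * theta)^-1 * (2 * s) by field; rewrite gt_eqF.
  by rewrite ler_wpM2l// invr_ge0 mulr_ge0// ltW.
apply: (@le_trans _ _ 1).
  have h1 := prod_mean_le hh F1; have h2 := prod_mean_le hh F0.
  have h3 := prod_mean_le d1 F1; have h4 := prod_mean_le d1 F0.
  rewrite prod_mean1_density// in h1; rewrite prod_mean1_density// in h3.
  have z h' : prod_mean h' (fun=> 0) = 0.
    by rewrite /prod_mean big1// => u _; rewrite mulr0.
  rewrite z in h2; rewrite z in h4.
  by rewrite ler_norml; apply/andP; split; lra.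
apply: (@le_trans _ _ (theta / 2 + theta^-1 * 2^-1)); last first.
  by rewrite lerD2l ler_wpM2l ?invr_ge0 ?ltW.
rewrite -subr_ge0 (_ : _ - 1 = (2 * theta)^-1 * (theta - 1) ^+ 2).
  by rewrite mulr_ge0 ?sqr_ge0// invr_ge0 mulr_ge0// ltW.
by field; rewrite gt_eqF.
Qed.

End ProductMeasures.

Section TotalVariation.
Variables (R : realType) (G : wgraph R) (k : nat).
Local Notation V := (vertex G).
Local Notation one := (fun=> fun=> 1 : R).
Implicit Types (A : {set config V k}).

Definition event A (xi : config V k) : R := (xi \in A)%:R.

Lemma prob_of_law xi A (t : R) :
  prob_of (law_at (@bin_gen R G k) (dirac_law R xi) t) A =
  semigroup (@bin_gen R G k) t (event A) xi.
Proof.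
have -> : event A = fun z => \sum_(y <- enum A) 1 * dirac_law R y z.
  apply/funext => z; rewrite big_enum/= /event; have [zA|zA] := boolP (z \in A).
    rewrite (bigD1 z)//= big1 ?addr0.
      by rewrite /dirac_law eqxx mul1r.
    by move=> y /andP[_ /negbTE yz]; rewrite /dirac_law eq_sym yz mulr0.
  rewrite big1// => y yA; rewrite /dirac_law; case: eqP => [zy|_].
    by rewrite -zy (negbTE zA) in yA.
  by rewrite mulr0.
rewrite semigroup_sum; last exact: lin_op_bin_gen.
rewrite big_enum/=; apply: eq_bigr => y _; rewrite mul1r /law_at.
rewrite -[RHS](sum_dirac (fun x => semigroup (@bin_gen R G k) t (dirac_law R y)
  x) xi).
by apply: eq_bigr => x _; rewrite mulrC /dirac_law eq_sym.
Qed.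

Lemma prob_of_multinomial A :
  prob_of (@multinomial_law R G k) A = prod_mean one (fun u => event A (cfg u)).
Proof.
rewrite -prod_mean_law /prob_of big_mkcond/=; apply: eq_bigr => xi _.
by rewrite /event; case: ifP; rewrite ?mulr1 ?mulr0.
Qed.

Lemma event_itv A xi : 0 <= event A xi <= 1.
Proof. by rewrite /event; case: (xi \in A); rewrite ?lexx ler01. Qed.

(** Given the word, the law is a product of evolved Dirac densities, to which [prod_mean_close]
    applies. Its bound is affine in the squared norms and therefore averages over the words;
    optimising [theta] beforehand would leave a square root. *)
Lemma worst_tv_le (t M theta : R) : 0 <= t -> 0 < theta ->
  (forall x : V, energy (delta x) t <= M) ->
  worst_tv G k t <= theta / 2 + theta^-1 * (k%:R * M).
Proof.
move=> t0 th0 hM; rewrite /worst_tv.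
have [x0 _] : exists x : V, true.
  have [x _|h] := pickP (fun _ : V => true); first by exists x.
  have := weight_sum1 G; rewrite big1; last by move=> x; have := h x.
  by move/eqP; rewrite eq_sym oner_eq0.
apply: (sup_range_le (cfg [ffun=> x0])) => xi.
apply: (sup_range_le finset.set0) => A.
have [u <-] := cfg_surj xi.
rewrite prob_of_law prob_of_multinomial.
have := particle_representation (fun i => delta (u i)) (event A) t0.
rewrite initial_lawE prod_mean_delta => ->.
set c := prod_mean one _.
have c0 := @rate_ge0 R G.
have bF := bounded_word_prod_mean (fun i => delta (u i)) (fun z => event A (cfg z)).
pose E w := \sum_i 1 * (dot (run w (delta (u i))) (run w (delta (u i))) - 1).
have bE : bounded_word E.
  apply: bounded_word_sum => i; apply: bounded_wordB; last exact: bounded_word_cst.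
  exact: bounded_word_norm_run.
have hE : word_mean (@rate R G) t E <= k%:R * M.
  rewrite word_mean_sum//; last first.
    move=> i; apply: bounded_wordB; last exact: bounded_word_cst.
    exact: bounded_word_norm_run.
  rewrite -[k in k%:R]card_ord -sum1_card natr_sum mulr_suml.
  apply: ler_sum => i _; rewrite ler_wpM2l// word_meanB//.
  - by rewrite word_mean_cst//; exact: hM.
  - exact: bounded_word_norm_run.
  - exact: bounded_word_cst.
have bB : bounded_word (fun w => theta / 2 + theta^-1 * E w).
  by apply: bounded_wordD; [exact: bounded_word_cst | exact: bounded_wordZ].
have mB : word_mean (@rate R G) t (fun w => theta / 2 + theta^-1 * E w) <=
    theta / 2 + theta^-1 * (k%:R * M).
  rewrite word_meanD//; last 2 first.
  - exact: bounded_word_cst.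
  - exact: bounded_wordZ.
  by rewrite word_mean_cst// word_meanZ// lerD2l ler_wpM2l// invr_ge0 ltW.
have close w : `|prod_mean (fun i => run w (delta (u i))) (fun z => event A
  (cfg z)) - c|
    <= theta / 2 + theta^-1 * E w.
  have := @prod_mean_close _ _ k (fun i => run w (delta (u i)))
    (fun z => event A (cfg z)) theta th0.
  rewrite /E; under [in X in _ -> X]eq_bigr do rewrite mul1r; apply.
    by move=> i; apply: density_run; exact: density_delta.
  by move=> z; exact: event_itv.
rewrite ler_norml; apply/andP; split.
  rewrite lerBrDl -lerBrDr opprK -lerBlDl; apply: le_trans mB.
  rewrite -(word_mean_cst c0 t c) -word_meanB//; last exact: bounded_word_cst.
  apply: word_mean_le => //.
    by apply: bounded_wordB => //; exact: bounded_word_cst.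
  by move=> w; have := close w; rewrite ler_norml => /andP[]; lra.
apply: le_trans mB.
rewrite -(word_mean_cst c0 t c) -word_meanB//; last exact: bounded_word_cst.
apply: word_mean_le => //.
  by apply: bounded_wordB => //; exact: bounded_word_cst.
by move=> w; have := close w; rewrite ler_norml => /andP[].
Qed.

(** A start from [k] independent particles of density [h] is a mixture of deterministic starts, and
    the worst of these is at least as far from equilibrium on [A] as the average. *)
Lemma worst_tv_ge (t : R) (h : V -> R) A : 0 <= t -> density h ->
  word_mean (@rate R G) t
    (fun w => prod_mean (fun=> run w h) (fun u => event A (cfg u))) -
  prod_mean one (fun u => event A (cfg u)) <= worst_tv G k t.
Proof.
move=> t0 hh; rewrite -particle_representation// -prob_of_multinomial.
set mu := prob_of _ A; set S := semigroup _ _ _.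
have hS xi : S xi - mu <= worst_tv G k t.
  have H := @le_sup_range R _ (fun xi : config V k =>
    tv_dist (law_at (@bin_gen R G k) (dirac_law R xi) t) (@multinomial_law R G
      k)) xi.
  apply: le_trans H.
  have H := @le_sup_range R _ (fun A : {set config V k} =>
    `|prob_of (law_at (@bin_gen R G k) (dirac_law R xi) t) A -
      prob_of (@multinomial_law R G k) A|) A.
  by apply: le_trans H; rewrite prob_of_law ler_norm.
have mass : \sum_xi initial_law (fun _ : 'I_k => h) xi = 1.
  transitivity (\sum_xi initial_law (fun _ : 'I_k => h) xi * (1 : R)).
    by apply: eq_bigr => xi _; rewrite mulr1.
  by rewrite (initial_lawE (fun=> h) (fun=> 1)) prod_mean1_density.
rewrite lerBlDr -[leRHS]mul1r -mass mulr_suml; apply: ler_sum => xi _.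
rewrite ler_wpM2l//; last by rewrite -lerBlDr.
apply: sumr_ge0 => u _; apply: mulr_ge0 => //.
exact: (prod_weight_ge0 (h := fun=> h)).
Qed.

End TotalVariation.

(** * Consequences of a bound [U] on the energy at time [tau] *)

Section Regularised.
Variables (R : realType) (G : wgraph R).
Local Notation V := (vertex G).
Local Notation p := (@weight R G).
Local Notation g := (gap G).
Local Notation mean := (word_mean (@rate R G)).
Local Notation P r f := (semigroup (@gen1 R G) r f).
Implicit Types (f h phi : V -> R) (e : V * V).

Variables (tau U W : R).
Hypothesis V1 : (1 < #|V|)%N.
Hypothesis tau_gt0 : 0 < tau.
Hypothesis g_tau : expR (2 * g * tau) <= 3 / 2.
Hypothesis U_ge0 : 0 <= U.
Hypothesis energyU : forall h, density h -> energy h tau <= U.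
Hypothesis weightW : forall x, p x <= W.

Let g_gt0 : 0 < g.
Proof. by have [phi []] := gap_eigenfunction V1. Qed.

Let W_ge0 : 0 <= W.
Proof.
have [x _] := card_gt1P V1; apply: le_trans (weightW x); exact/ltW/weight_gt0.
Qed.

(** The constant 6 is [4 * (3 / 2)]: 4 from splitting the dipole into two Dirac densities, [3 / 2]
    from moving the origin of the decay from [tau] to 0. The factor [W], of order 1 / n, bounds
    [qe e]. *)
Lemma dipole_norm_decay e r : tau <= r ->
  dipole_norm e r <= 6 * W * (1 + U) * expR (- (2 * g) * r).
Proof.
move=> tr; rewrite /dipole_norm.
have hd := norm_walk_decay V1 (ltW tau_gt0) tr (dipole_mean e).
have hx x : dot (P tau (delta x)) (P tau (delta x)) <= 1 + U.
  apply: le_trans (norm_walk_le_energy _ (ltW tau_gt0)) _.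
  by rewrite lerD2l; apply: energyU; exact: density_delta.
have htau : dot (P tau (dipole e)) (P tau (dipole e)) <= 4 * (1 + U).
  have -> : P tau (dipole e) =
      fun z => P tau (delta e.1) z - P tau (delta e.2) z.
    apply/funext => z.
    transitivity (-1 * P tau (delta e.2) z + P tau (delta e.1) z); last by ring.
    by rewrite -walk_linear; congr (semigroup _ _ _ _); apply/funext => y;
      rewrite /dipole; ring.
  apply: le_trans (dotB_le _ _) _.
  have := hx e.1; have := hx e.2; lra.
have hexp : expR (- (2 * g) * (r - tau)) <= 3 / 2 * expR (- (2 * g) * r).
  rewrite (_ : - (2 * g) * (r - tau) = 2 * g * tau + - (2 * g) * r); last by ring.
  by rewrite expRD ler_wpM2r ?expR_ge0.
apply: (@le_trans _ _ (W * (4 * (1 + U) * (3 / 2 * expR (- (2 * g) * r)))));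
  last first.
  by rewrite le_eqVlt; apply/orP; left; apply/eqP; field.
apply: ler_pM => //; first exact: qe_ge0.
- exact: dot_ge0.
- by apply: le_trans (weightW e.1); exact: qe_le.
by apply: (le_trans hd); apply: ler_pM => //; exact: dot_ge0.
Qed.

(** [energy_double_decay] is started at [tau], where the energy is at most [U]; at time 0 that of a
    Dirac density is [(p x)^-1 - 1]. Moving the origin back turns the factor 2 into 3. *)
Lemma energy_upper h (t : R) : density h -> tau <= t ->
  energy h t <= 3 * U * (1 + 6 * W * (1 + U) * (1 + 2 * expR (g * t))) *
    expR (- (2 * g) * t).
Proof.
move=> hh tt; have h1 : dot (fun=> 1) h = 1 by case: hh.
set K := 6 * W * (1 + U).
have K0 : 0 <= K by rewrite /K mulr_ge0 ?mulr_ge0// addr_ge0.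
set B := 1 + K * (1 + 2 * expR (g * t)).
have egt : expR (g * (t - tau)) <= expR (g * t).
  by rewrite ler_expR ler_pM2l// gerBl ltW.
have hB : 1 + K + 2 * K * expR (g * (t - tau)) <= B.
  rewrite /B -subr_ge0.
  rewrite (_ : _ - _ = 2 * K * (expR (g * t) - expR (g * (t - tau)))); last by ring.
  by rewrite mulr_ge0 ?subr_ge0// mulr_ge0.
have B0 : 0 <= B.
  apply: le_trans hB; rewrite !addr_ge0// mulr_ge0 ?expR_ge0// mulr_ge0//.
have := energy_double_decay V1 (ltW tau_gt0) tau_gt0 tt K0 h1 g_tau
  dipole_norm_decay hB.
move=> /le_trans; apply.
rewrite (_ : - (2 * g) * (t - tau) = 2 * g * tau + - (2 * g) * t); last by ring.
rewrite expRD mulrA ler_wpM2r ?expR_ge0//.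
rewrite (_ : 3 * U * B = 2 * B * U * (3 / 2)); last by field.
apply: ler_pM => //.
  by rewrite !mulr_ge0// energy_ge0// ltW.
by rewrite ler_wpM2l ?mulr_ge0//; exact: energyU.
Qed.

(** By the eigenvalue equation [phi x] is [expR (g * tau)] times the inner product of [phi] with
    [P tau (delta x)], whose squared norm is at most [1 + U]. *)
Lemma eigenfunction_bound phi x : dot phi phi = 1 ->
  (forall x, gen1 phi x = - g * phi x) -> `|phi x| <= 3 / 2 * (1 + U).
Proof.
move=> phi2 hphi.
have gphi : gen1 phi = fun z => - g * phi z by apply/funext.
pose F s := expR (g * s) * dot phi (P s (delta x)).
have hF (s : R) : is_derive s 1 F 0.
  have hx y := is_derive_fscale (p y * phi y) (is_derive_walk (delta x) y s).
  have hd := is_derive_fmul (is_derive_expRM g s) (is_derive_fsum hx).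
  apply: is_derive_eq_pt hd _.
  have -> : P s (gen1 (delta x)) = gen1 (P s (delta x)).
    by apply/funext => z; rewrite semigroup_comm//; exact: lin_op_gen1.
  rewrite -/(dot phi (P s (delta x))) -/(dot phi (gen1 (P s (delta x)))).
  by rewrite -dot_gen1C gphi dotZl; ring.
have F0 : F tau = phi x.
  transitivity (F 0); first exact: is_derive_0_is_cst.
  rewrite /F mulr0 expR0 mul1r -[RHS]dot_delta; congr (dot _ _).
  by apply/funext => z; rewrite semigroup0.
rewrite -F0 /F normrM ger0_norm ?expR_ge0//.
have hP : dot (P tau (delta x)) (P tau (delta x)) <= 1 + U.
  apply: le_trans (norm_walk_le_energy _ (ltW tau_gt0)) _.
  by rewrite lerD2l; apply: energyU; exact: density_delta.
have e1 : expR (g * tau) <= 3 / 2.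
  apply: le_trans g_tau; rewrite ler_expR ler_pM2r//; have := g_gt0; lra.
apply: ler_pM => //.
set psi := P tau (delta x) in hP *.
(* AM-GM for the inner product, from the squared norms of [psi - phi] and [psi + phi]. *)
have hp := dot_ge0 (fun z => -1 * phi z + psi z).
have hq := dot_ge0 (fun z => 1 * phi z + psi z).
move: hp hq; rewrite !dotDl ![dot _ (fun z => _ + _)]dotC !dotDl phi2.
rewrite [dot psi phi]dotC => hp hq.
have U0 : 0 <= U by [].
by rewrite ler_norml; apply/andP; split; lra.
Qed.

End Regularised.

(** * Second moments and the lower bound *)

Section SecondMoment.
Variables (R : realType) (G : wgraph R) (k : nat).
Local Notation V := (vertex G).
Local Notation p := (@weight R G).
Local Notation lab := {ffun 'I_k -> V}.
Implicit Types (f h phi : V -> R) (u : lab).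

Lemma prod_mean_square h phi (c : R) : density h ->
  prod_mean (fun _ : 'I_k => h) (fun u => (\sum_i phi (u i) - c) ^+ 2) =
  k%:R * (dot h (fun x => phi x ^+ 2) - dot h phi ^+ 2) +
  (k%:R * dot h phi - c) ^+ 2.
Proof.
move=> hh; have h1 : dot h (fun=> 1) = 1 by rewrite dotC; case: hh.
(* [sel i] writes [phi (u i)] as a product over all particles, so that [prod_mean_prod] computes the
   moments. *)
pose sel (i j : 'I_k) : V -> R := if i == j then phi else fun=> 1.
have selE i u : phi (u i) = \prod_l sel i l (u l).
  rewrite (bigD1 i)//= /sel eqxx big1 ?mulr1// => l li.
  by rewrite eq_sym (negbTE li).
have m1 i : prod_mean (fun _ : 'I_k => h) (fun u => phi (u i)) = dot h phi.
  rewrite (_ : (fun u => _) = fun u => \prod_l sel i l (u l)); last first.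
    by apply/funext => u; exact: selE.
  rewrite prod_mean_prod (bigD1 i)//= /sel eqxx big1 ?mulr1// => l li.
  by rewrite eq_sym (negbTE li).
have m2 i j : prod_mean (fun _ : 'I_k => h) (fun u => phi (u i) * phi (u j)) =
    dot h phi ^+ 2 +
    (if i == j then dot h (fun x => phi x ^+ 2) - dot h phi ^+ 2 else 0).
  rewrite (_ : (fun u => _) = fun u =>
    \prod_l (fun x => sel i l x * sel j l x) (u l)); last first.
    by apply/funext => u; rewrite big_split/= -!selE.
  rewrite (prod_mean_prod (fun=> h) (fun l x => sel i l x * sel j l x)).
  have [<-|ij] := eqVneq i j.
    rewrite (bigD1 i)//= /sel eqxx big1 => [|l li].
      by rewrite mulr1 addrC subrK; congr (dot _ _); apply/funext => x;
        rewrite expr2.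
    by rewrite eq_sym (negbTE li) mulr1.
  rewrite (bigD1 i)//= (bigD1 j)/=; last by rewrite eq_sym.
  rewrite [X in _ * (_ * X)]big1 => [|l /andP[li lj]]; last first.
    by rewrite /sel eq_sym (negbTE li) eq_sym (negbTE lj) mulr1.
  rewrite /sel !eqxx (negbTE ij) [j == i]eq_sym (negbTE ij) mulr1 addr0 expr2.
  by congr (_ * _); congr (dot _ _); apply/funext => x; rewrite ?mulr1 ?mul1r.
have -> : (fun u : lab => (\sum_i phi (u i) - c) ^+ 2) = (fun u =>
    1 * (\sum_i 1 * (\sum_j 1 * (phi (u i) * phi (u j)))) +
    1 * ((- 2 * c) * (\sum_i 1 * phi (u i)) + c ^+ 2 * 1)).
  apply/funext => u.
  have -> : \sum_i 1 * phi (u i) = \sum_i phi (u i) by apply: eq_bigr => i _;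
    rewrite mul1r.
  have -> : \sum_i 1 * (\sum_j 1 * (phi (u i) * phi (u j))) =
      (\sum_i phi (u i)) * (\sum_i phi (u i)).
    rewrite mulr_suml; apply: eq_bigr => i _; rewrite mul1r mulr_sumr.
    by apply: eq_bigr => j _; rewrite mul1r.
  ring.
rewrite !prod_meanD !prod_mean_sum prod_mean1_density//.
have -> : \sum_i 1 * prod_mean (fun _ : 'I_k => h) (fun u => phi (u i)) = k%:R
  * dot h phi.
  under eq_bigr do rewrite m1 mul1r.
  by rewrite sumr_const card_ord mulr_natl.
have -> : \sum_i 1 * prod_mean (fun _ : 'I_k => h)
     (fun u => \sum_j 1 * (phi (u i) * phi (u j))) =
   k%:R * (k%:R * dot h phi ^+ 2 + (dot h (fun x => phi x ^+ 2) - dot h phi ^+ 2)).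
  transitivity (\sum_(i < k) (k%:R * dot h phi ^+ 2 +
     (dot h (fun x => phi x ^+ 2) - dot h phi ^+ 2))).
    apply: eq_bigr => i _; rewrite mul1r prod_mean_sum.
    under eq_bigr do rewrite mul1r m2.
    rewrite big_split/= sumr_const card_ord mulr_natl; congr (_ + _).
    by rewrite -big_mkcond (big_pred1 i)// => j; rewrite eq_sym.
  by rewrite sumr_const card_ord [RHS]mulr_natl.
ring.
Qed.

End SecondMoment.

Section LowerBound.
Variables (R : realType) (G : wgraph R) (k : nat).
Local Notation V := (vertex G).
Local Notation p := (@weight R G).
Local Notation g := (gap G).
Local Notation mean := (word_mean (@rate R G)).
Local Notation one := (fun=> fun=> 1 : R).

Variables (phi : V -> R) (Phi W : R).
Hypothesis V1 : (1 < #|V|)%N.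
Hypothesis k_gt0 : (0 < k)%N.
Hypothesis phi_mean : dot (fun=> 1) phi = 0.
Hypothesis phi_norm : dot phi phi = 1.
Hypothesis phi_eigen : forall x, gen1 phi x = - g * phi x.
Hypothesis Phi_ge1 : 1 <= Phi.
Hypothesis phi_le : forall x, `|phi x| <= Phi.
Hypothesis weightW : forall x, p x <= W.

Let g_gt0 : 0 < g.
Proof. by have [psi []] := gap_eigenfunction V1. Qed.

Let Phi_gt0 : 0 < Phi.
Proof. exact: lt_le_trans ltr01 Phi_ge1. Qed.

Let W_ge0 : 0 <= W.
Proof.
have [x _] := card_gt1P V1; apply: le_trans (weightW x); exact/ltW/weight_gt0.
Qed.

Let h0 : V -> R := fun z => Phi^-1 * phi z + 1.
Let X w := dot (run w h0) phi.

Let density_h0 : density h0.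
Proof.
split => [z|]; last by rewrite dotC dotDl dot11 [dot phi _]dotC phi_mean; ring.
have := phi_le z; rewrite ler_norml => /andP[h _].
rewrite /h0 (_ : Phi^-1 * phi z + 1 = Phi^-1 * (phi z + Phi)); last first.
  by field; rewrite gt_eqF.
by rewrite mulr_ge0 ?invr_ge0 ?(ltW Phi_gt0)//; lra.
Qed.

Let h0_phi : dot h0 phi = Phi^-1.
Proof. by rewrite dotDl phi_norm phi_mean; ring. Qed.

Let energy_h0 : energy h0 0 = Phi^-1 ^+ 2.
Proof.
rewrite /energy word_mean0 /= dotDl [dot phi _]dotC h0_phi.
have [_ ->] := density_h0; ring.
Qed.

Let bX : bounded_word X.
Proof. exact: bounded_word_dot_run. Qed.

Lemma gen_dot_eigen f : \sum_e rate e * (dot (resample e f) phi - dot f phi) =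
  - g * dot f phi.
Proof.
have <- : dot f (gen1 phi) = - g * dot f phi.
  by rewrite -dotZr; congr (dot _ _); apply/funext.
rewrite -dot_gen1C dot_gen1 -[RHS]sumrN; apply: eq_bigr => e _.
by rewrite dot_resample; ring.
Qed.

Lemma mean_projection (t : R) : mean t X = Phi^-1 * expR (- g * t).
Proof.
pose F s := expR (g * s) * mean s X.
have hF (s : R) : is_derive s 1 F 0.
  have hd := is_derive_fmul (is_derive_expRM g s)
    (is_derive_word_mean (@rate_ge0 R G) s bX).
  apply: is_derive_eq_pt hd _.
  have -> : word_gen (@rate R G) X = fun w => - g * X w.
    by apply/funext => w; exact: gen_dot_eigen.
  rewrite word_meanZ//; last exact: rate_ge0.
  ring.
have : F t = F 0 by exact: is_derive_0_is_cst.
rewrite /F mulr0 expR0 mul1r word_mean0 /X/= h0_phi => <-.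
rewrite mulrAC -expRD (_ : g * t + - g * t = 0) ?expR0 ?mul1r//; ring.
Qed.

(** The drift of [X ^+ 2] is [- (2 * g) * X ^+ 2] plus squared jumps. As [phi] varies by at most
    [2 * Phi] along an edge, these are at most [C = W * (2 * Phi) ^+ 2] times the dissipation, which
    is integrated by parts against [energy_decay] as in [energy_two_step]. *)
Lemma mean_projection_sqr (t : R) : 0 <= t ->
  mean t (fun w => X w ^+ 2) <= Phi^-1 ^+ 2 * expR (- (2 * g) * t) *
    (1 + 8 * W * Phi ^+ 2 * expR (g * t)).
Proof.
move=> t0; set C := 4 * W * Phi ^+ 2.
have C0 : 0 <= C by rewrite mulr_ge0 ?sqr_ge0// mulr_ge0.
have bX2 : bounded_word (fun w => X w ^+ 2).
  by under eq_fun do rewrite expr2; exact: bounded_wordM.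
have c0 := @rate_ge0 R G.
pose q s := mean s (fun w => X w ^+ 2).
pose dq s := mean s (word_gen (@rate R G) (fun w => X w ^+ 2)).
have hq (s : R) : is_derive s 1 q (dq s) by exact: is_derive_word_mean.
have dq_le (s : R) : 0 <= s -> dq s <= - (2 * g) * q s + C * dissipation h0 s.
  move=> s0; rewrite /dq /q /dissipation -!word_meanZ//; last first.
    exact: bounded_word_dirichlet_run.
  rewrite -word_meanD//; do ?exact: bounded_wordZ; last first.
    exact/bounded_wordZ/bounded_word_dirichlet_run.
  apply: word_mean_le => //; first exact: bounded_word_gen.
    by apply: bounded_wordD; apply: bounded_wordZ => //;
      exact: bounded_word_dirichlet_run.
  move=> w; rewrite /word_gen /X/= dirichletE mulr_sumr.
  set f := run w h0.
  have -> : - (2 * g) * dot f phi ^+ 2 =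
      \sum_e 2 * dot f phi * (rate e * (dot (resample e f) phi - dot f phi)).
    by rewrite -mulr_sumr gen_dot_eigen; ring.
  rewrite -big_split/=; apply: ler_sum => e _.
  rewrite dot_resample -subr_ge0.
  rewrite (_ : _ - _ = rate e * (qe e * grad e f ^+ 2 * (C - qe e * grad e phi
    ^+ 2))); last by ring.
  rewrite mulr_ge0// mulr_ge0//; first by rewrite mulr_ge0 ?qe_ge0 ?sqr_ge0.
  rewrite subr_ge0 /C (_ : 4 * W * Phi ^+ 2 = W * (2 * Phi) ^+ 2); last by ring.
  apply: ler_pM; rewrite ?qe_ge0 ?sqr_ge0//.
    exact: le_trans (qe_le e) (weightW _).
  rewrite -real_normK ?num_real// ler_sqr ?nnegrE ?mulr_ge0 ?(ltW Phi_gt0)//.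
  apply: le_trans (ler_normB _ _) _.
  have := phi_le e.1; have := phi_le e.2; lra.
pose m s := energy h0 s.
pose a := Phi^-1 ^+ 2.
pose J s := expR (2 * g * s) * q s + C * (expR (2 * g * s) * m s) - 2 * C * a *
  expR (g * s).
pose dJ s := 2 * g * expR (2 * g * s) * q s + expR (2 * g * s) * dq s +
  C * (2 * g * expR (2 * g * s) * m s + expR (2 * g * s) * - dissipation h0 s)
  - 2 * C * a * (g * expR (g * s)).
have : J t <= J 0.
  apply: (@is_derive_nonincreasing R J dJ 0 t t0).
    move=> s _.
    have he := is_derive_expRM (2 * g) s.
    exact: (is_derive_fsub (is_derive_fadd (is_derive_fmul he (hq s))
      (is_derive_fscale C (is_derive_fmul he (is_derive_energy h0 s))))
      (is_derive_fscale (2 * C * a) (is_derive_expRM g s))).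
  move=> s /andP[s0 _].
  have hm : m s <= a * expR (- g * s).
    have := energy_decay V1 (lexx 0) s0 (proj2 density_h0).
    by rewrite energy_h0 subr0.
  have hmE : expR (2 * g * s) * m s <= a * expR (g * s).
    apply: le_trans (ler_wpM2l (expR_ge0 _) hm) _.
    rewrite mulrCA -expRD le_eqVlt; apply/orP; left; apply/eqP.
    by congr (_ * expR _); ring.
  have h1 : expR (2 * g * s) * dq s <=
      expR (2 * g * s) * (- (2 * g) * q s + C * dissipation h0 s).
    by rewrite ler_wpM2l ?expR_ge0// dq_le.
  have h2 : 2 * g * C * (expR (2 * g * s) * m s) <= 2 * g * C * (a * expR (g * s)).
    by rewrite ler_wpM2l// mulr_ge0// mulr_ge0// ltW.
  rewrite /dJ; lra.
rewrite /J !mulr0 expR0 !mul1r mulr1 {2}/q word_mean0 {2}/m energy_h0 /X/= h0_phi.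
rewrite -/a => hJ.
have m0 : 0 <= C * (expR (2 * g * t) * m t).
  rewrite mulr_ge0// mulr_ge0 ?expR_ge0//; apply: energy_ge0 => //.
  by case: density_h0.
have a0 : 0 <= a by exact: sqr_ge0.
have Ca : 0 <= C * a by exact: mulr_ge0.
have hq2 : expR (2 * g * t) * q t <= a * (1 + 2 * C * expR (g * t)) by lra.
rewrite -/(q t); have -> : q t = expR (- (2 * g) * t) * (expR (2 * g * t) * q t).
  rewrite [RHS]mulrA -expRD (_ : - (2 * g) * t + 2 * g * t = 0) ?expR0 ?mul1r//.
  ring.
rewrite [leRHS](_ : _ = expR (- (2 * g) * t) * (a * (1 + 2 * C * expR (g *
  t)))); last first.
  by rewrite /C; ring.
by rewrite ler_wpM2l ?expR_ge0.
Qed.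

Lemma event_sum (c : R) (u : {ffun 'I_k -> V}) :
  event [set xi : config V k | c <= \sum_x (occ xi x)%:R * phi x]%SET (cfg u) =
  (c <= \sum_i phi (u i))%R%:R :> R.
Proof.
rewrite /event finset.inE; congr (nat_of_bool (_ <= _))%:R.
rewrite [RHS](partition_big u xpredT)//=; apply: eq_bigr => x _.
rewrite occ_cfg /load -sum1_card natr_sum mulr_suml; apply: eq_big => i.
  by rewrite finset.inE.
by rewrite finset.inE => /eqP ->; rewrite mul1r.
Qed.

(* Started from k independent particles of density 1 + phi / Phi, the sum of
   phi over the particles has a mean which exceeds its standard deviation. *)
Lemma worst_tv_lower (t : R) : 0 <= t ->
  1 - 8 * Phi ^+ 4 * (expR (2 * g * t) / k%:R) - 32 * W * Phi ^+ 2 * expR (g * t)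
  <= worst_tv G k t.
Proof.
move=> t0; pose c := Phi^-1 * expR (- g * t).
have c_gt0 : 0 < c by rewrite mulr_gt0 ?invr_gt0// expR_gt0.
have kR : 0 < k%:R :> R by rewrite ltr0n.
pose M := k%:R * c; have M_gt0 : 0 < M by exact: mulr_gt0.
(* The threshold is halfway between the means of the statistic, 0 in equilibrium and [M] at time
   [t]. Chebyshev's inequality on either side then has the factor [4 / M ^+ 2]. *)
pose A := [set xi : config V k | M / 2 <= \sum_x (occ xi x)%:R * phi x]%SET.
apply: le_trans (worst_tv_ge A t0 density_h0).
have FE : (fun u : {ffun 'I_k -> V} => event A (cfg u)) =
    (fun u => (M / 2 <= \sum_i phi (u i))%R%:R).
  by apply/funext => u; exact: event_sum.
rewrite FE.
set F := fun u : {ffun 'I_k -> V} => _%:R : R.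
have equil : prod_mean one F <= 4 / M ^+ 2 * k%:R.
  have hs := prod_mean_square k phi 0 (@density1 R G).
  have -> : 4 / M ^+ 2 * k%:R = prod_mean one (fun u : {ffun 'I_k -> V} =>
      4 / M ^+ 2 * (\sum_i phi (u i) - 0) ^+ 2).
    rewrite prod_meanZ hs phi_mean; congr (_ * _).
    have -> : dot (fun=> 1) (fun x => phi x ^+ 2) = dot phi phi.
      by apply: eq_bigr => x _; ring.
    by rewrite phi_norm; ring.
  apply: prod_mean_le; first by move=> i; exact: density1.
  move=> u; rewrite /F; case: (lerP (M / 2) (\sum_i phi (u i))) => hZ /=;
    last first.
    by rewrite mulr_ge0 ?sqr_ge0// divr_ge0 ?sqr_ge0.
  rewrite subr0 mulrAC ler_pdivlMr ?exprn_gt0// mul1r.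
  set Z := \sum_i _ in hZ *.
  have h2 : 0 <= 2 * Z - M by lra.
  rewrite -subr_ge0 (_ : _ - _ = (2 * Z - M) * (2 * Z + M)); last by ring.
  by rewrite mulr_ge0//; lra.
(* Given [w], the second moment about [M] is the variance of [k] independent terms bounded by [Phi],
   plus the square of the bias [k * (X w - c)]. *)
have far w : 1 - 4 / M ^+ 2 * (k%:R * Phi ^+ 2 + k%:R ^+ 2 * (X w - c) ^+ 2) <=
    prod_mean (fun=> run w h0) F.
  have hd := density_run w density_h0.
  have hs := prod_mean_square k phi M hd.
  have hsq : prod_mean (fun _ : 'I_k => run w h0)
      (fun u => (\sum_i phi (u i) - M) ^+ 2) <=
      k%:R * Phi ^+ 2 + k%:R ^+ 2 * (X w - c) ^+ 2.
    rewrite hs /M -mulrBr exprMn lerD2r ler_wpM2l ?ler0n// lerBlDr.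
    rewrite ler_wpDr ?sqr_ge0//.
    have -> : Phi ^+ 2 = dot (run w h0) (fun=> Phi ^+ 2 * 1).
      by rewrite dotZr dotC; case: hd => _ ->; rewrite mulr1.
    apply: ler_sum => x _; rewrite mulr1 ler_wpM2l//.
      by rewrite mulr_ge0 ?(ltW (weight_gt0 _))//; case: hd.
    rewrite -real_normK ?num_real// ler_sqr ?nnegrE ?(ltW Phi_gt0)//.
  have M2 : 0 <= 4 / M ^+ 2 by rewrite divr_ge0 ?sqr_ge0.
  apply: le_trans (_ : 1 - 4 / M ^+ 2 * prod_mean (fun _ : 'I_k => run w h0)
      (fun u => (\sum_i phi (u i) - M) ^+ 2) <= _).
    by rewrite lerD2l lerN2 ler_wpM2l.
  have h1 := @prod_mean1_density R G k (fun=> run w h0) (fun=> hd).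
  rewrite -{1}h1 -[X in X - _]mul1r -mulNr -prod_meanD.
  apply: prod_mean_le => // u; rewrite /F mulr1 mulNr.
  case: (lerP (M / 2) (\sum_i phi (u i))) => hZ /=.
    by rewrite lerBlDr lerDl mulr_ge0 ?sqr_ge0.
  rewrite subr_le0 mulrAC ler_pdivlMr ?exprn_gt0// mul1r.
  set Z := \sum_i _ in hZ *.
  have h2 : 0 <= M - 2 * Z by lra.
  rewrite -subr_ge0 (_ : _ - _ = (M - 2 * Z) * ((M - 2 * Z) + 2 * M)); last by ring.
  by rewrite mulr_ge0// addr_ge0// mulr_ge0// ltW.
have c0 := @rate_ge0 R G.
have bX2 : bounded_word (fun w => X w ^+ 2).
  by under eq_fun do rewrite expr2; exact: bounded_wordM.
(* [(X w - c) ^+ 2] without its constant term: a combination of the two moments of [X] already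
   controlled. *)
pose Y w := X w ^+ 2 + (- (2 * c)) * X w.
have bY : bounded_word Y by apply: bounded_wordD => //; exact: bounded_wordZ.
pose m0 := 1 - 4 / M ^+ 2 * (k%:R * Phi ^+ 2 + k%:R ^+ 2 * c ^+ 2).
pose m1 := - (4 / M ^+ 2 * k%:R ^+ 2).
have bZ : bounded_word (fun w => m0 + m1 * Y w).
  by apply: bounded_wordD; [exact: bounded_word_cst | exact: bounded_wordZ].
have farE w : m0 + m1 * Y w =
    1 - 4 / M ^+ 2 * (k%:R * Phi ^+ 2 + k%:R ^+ 2 * (X w - c) ^+ 2).
  by rewrite /m0 /m1 /Y; ring.
have hmean : m0 + m1 * (mean t (fun w => X w ^+ 2) - 2 * c * c) <=
    mean t (fun w => prod_mean (fun=> run w h0) F).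
  have -> : m0 + m1 * (mean t (fun w => X w ^+ 2) - 2 * c * c) =
      mean t (fun w => m0 + m1 * Y w).
    rewrite word_meanD//; last 2 first.
    - exact: bounded_word_cst.
    - exact: bounded_wordZ.
    rewrite word_mean_cst// word_meanZ// word_meanD//; last exact: bounded_wordZ.
    by rewrite word_meanZ// mean_projection -/c; ring.
  apply: word_mean_le => //; first exact: bounded_word_prod_mean.
  by move=> w; rewrite farE; exact: far.
have hvar := mean_projection_sqr t0.
have cE : Phi^-1 ^+ 2 * expR (- (2 * g) * t) = c ^+ 2.
  by rewrite /c exprMn -expRM_natl; congr (_ * expR _); ring.
rewrite cE in hvar.
have kM : k%:R ^+ 2 / M ^+ 2 = (c ^+ 2)^-1.
  by rewrite /M; field; rewrite !gt_eqF.
have m1_le0 : m1 <= 0.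
  by rewrite oppr_le0 mulr_ge0 ?sqr_ge0// divr_ge0 ?sqr_ge0.
have h3 : m1 * (mean t (fun w => X w ^+ 2) - 2 * c * c) >=
    m1 * (c ^+ 2 * (1 + 8 * W * Phi ^+ 2 * expR (g * t)) - 2 * c * c).
  by rewrite ler_wnM2l// lerD2r.
have m1E : m1 = - (4 / c ^+ 2).
  by rewrite /m1 /M; field; rewrite !gt_eqF.
have e1 : m0 + m1 * (c ^+ 2 * (1 + 8 * W * Phi ^+ 2 * expR (g * t)) - 2 * c * c) =
    1 - 4 * Phi ^+ 2 / (k%:R * c ^+ 2) - 32 * W * Phi ^+ 2 * expR (g * t).
  by rewrite m1E /m0 /M; field; rewrite !gt_eqF.
have cinv : (c ^+ 2)^-1 = Phi ^+ 2 * expR (2 * g * t).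
  rewrite -cE invfM -exprVn invrK -expRN; congr (_ * expR _); ring.
have e2 : 4 * Phi ^+ 2 / (k%:R * c ^+ 2) = 4 * Phi ^+ 4 * (expR (2 * g * t) / k%:R).
  by rewrite invfM cinv; ring.
have e3 : 4 / M ^+ 2 * k%:R = 4 * Phi ^+ 2 * (expR (2 * g * t) / k%:R).
  have -> : 4 / M ^+ 2 * k%:R = 4 * (c ^+ 2)^-1 / k%:R.
    by rewrite /M; field; rewrite !gt_eqF.
  by rewrite cinv; ring.
have e4 : 4 * Phi ^+ 2 * (expR (2 * g * t) / k%:R) <=
    4 * Phi ^+ 4 * (expR (2 * g * t) / k%:R).
  rewrite ler_wpM2r ?divr_ge0 ?expR_ge0 ?ler0n// ler_wpM2l//.
  by rewrite ler_weXn2l.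
rewrite e3 in equil; rewrite e2 in e1; lra.
Qed.

End LowerBound.

(** * Constants and the bounds at the cutoff time *)

Section Cutoff.
Variables (R : realType) (G : wgraph R) (k : nat).
Local Notation V := (vertex G).
Local Notation p := (@weight R G).
Local Notation g := (gap G).

(** The weights sum to 1, so the smallest of them is at most [1 / #|V|]. *)
Lemma weight_le (cell : R) x :
  sup (range (@weight R G)) / inf (range (@weight R G)) <= cell ->
  p x <= cell / #|V|%:R.
Proof.
move=> hcell; have V0 : (0 < #|V|)%N by apply/card_gt0P; exists x.
set s := sup _ in hcell; set i := inf _ in hcell.
have hlb : has_lbound (range p) by exists 0 => _ [y _ <-]; exact/ltW/weight_gt0.
have iP y : i <= p y by apply: ge_inf => //; exists y.
have i0 : 0 < i.
  have [y hy] : exists y, forall z, p y <= p z.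
    have [y _ hy] := arg_minP (P := xpredT) (i0 := x) p isT.
    by exists y => z; exact: hy.
  apply: lt_le_trans (weight_gt0 y) _; apply: lb_le_inf; first by exists (p y), y.
  by move=> _ [z _ <-].
have sx : p x <= s by exact: le_sup_range.
have in1 : i * #|V|%:R <= 1.
  rewrite -[leRHS](weight_sum1 G) mulr_natr -sumr_const; exact: ler_sum.
have c0 : 0 <= cell.
  apply: le_trans hcell; rewrite divr_ge0 ?(ltW i0)//.
  by apply: le_trans sx; exact/ltW/weight_gt0.
rewrite ler_pdivlMr ?ltr0n//; move: hcell; rewrite ler_pdivrMr// => hcell.
apply: (@le_trans _ _ (cell * i * #|V|%:R)).
  by rewrite ler_wpM2r// (le_trans sx).
by rewrite -mulrA ler_piMr.
Qed.

Section Constants.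
Variables (d D tNash T B1 B2 cell kappa : R).
Hypothesis V1 : (1 < #|V|)%N.
Hypothesis d_gt0 : 0 < d.
Hypothesis d_le : d <= D.
Hypothesis tNash_gt0 : 0 < tNash.
Hypothesis T_gt0 : 0 < T.
Hypothesis nash : nash_inequality G d tNash T.
Hypothesis B1_ge0 : 0 <= B1.
Hypothesis B2_ge0 : 0 <= B2.
Hypothesis tNash_trel : tNash <= B1 * trel G.
Hypothesis tNash_T : tNash <= B2 * T.
Hypothesis cell_ge1 : 1 <= cell.
Hypothesis elliptic : sup (range p) / inf (range p) <= cell.
Hypothesis k_gt0 : (0 < k)%N.
Hypothesis kappa_ge0 : 0 <= kappa.
Hypothesis k_le : k%:R <= (kappa * #|V|%:R) ^+ 2.

Let g_gt0 : 0 < g.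
Proof. by have [phi []] := gap_eigenfunction V1. Qed.

Let trel_gt0 : 0 < trel G.
Proof. by rewrite invr_gt0. Qed.

(** Chosen so that [2 * g * tau = 1 / 4], whose exponential is at most [1 + 2 / 4 = 3 / 2] by
    [expR_le_1D2x]. *)
Let tau := trel G / 8.

Let tau_gt0 : 0 < tau.
Proof. by rewrite divr_gt0. Qed.

Let gM_trel (a : R) : g * (a * trel G) = a.
Proof. by rewrite mulrCA mulfV ?mulr1// gt_eqF. Qed.

(** The exponential of the bound in [nash_energy] at the time [s = Num.min tau T], where
    [s / T <= 1] and [tNash <= (8 * B1 + B2) * s]. The 1 inside the logarithm makes it nonnegative,
    so that [d] may be replaced by [D]. *)
Definition energy_const : R := expR (1 + D / 2 * ln (1 + D * (8 * B1 + B2))).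

Let U := energy_const.

Let g_tau : expR (2 * g * tau) <= 3 / 2.
Proof.
rewrite (_ : 2 * g * tau = 4^-1).
  by apply: le_trans (expR_le_1D2x _ _) _; lra.
by rewrite -[RHS]gM_trel /tau; field.
Qed.

Let U_ge0 : 0 <= U.
Proof. exact: expR_ge0. Qed.

Lemma energy_le_const (h : V -> R) : density h -> energy h tau <= U.
Proof.
move=> hh; pose s := Num.min tau T.
have s0 : 0 < s by rewrite lt_min tau_gt0.
have sT : s <= T by rewrite ge_min lexx orbT.
have st : s <= tau by rewrite ge_min lexx.
apply: le_trans (energy_nonincreasing h (ltW s0) st) _.
have h1 : dot (fun=> 1) h = 1 by case: hh.
have E0 := energy_ge0 (ltW s0) h1.
have hn := nash_energy d_gt0 tNash_gt0 T_gt0 nash hh s0.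
have D0 : 0 < D by exact: lt_le_trans d_le.
have tNs : tNash <= (8 * B1 + B2) * s.
  rewrite /s; case: (leP tau T) => _.
    apply: (le_trans tNash_trel).
    rewrite (_ : trel G = 8 * tau); last by rewrite /tau; field.
    rewrite mulrA ler_pM2r// mulrC lerDl//.
  by apply: (le_trans tNash_T); rewrite ler_pM2r// lerDr mulr_ge0.
set Y := 1 + D * (8 * B1 + B2).
have B0 : 0 <= 8 * B1 + B2 by rewrite addr_ge0// mulr_ge0.
have Y1 : 1 <= Y by rewrite lerDl mulr_ge0// ltW.
have hX : d * tNash / (2 * s) <= Y.
  rewrite ler_pdivrMr ?mulr_gt0//.
  apply: (@le_trans _ _ (D * ((8 * B1 + B2) * s))).
    by apply: ler_pM => //; exact: ltW.
  rewrite mulrA; apply: ler_pM => //; rewrite ?mulr_ge0 ?(ltW s0) ?(ltW D0)//.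
    by rewrite lerDr.
  lra.
have lnY : 0 <= ln Y by exact: ln_ge0.
have hln : d / 2 * ln (d * tNash / (2 * s)) <= D / 2 * ln Y.
  apply: (@le_trans _ _ (d / 2 * ln Y)).
    rewrite ler_pM2l ?divr_gt0// ler_ln ?posrE ?divr_gt0 ?mulr_gt0//.
    exact: lt_le_trans Y1.
  by rewrite ler_wpM2r// ler_pM2r// invr_gt0.
have sT1 : s / T <= 1 by rewrite ler_pdivrMr// mul1r.
have : 1 + energy h s <= U.
  rewrite -[leLHS]lnK ?posrE ?ltr_wpDr// ler_expR; apply: (le_trans hn).
  by rewrite lerD.
by apply: le_trans; rewrite lerDr.
Qed.

Let n : R := #|V|%:R.

Let n_ge1 : 1 <= n.
Proof. by rewrite ler1n (leq_trans _ V1). Qed.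

Let W := cell / n.

Let weightW x : p x <= W.
Proof. exact: weight_le. Qed.

(** The square root of [k], in the form in which the cutoff time produces it. *)
Let r : R := expR (ln k%:R / 2).

Let r_sqr : r ^+ 2 = k%:R.
Proof. by rewrite -expRM_natl mulrC divfK// lnK// posrE ltr0n. Qed.

Let r_le : r <= kappa * n.
Proof.
by rewrite -ler_sqr ?nnegrE ?expR_ge0 ?mulr_ge0// r_sqr.
Qed.

Let n0 : n != 0.
Proof. by rewrite gt_eqF// (lt_le_trans ltr01). Qed.

Let rn : r / n <= kappa.
Proof. by rewrite ler_pdivrMr// (lt_le_trans ltr01). Qed.

Let g_cutoff (C : R) : g * cutoff_time G k C = ln k%:R / 2 + C.
Proof.
rewrite /cutoff_time mulrDr gM_trel; congr (_ + _).
by rewrite -[RHS]gM_trel; congr (_ * _); ring.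
Qed.

Let exp_g (C : R) : expR (g * cutoff_time G k C) = r * expR C.
Proof. by rewrite g_cutoff expRD. Qed.

Let exp_2g (C : R) : expR (2 * g * cutoff_time G k C) = k%:R * expR C ^+ 2.
Proof. by rewrite -mulrA expRM_natl exp_g exprMn r_sqr. Qed.

(** At this time [k%:R * expR (- (2 * g) * t)] is [expR (- C) ^+ 2], while the correction
    [W * expR (g * t)] is at most [cell * kappa * expR C]. The correction thus costs one of the two
    factors [expR (- C)]. *)
Lemma cutoff_upper (C delta : R) : 1 <= C -> 0 < delta ->
  worst_tv G k (cutoff_time G k C) <= delta / 2 + delta^-1 *
    (3 * U * (1 + 6 * cell * (1 + U) * (1 + 2 * kappa)) * expR (- C)).
Proof.
move=> C1 delta0; set t := cutoff_time G k C.
have lnk : 0 <= ln k%:R :> R by rewrite ln_ge0// ler1n.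
have taut : tau <= t.
  rewrite /t /cutoff_time /tau -subr_ge0.
  rewrite (_ : _ - _ = trel G * (ln k%:R / 2 + C - 8^-1)); last by field.
  rewrite mulr_ge0 ?(ltW trel_gt0)//.
  have : 0 <= ln k%:R / 2 :> R by rewrite divr_ge0.
  move=> h; lra.
have t0 : 0 <= t by apply: le_trans taut; exact: ltW.
pose M := 3 * U * (1 + 6 * W * (1 + U) * (1 + 2 * expR (g * t))) *
  expR (- (2 * g) * t).
apply: le_trans (worst_tv_le k t0 delta0 (M := M) _) _.
  by move=> x; apply: (energy_upper V1 tau_gt0 g_tau U_ge0 energy_le_const
    weightW _ taut);
    exact: density_delta.
rewrite lerD2l ler_wpM2l ?invr_ge0 ?(ltW delta0)//.
pose E := expR C.
have E1 : 1 <= E by rewrite -expR0 ler_expR (le_trans ler01).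
have E0 : 0 < E := expR_gt0 C.
have kR : 0 < k%:R :> R by rewrite ltr0n.
have -> : expR (- C) = E^-1 by rewrite expRN.
have kM : k%:R * M = 3 * U * (1 + 6 * W * (1 + U) * (1 + 2 * (r * E))) * E ^- 2.
  rewrite /M exp_g mulNr expRN exp_2g -/E; field.
  by rewrite !gt_eqF.
rewrite kM.
have hin : 1 + 6 * W * (1 + U) * (1 + 2 * (r * E)) <=
    E * (1 + 6 * cell * (1 + U) * (1 + 2 * kappa)).
  rewrite [leRHS]mulrDr mulr1 lerD//.
  rewrite (_ : 6 * W * (1 + U) * (1 + 2 * (r * E)) =
    6 * cell * (1 + U) * (n^-1 + 2 * (r / n * E))); last by rewrite /W; field.
  rewrite [leRHS]mulrCA ler_wpM2l//.
    by rewrite !mulr_ge0// ?addr_ge0// (le_trans ler01).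
  have ninv : n^-1 <= 1 by rewrite invf_le1// (lt_le_trans ltr01).
  have h := ler_wpM2r (ltW E0) rn.
  rewrite mulrDr mulr1; lra.
have -> : 3 * U * (1 + 6 * cell * (1 + U) * (1 + 2 * kappa)) / E =
    3 * U * (E * (1 + 6 * cell * (1 + U) * (1 + 2 * kappa))) * E ^- 2.
  by field; rewrite gt_eqF.
rewrite ler_wpM2r ?invr_ge0 ?exprn_ge0 ?(ltW E0)// ler_wpM2l// mulr_ge0//.
Qed.

(** The bound on [C] keeps the time nonnegative. With [E := expR (- C)], the two errors of
    [worst_tv_lower] are of order [E ^+ 2] and [kappa * E]. *)
Lemma cutoff_lower (C : R) : 0 <= C -> C <= ln k%:R / 2 ->
  1 - (8 * (3 / 2 * (1 + U)) ^+ 4 + 32 * cell * kappa * (3 / 2 * (1 + U)) ^+ 2) *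
      expR (- C) <= worst_tv G k (cutoff_time G k (- C)).
Proof.
move=> C0 Ck; set t := cutoff_time G k (- C).
have t0 : 0 <= t.
  rewrite /t /cutoff_time (_ : _ + _ = trel G * (ln k%:R / 2 - C)); last by field.
  by rewrite mulr_ge0 ?(ltW trel_gt0)// subr_ge0.
have [phi [phi1 phi2 _ phiE _]] := gap_eigenfunction V1.
pose Phi := 3 / 2 * (1 + U).
have U0 : 0 <= U by [].
have Phi1 : 1 <= Phi by rewrite /Phi; lra.
have Phi0 : 0 <= Phi by exact: le_trans ler01 Phi1.
have phi_le x : `|phi x| <= Phi.
  exact: (eigenfunction_bound V1 tau_gt0 g_tau U_ge0 energy_le_const).
have := worst_tv_lower V1 k_gt0 phi1 phi2 phiE Phi1 phi_le weightW t0.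
apply: le_trans; rewrite -/Phi exp_2g exp_g.
pose E := expR (- C); rewrite -/E.
have E0 : 0 <= E := expR_ge0 _.
have E1 : E <= 1 by rewrite -expR0 ler_expR oppr_le0.
have -> : k%:R * E ^+ 2 / k%:R = E ^+ 2.
  by rewrite mulrAC mulfV ?mul1r// pnatr_eq0 -lt0n.
have hE : E ^+ 2 <= E by rewrite expr2 ler_piMr.
have h1 : 8 * Phi ^+ 4 * E ^+ 2 <= 8 * Phi ^+ 4 * E.
  by rewrite ler_wpM2l// mulr_ge0// exprn_ge0.
have h2 : 32 * W * Phi ^+ 2 * (r * E) <= 32 * cell * kappa * Phi ^+ 2 * E.
  rewrite (_ : 32 * W * Phi ^+ 2 * (r * E) = 32 * cell * Phi ^+ 2 * E * (r /
    n)); last first.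
    by rewrite /W; field.
  rewrite (_ : 32 * cell * kappa * Phi ^+ 2 * E = 32 * cell * Phi ^+ 2 * E *
    kappa); last by ring.
  rewrite ler_wpM2l// mulr_ge0// mulr_ge0 ?sqr_ge0// mulr_ge0//.
  exact: le_trans ler01 cell_ge1.
lra.
Qed.

End Constants.
End Cutoff.

(** * Asymptotics *)

Lemma limn_esup_le_near (R : realType) (u : nat -> R) (c : R) :
  (\forall n \near \oo, u n <= c) ->
  (limn_esup (fun n => (u n)%:E) <= c%:E)%E.
Proof.
move=> hu; rewrite /limn_esup limf_esupE.
apply: (@le_trans _ _ (ereal_sup ((fun n => (u n)%:E) @` [set n | u n <= c]))).
  by apply: ereal_inf_lbound; exists [set n | u n <= c].
by apply: ge_ereal_sup => _ [n /= hn <-]; rewrite lee_fin.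
Qed.

Lemma limn_einf_ge_near (R : realType) (u : nat -> R) (c : R) :
  (\forall n \near \oo, c <= u n) ->
  (c%:E <= limn_einf (fun n => (u n)%:E))%E.
Proof.
move=> hu; rewrite /limn_einf leeNr.
have := @limn_esup_le_near R (fun n => - u n) (- c).
apply; near=> n; rewrite lerN2; near: n; exact: hu.
Unshelve. all: by end_near. Qed.

Lemma near_le_limn_esup (R : realType) (u : nat -> R) (c c' : R) : c < c' ->
  (limn_esup (fun n => (u n)%:E) <= c%:E)%E ->
  \forall n \near \oo, u n <= c'.
Proof.
move=> cc'; rewrite /limn_esup limf_esupE => h.
have /ereal_inf_lt[_ [A hA <-] hlt] : (ereal_inf
    [set ereal_sup ((fun n => (u n)%:E) @` A) | A in \oo] < c'%:E)%E.
  by apply: le_lt_trans h _; rewrite lte_fin.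
near=> n; rewrite -lee_fin; apply: le_trans (ltW hlt).
apply: ereal_sup_ubound; exists n => //; near: n; exact: hA.
Unshelve. all: by end_near. Qed.

Lemma eqO_near (R : realType) (f h : nat -> R) : f =O_\oo h ->
  exists2 B : R, 0 < B & \forall n \near \oo, `|f n| <= B * `|h n|.
Proof. by move=> /eqO_exP. Qed.

Theorem theorem2p3 (R : realType) (G : nat -> wgraph R) (k : nat -> nat)
    (hV : forall n, (1 < n)%N -> #|vertex (G n)| = n)
    (hA : finite_dimensional G)
    (hB : uniformly_elliptic G)
    (hk : k @ \oo --> \oo)
    (hvol : exists2 cvol : R, 0 <= cvol &
      (limn_esup (fun n => ((k n)%:R / n%:R ^+ 2)%:E) <= cvol%:E)%E)
    (delta : R) (hdelta : 0 < delta < 1) :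
  exists2 C : R, 0 < C &
    (limn_esup (fun n =>
        (worst_tv (G n) (k n) (cutoff_time (G n) (k n) C))%:E) <= delta%:E)%E
    /\
    ((1 - delta)%:E <= limn_einf (fun n =>
        (worst_tv (G n) (k n) (cutoff_time (G n) (k n) (- C)))%:E))%E.
Proof.
have [d [tNash [T [hnash hd htN hT]]]] := hA.
have [cell cell1 hcell] := hB.
have [cvol cvol0 hcvol] := hvol.
case/andP: hdelta => delta0 delta1.
have [D D0 {}hd] := eqO_near hd.
have [B1 B10 {}htN] := eqO_near htN.
have [B2 B20 hT'] : exists2 B : R, 0 < B &
    \forall n \near \oo, `|tNash n| <= B * `|T n|.
  by move: hT; rewrite Theta_sym eqThetaE bigThetaE => -[/eqO_near].
have hk1 m : \forall n \near \oo, (m <= k n)%N by exact: (hk _ (nbhs_infty_ge m)).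
have hkv : \forall n \near \oo, (k n)%:R / n%:R ^+ 2 <= cvol + 1.
  by apply: near_le_limn_esup hcvol; rewrite ltrDl.
(* The room of 1 above the limit superior makes the bound hold eventually. It also gives
   [kappa <= kappa ^+ 2], so that [k <= (kappa * n) ^+ 2] needs no square root. *)
pose kappa : R := cvol + 1.
have kappa1 : 1 <= kappa by rewrite lerDr.
pose U := energy_const D B1 B2.
have U0 : 0 <= U by exact: expR_ge0.
pose a1 := 3 * U * (1 + 6 * cell * (1 + U) * (1 + 2 * kappa)).
pose a2 := 8 * (3 / 2 * (1 + U)) ^+ 4 + 32 * cell * kappa * (3 / 2 * (1 + U)) ^+ 2.
have a10 : 0 <= a1.
  rewrite /a1 mulr_ge0// ?mulr_ge0// addr_ge0// mulr_ge0//; last lra.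
  by rewrite !mulr_ge0//; lra.
have a20 : 0 <= a2.
  rewrite /a2 addr_ge0// mulr_ge0 ?sqr_ge0 ?exprn_ge0//;
    last by rewrite !mulr_ge0//; lra.
  by rewrite mulr_ge0//; lra.
(* The second term makes [a1 / (delta * b)] at most [delta / 2], the third makes [a2 / b] at most
   [delta], and the 1 makes [ln b] nonnegative. *)
pose b := 1 + 2 * a1 / delta ^+ 2 + a2 / delta.
have b1 : 1 <= b.
  have h1 : 0 <= 2 * a1 / delta ^+ 2 by rewrite divr_ge0 ?sqr_ge0// mulr_ge0.
  have h2 : 0 <= a2 / delta by rewrite divr_ge0// ltW.
  rewrite /b; lra.
pose C := 1 + ln b.
have C1 : 1 <= C by rewrite lerDl ln_ge0.
have bC : expR (- C) <= b^-1.
  rewrite expRN lef_pV2 ?posrE ?expR_gt0 ?(lt_le_trans ltr01)//.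
  rewrite -[leLHS]lnK ?posrE ?(lt_le_trans ltr01)// ler_expR lerDr//.
have b0 : 0 < b by exact: lt_le_trans b1.
have e1 : delta^-1 * (a1 * expR (- C)) <= delta / 2.
  rewrite ler_pdivrMl// (le_trans (ler_wpM2l a10 bC))// ler_pdivrMr//.
  rewrite /b.
  have -> : delta * (delta / 2) * (1 + 2 * a1 / delta ^+ 2 + a2 / delta) =
    a1 + (delta ^+ 2 / 2 + delta * a2 / 2) by field; rewrite gt_eqF.
  rewrite lerDl addr_ge0// divr_ge0 ?mulr_ge0 ?sqr_ge0 ?(ltW delta0)//.
have e2 : a2 * expR (- C) <= delta.
  rewrite (le_trans (ler_wpM2l a20 bC))// ler_pdivrMr// /b.
  have -> : delta * (1 + 2 * a1 / delta ^+ 2 + a2 / delta) =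
    a2 + (delta + 2 * a1 / delta) by field; rewrite gt_eqF.
  have h : 0 <= 2 * a1 / delta.
    by apply: divr_ge0 (ltW delta0); exact: mulr_ge0.
  by rewrite lerDl; lra.
have hlnk : \forall n \near \oo, C <= ln (k n)%:R / 2.
  have [m hm] : exists m, expR (2 * C) <= m%:R.
    exists (Num.bound (expR (2 * C))); apply/ltW/archi_boundP; exact: expR_ge0.
  near=> n.
  have mk : (m <= k n)%N by near: n; exact: hk1.
  rewrite ler_pdivlMr// mulrC -ler_expR lnK ?posrE.
    by rewrite (le_trans hm)// ler_nat.
  by apply: lt_le_trans (expR_gt0 (2 * C)) _; rewrite (le_trans hm)// ler_nat.
exists C; first exact: lt_le_trans ltr01 C1.
have hbounds : \forall n \near \oo,
    worst_tv (G n) (k n) (cutoff_time (G n) (k n) C) <= delta /\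
    1 - delta <= worst_tv (G n) (k n) (cutoff_time (G n) (k n) (- C)).
  near=> n.
  have n1 : (1 < n)%N by near: n; exact: nbhs_infty_gt.
  have Vn := hV n n1; have V1 : (1 < #|vertex (G n)|)%N by rewrite Vn.
  have [d0 t0 T0 nash] := hnash n n1.
  have dD : d n <= D.
    have : `|d n| <= D * `|1 : R| by near: n; exact: hd.
    by rewrite normr1 mulr1; apply: le_trans; exact: ler_norm.
  have trel0 : 0 < trel (G n).
    by have [phi [_ _ g0 _ _]] := gap_eigenfunction V1; rewrite invr_gt0.
  have tB1 : tNash n <= B1 * trel (G n).
    have : `|tNash n| <= B1 * `|trel (G n)| by near: n; exact: htN.
    by rewrite (gtr0_norm trel0); apply: le_trans; exact: ler_norm.
  have tB2 : tNash n <= B2 * T n.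
    have : `|tNash n| <= B2 * `|T n| by near: n; exact: hT'.
    by rewrite (gtr0_norm T0); apply: le_trans; exact: ler_norm.
  have k0 : (0 < k n)%N by near: n; exact: (hk1 1%N).
  have nR : 0 < n%:R :> R by rewrite ltr0n ltnW.
  have kle : (k n)%:R <= (kappa * #|vertex (G n)|%:R) ^+ 2.
    have : (k n)%:R / n%:R ^+ 2 <= cvol + 1 by near: n; exact: hkv.
    rewrite ler_pdivrMr ?exprn_gt0// Vn exprMn => /le_trans; apply.
    by rewrite ler_wpM2r ?sqr_ge0// -/kappa expr2 ler_peMl// (le_trans ler01).
  have Ck : C <= ln (k n)%:R / 2 by near: n; exact: hlnk.
  have kappa0 : 0 <= kappa by exact: le_trans ler01 kappa1.
  split.
    apply: le_trans (cutoff_upper V1 d0 dD t0 T0 nash (ltW B10) (ltW B20) tB1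
      tB2 cell1 (hcell n n1) k0 kappa0 kle C1 delta0) _.
    rewrite -/U -/a1; lra.
  apply: le_trans (cutoff_lower V1 d0 dD t0 T0 nash (ltW B10) (ltW B20) tB1
      tB2 cell1 (hcell n n1) k0 kappa0 kle (le_trans ler01 C1) Ck).
  rewrite -/U -/a2; lra.
split.
  by apply: limn_esup_le_near; near=> n; near: n; apply: filterS hbounds => n [].
by apply: limn_einf_ge_near; near=> n; near: n; apply: filterS hbounds => n [].
Unshelve. all: by end_near. Qed.
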